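(* There exists $C$ such that for every $h\in\,]0,1]$, every $0<a\le h^{1/2}$ and every $t\in[-1,1]$, $$\bigl\|\mathbf 1_{x\le a}\,u_{a,h}(t,x,y)\bigr\|_{L^\infty}\le C\,h^{-2}\min\Bigl(1,\ h^{1/4}+\bigl(\tfrac{h}{|t|}\bigr)^{1/3}\Bigr),$$ where $u_{a,h}(t,\cdot)=e^{-it\sqrt{-\Delta_g}}\,\psi_2(h\sqrt{-\Delta_g})\,\psi_1(hD_y)\,\delta_{x=a,y=0}$.
   Context: $\Omega=\{(x,y)\in\mathbb{R}^2: x>0\}$ with $\Delta_g=\partial_x^2+(1+x)\partial_y^2$ and Dirichlet condition on $x=0$ (self-adjoint on $L^2(dx\,dy)$); $D_y=\frac1i\partial_y$; the $L^\infty$ norm is over $(x,y)\in\Omega$. Let $-\omega_k$, $k\ge1$, be the zeros of the Airy function $\mathrm{Ai}$ in decreasing order and $\lambda_k(\eta)=\eta^2+\omega_k\eta^{4/3}$. The eigenfunctions of $-\partial_x^2+(1+x)\eta^2$ on $x>0$ with Dirichlet condition are $e_k(x,\eta)=f_k\frac{\eta^{1/3}}{k^{1/6}}\mathrm{Ai}(\eta^{2/3}x-\omega_k)$, with $f_k>0$ normalizing $e_k$ in $L^2([0,\infty[)$. Here $\psi_1,\psi_2\in C_0^\infty(]0,\infty[)$ are fixed such that on the support of $\psi_1(h\eta)\psi_2(h\sqrt{\lambda_k(\eta)})$ one has $k\le\varepsilon h^{-1}$ with $\varepsilon>0$ a small fixed constant. Explicitly, $$u_{a,h}(t,x,y)=\sum_{k\ge1}\frac1{2\pi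 h}\int e^{\frac ih(y\eta-t\eta\sqrt{1+\omega_k(h/\eta)^{2/3}})}\psi_2\bigl(\eta\sqrt{1+\omega_k(h/\eta)^{2/3}}\bigr)\psi_1(\eta)\,e_k(a,\eta/h)\,e_k(x,\eta/h)\,d\eta.$$ *)

(* Defs.v *)
From HB Require Import structures.
From mathcomp Require Import all_boot all_order all_algebra.
From mathcomp Require Import all_classical all_reals all_analysis.
From mathcomp Require Import complex.

Set Implicit Arguments.
Unset Strict Implicit.
Unset Printing Implicit Defensive.

Import Order.TTheory GRing.Theory Num.Theory.
Import numFieldNormedType.Exports.

Local Open Scope classical_set_scope.
Local Open Scope ring_scope.
Local Open Scope complex_scope.

Section Complex.
Context {R : realType}.

Definition expi (theta : R) : R[i] := cos theta +i* sin theta.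

Definition Cmodulus (z : R[i]) : R := ComplexField.Normc.normc z.

Definition Cintegral (F : R -> R[i]) : R[i] :=
  (\int[lebesgue_measure]_eta complex.Re (F eta)) +i*
  (\int[lebesgue_measure]_eta complex.Im (F eta)).

(* Sum of z k over k >= 1. *)
Definition Cseries (z : nat -> R[i]) : R[i] :=
  limn (fun n : nat => \sum_(1 <= k < n) complex.Re (z k)) +i*
  limn (fun n : nat => \sum_(1 <= k < n) complex.Im (z k)).

Definition smooth (g : R -> R) : Prop :=
  forall (n : nat) (x : R), derivable (derive1n n g) x 1.

(* The space C_0^infty(]0,oo[) of complex-valued test functions, each extended
   by 0 to R: the support is contained in a compact [c, d] of ]0,oo[. *)
Definition test_function_pos (psi : R -> R[i]) : Prop :=
  [/\ smooth (fun x => complex.Re (psi x)),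
      smooth (fun x => complex.Im (psi x)) &
      exists c d : R, 0 < c /\ forall x, psi x != 0 -> c <= x <= d].

End Complex.

Section Airy.
Context {R : realType}.

(* Ai z = (1 / pi) * int_0^oo cos (s^3 / 3 + z s) ds. The integral is only
   conditionally convergent, hence the limit of proper integrals. *)
Definition airy (z : R) : R :=
  pi^-1 * lim ((\int[lebesgue_measure]_(s in `[0, A])
                  cos (s ^+ 3 / 3 + z * s)) @[A --> +oo]).

(* (- om k), k >= 1, lists all the zeros of Ai in decreasing order;
   om 0 is irrelevant. *)
Definition airy_zeros (om : nat -> R) : Prop :=
  [/\ forall k, (1 <= k)%N -> airy (- om k) = 0,
      forall k l, (1 <= k)%N -> (k < l)%N -> - om l < - om k &
      forall z, airy z = 0 -> exists2 k, (1 <= k)%N & z = - om k].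

End Airy.

Section Friedlander.
Context {R : realType}.

Definition lambda (om : nat -> R) (k : nat) (eta : R) : R :=
  eta ^+ 2 + om k * eta `^ (4 / 3).

Definition eigenfun (om f : nat -> R) (k : nat) (x eta : R) : R :=
  f k * (eta `^ 3^-1 / k%:R `^ 6^-1) * airy (eta `^ (2 / 3) * x - om k).

(* f k > 0 makes e_k(., eta) a unit vector of L^2([0,oo[), for every eta > 0. *)
Definition normalizing (om f : nat -> R) : Prop :=
  forall k, (1 <= k)%N -> 0 < f k /\
    forall eta, 0 < eta ->
      (\int[lebesgue_measure]_(x in `[0%R, +oo[)
         ((eigenfun om f k x eta) ^+ 2)%:E = 1)%E.

(* On the support of psi1 (h eta) psi2 (h sqrt (lambda_k eta)),
   one has k <= eps / h. *)
Definition mode_cutoff (om : nat -> R) (eps : R) (psi1 psi2 : R -> R[i]) :=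
  forall (h : R) (k : nat) (eta : R), 0 < h <= 1 -> (1 <= k)%N ->
    psi1 (h * eta) * psi2 (h * Num.sqrt (lambda om k eta)) != 0 ->
    k%:R <= eps * h^-1.

(* Kernel of exp(-it sqrt(-Delta_g)) psi2(h sqrt(-Delta_g)) psi1(h D_y) at the
   source (a, 0): expansion in the eigenfunctions e_k(., eta / h) after a
   rescaled Fourier transform in y. Since psi1 vanishes outside ]0,oo[, only
   eta > 0 contributes to the integral. *)
Definition green (om f : nat -> R) (psi1 psi2 : R -> R[i])
    (a h t x y : R) : R[i] :=
  Cseries (fun k =>
    (1 / (2 * pi * h))%:C *
    Cintegral (fun eta =>
      let rho := eta * Num.sqrt (1 + om k * (h / eta) `^ (2 / 3)) in
      expi (h^-1 * (y * eta - t * rho)) * psi2 rho * psi1 eta *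
      (eigenfun om f k a (eta / h))%:C * (eigenfun om f k x (eta / h))%:C)).

Definition Omega : set (measurableTypeR R * measurableTypeR R) :=
  [set p | 0 < (p.1 : R)].

Lemma measurable_Omega : measurable Omega.
Proof.
have -> : Omega = (`]0, +oo[%classic : set R) `*` setT.
  by apply/seteqP; split=> -[x y]; rewrite /Omega /= in_itv /= andbT //; case.
by apply: measurableX => //; exact: measurable_itv.
Qed.

Definition muOmega :=
  mrestr (lebesgue_measure \x lebesgue_measure)%E measurable_Omega.

Definition LinftyOmega (v : R -> R -> R[i]) : \bar R :=
  Lnorm muOmega +oo%E (fun p => (Cmodulus (v p.1 p.2))%:E).

End Friedlander.

(* Main.v *)
Require Import Defs.
From mathcomp Require Import all_boot all_order all_algebra.
From mathcomp Require Import all_classical all_reals all_analysis.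
From mathcomp Require Import complex measurable_realfun.
From mathcomp Require Import ring lra.

Set Implicit Arguments.
Unset Strict Implicit.
Unset Printing Implicit Defensive.

Import Order.TTheory GRing.Theory Num.Theory.
Import numFieldNormedType.Exports.

Local Open Scope classical_set_scope.
Local Open Scope ring_scope.

(** Expanding over the modes, the kernel is a sum of one-dimensional oscillatory
    integrals in [eta]. The Airy equation is obtained by passing to the limit in
    the truncated Airy integrals; the Liouville transform of its solution then
    gives a polar form [Ai (- s) = s^(-1/4) (al cos xi + be sin xi)] with
    [xi = (2/3) s^(3/2)] and slowly varying [al], [be], hence
    [f k ^ 2 k^(-1/3) = O(om k ^(-1/2))], and the equation alone forces the gaps
    [om (k+1) - om k >= om (k+1)^(-1/2)].

    Bounding absolutely the modes with [om k <= L], where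
    [sum_k om_k^(-1/2) Ai^2 (b - om_k) = O(L^(1/2))] uniformly in [b], yields
    [h^(-2)] when [L ~ h^(-2/3)] (all the modes seen by [psi2]), and
    [h^(-2) h^(1/4)] when [L ~ h^(-1/6)]. For larger [om k], [a <= h^(1/2)] keeps
    both Airy factors in the oscillating regime. The second derivative of each
    phase is [th / (9 h eta^(4/3)) G], [th = om_k h^(2/3)], where [G] is [t] times
    a decreasing positive function of [eta], plus reflection terms that are,
    according to the sign of the one with [a], either nonnegative or
    nonincreasing. So either [G] is bounded below by [c t] or its derivative is
    at most [- c t], and van der Corput's lemma gains [(h / (th |t|))^(1/3)] in
    all cases, uniformly in [x], [y] and [a]. Summing this gain over the modes
    gives [h^(-2) (h / |t|)^(1/3)]. *)

(** * Derivatives and primitives *)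

(** The threshold [h^(-1/6)] comes from the source: for [x <= a <= h^(1/2)] the shifts
    [(eta/h)^(2/3) a] and [(eta/h)^(2/3) x] are [O(h^(-1/6))], so above a large multiple of it both
    Airy arguments keep a size at least [om_k / 2]. The low modes cost
    [h^(-1) h^(-2/3) L^(1/2) = h^(-7/4)]. A high mode costs [h^(-5/3) om_k^(-1) (om_k |t| /
    h^(1/3))^(-1/3)], one factor [om_k^(-1/2)] coming from the normalization and one from the two
    Airy amplitudes; the sum of [om_k^(-4/3)] up to [h^(-2/3)] is [O(h^(-1/9))]. The exponents [1/4]
    and [1/9] are why the final estimates use [h = chi^36]: every power of [h] is then an integer
    power of [chi]. Global information on Ai is drawn from the normalization: [s y^2 + y'^2] is a
    primitive of [y^2] along [y'' = - s y], so a finite [L^2] norm bounds this energy below, which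
    gives decay on one side and the size of [f k] on the other. The obstacle in the phase is that
    its third derivative has no definite sign because of the factor [eta^(-4/3)]; the third-order
    test is therefore applied to a second derivative written as a product, and differentiates only
    the factor [G]. *)

Section Calculus.
Context {R : realType}.
Implicit Types (f g : R -> R) (a b x y l : R).

(* Unlike [is_derive], not a class: derivatives are composed by syntax-directed
   application of the rules below, without instance search. *)
Definition der f x l : Prop := is_derive x (1 : R) f l.

Lemma der_eq f x l l' : der f x l -> l = l' -> der f x l'.
Proof. by move=> h <-. Qed.

Lemma der_ext f g x l : f =1 g -> der f x l -> der g x l.
Proof. by move=> /funext ->. Qed.

Lemma der_cst x (k : R) : der (fun=> k) x 0.
Proof. exact: is_derive_cst. Qed.

Lemma der_id x : der (fun u => u) x 1.
Proof. exact: is_derive_id. Qed.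

Lemma derD f g x l l' :
  der f x l -> der g x l' -> der (fun u => f u + g u) x (l + l').
Proof. by move=> hf hg; exact: is_deriveD hf hg. Qed.

Lemma derN f x l : der f x l -> der (fun u => - f u) x (- l).
Proof. by move=> hf; exact: is_deriveN hf. Qed.

Lemma derM f g x l l' :
  der f x l -> der g x l' -> der (fun u => f u * g u) x (l * g x + f x * l').
Proof.
move=> hf hg; apply: der_eq (is_deriveM hf hg) _.
by rewrite /GRing.scale /= addrC [g x * l]mulrC.
Qed.

Lemma derX f n x l :
  der f x l -> der (fun u => f u ^+ n) x (n%:R * f x ^+ n.-1 * l).
Proof.
move=> hf; elim: n => [|n IH].
  by apply: der_eq (der_cst _ _) _; rewrite !mul0r.
apply: (@der_ext (fun u => f u * f u ^+ n)) => [u|]; first by rewrite exprS.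
apply: der_eq (derM hf IH) _; rewrite /= -natr1.
case: n {IH} => [|n] /=; first by rewrite expr0; ring.
by rewrite exprS; ring.
Qed.

Lemma derV f x l :
  f x != 0 -> der f x l -> der (fun u => (f u)^-1) x (- (l / f x ^+ 2)).
Proof.
move=> fx0 hf; apply: der_eq (is_deriveV fx0 hf) _.
by rewrite /GRing.scale /= mulNr mulrC.
Qed.

Lemma der_comp f g x l l' :
  der g (f x) l' -> der f x l -> der (fun u => g (f u)) x (l' * l).
Proof. by move=> hg hf; exact: is_derive1_comp hg hf. Qed.

Lemma der_cos f x l : der f x l -> der (fun u => cos (f u)) x (- sin (f x) * l).
Proof. by move=> hf; apply: (der_comp _ hf); exact: is_derive_cos. Qed.

Lemma der_sin f x l : der f x l -> der (fun u => sin (f u)) x (cos (f x) * l).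
Proof. by move=> hf; apply: (der_comp _ hf); exact: is_derive_sin. Qed.

Lemma der_exp f x l :
  der f x l -> der (fun u => expR (f u)) x (expR (f x) * l).
Proof. by move=> hf; apply: (der_comp _ hf); exact: is_derive_expR. Qed.

Lemma der_sqrt f x l : 0 < f x -> der f x l ->
  der (fun u => Num.sqrt (f u)) x ((2 * Num.sqrt (f x))^-1 * l).
Proof. by move=> fx0 hf; apply: (der_comp _ hf); exact: is_derive1_sqrt. Qed.

Lemma der_sum (F : nat -> R -> R) (dF : nat -> R) (r : seq nat) (P : pred nat) x :
  (forall k, P k -> der (F k) x (dF k)) ->
  der (fun u => \sum_(k <- r | P k) F k u) x (\sum_(k <- r | P k) dF k).
Proof.
move=> h; elim: r => [|k r IH].
  rewrite big_nil (_ : (fun _ => _) = fun=> 0); first exact: der_cst.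
  by apply/funext => u; rewrite big_nil.
rewrite big_cons; case: ifPn => Pk.
  apply: (der_ext _ (derD (h k Pk) IH)) => u.
  by rewrite big_cons Pk.
by apply: (der_ext _ IH) => u; rewrite big_cons (negbTE Pk).
Qed.

Lemma der_derivable f x l : der f x l -> derivable f x 1.
Proof. by case. Qed.

Lemma der_continuous f x l : der f x l -> {for x, continuous f}.
Proof.
by move=> /der_derivable/derivable1_diffP/differentiable_continuous.
Qed.

Lemma continuous_within f a b :
  (forall x, a <= x <= b -> {for x, continuous f}) ->
  {within `[a, b], continuous f}.
Proof.
move=> h; apply: continuous_in_subspaceT => x /[1!inE] /=.
by rewrite in_itv /=; exact: h.
Qed.

Lemma der_IVT f a b : a <= b ->
  (forall x, a <= x <= b -> {for x, continuous f}) ->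
  f a <= 0 <= f b \/ f b <= 0 <= f a ->
  exists2 c, a <= c <= b & f c = 0.
Proof.
move=> ab cf hab.
have [|c] := @IVT _ f a b 0 ab (continuous_within cf).
  by rewrite ge_min le_max; case: hab => /andP[-> ->] /=; rewrite ?orbT.
by rewrite in_itv /= => hc fc; exists c.
Qed.

Lemma der_MVT f df a b : a <= b ->
  (forall x, a <= x <= b -> der f x (df x)) ->
  exists2 c, a <= c <= b & f b - f a = df c * (b - a).
Proof.
move=> ab hf; have [|c|c] := @MVT_segment _ f df a b ab.
- move=> x; rewrite in_itv /= => /andP[ax xb]; apply: hf.
  by rewrite !ltW.
- by apply: continuous_within => x /hf /der_continuous.
by rewrite in_itv /= => hc fc; exists c.
Qed.

Lemma der_nondecreasing f df a b : a <= b ->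
  (forall x, a <= x <= b -> der f x (df x)) ->
  (forall x, a <= x <= b -> 0 <= df x) -> f a <= f b.
Proof.
move=> ab hf df0; have [c hc fE] := der_MVT ab hf.
by rewrite -subr_ge0 fE mulr_ge0 ?df0// subr_ge0.
Qed.

(* Replaces integral estimates: a bound of a derivative is integrated by
   comparison with an explicit primitive. *)
Lemma der_le f g df dg a b : a <= b ->
  (forall x, a <= x <= b -> der f x (df x)) ->
  (forall x, a <= x <= b -> der g x (dg x)) ->
  (forall x, a <= x <= b -> `|df x| <= dg x) -> `|f b - f a| <= g b - g a.
Proof.
move=> ab hf hg hle.
have h1 : g a + f a <= g b + f b.
  apply: (der_nondecreasing (f := fun x => g x + f x) ab) => x hx.
    by apply: derD; [exact: hg|exact: hf].
  by have := hle _ hx; rewrite ler_norml => /andP[? ?]; lra.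
have h2 : g a - f a <= g b - f b.
  apply: (der_nondecreasing (f := fun x => g x - f x) ab) => x hx.
    by apply: derD; [exact: hg|apply: derN; exact: hf].
  by have := hle _ hx; rewrite ler_norml => /andP[? ?]; lra.
by rewrite ler_norml; lra.
Qed.

Lemma der_lipschitz f df a b (M : R) : a <= b ->
  (forall x, a <= x <= b -> der f x (df x)) ->
  (forall x, a <= x <= b -> `|df x| <= M) -> `|f b - f a| <= M * (b - a).
Proof.
move=> ab hf hM; rewrite mulrBr.
apply: (der_le (g := fun x => M * x) (dg := fun=> M) ab hf) => // x _.
by apply: der_eq (derM (der_cst _ _) (der_id _)) _; rewrite mul0r mulr1 add0r.
Qed.

(** A Taylor bound of order two, unlike a derivative, passes to pointwise limits; this is how the
    limit defining Ai gets differentiated. *)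
Lemma der_of_quadratic f x l (M e : R) : 0 < e ->
  (forall y, `|y - x| <= e -> `|f y - f x - l * (y - x)| <= M * (y - x) ^+ 2) ->
  der f x l.
Proof.
move=> e0 h.
suff H : (fun k : R => k^-1 *: (f (k *: (1 : R) + x) - f x)) @ 0^' --> l.
  by apply: DeriveDef; [apply/cvg_ex; exists l|exact: (cvg_lim _ H)].
apply/cvgrPdist_le => d d0.
near=> k.
have k0 : k != 0 by near: k; exact: nbhs_dnbhs_neq.
have ke : `|k| <= e by near: k; exact: dnbhs0_le.
have kd : `|k| <= d / (`|M| + 1).
  by near: k; apply: dnbhs0_le; rewrite divr_gt0// ltr_wpDl.
have kM : `|k| * (`|M| + 1) <= d by rewrite -ler_pdivlMr// ltr_wpDl.
have := h (k + x); rewrite addrK => /(_ ke) hk.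
rewrite distrC /GRing.scale /= mulr1.
have -> : k^-1 * (f (k + x) - f x) - l = k^-1 * (f (k + x) - f x - l * k).
  by field.
rewrite normrM normfV ler_pdivrMl ?normr_gt0//.
apply: (le_trans hk); apply: (@le_trans _ _ (`|M| * `|k| ^+ 2)).
  by rewrite real_normK ?num_real// ler_wpM2r ?sqr_ge0 ?ler_norm.
rewrite expr2 mulrCA ler_wpM2l//.
by apply: le_trans kM; rewrite mulrC mulrDr mulr1 lerDl.
Unshelve. all: by end_near.
Qed.

Lemma continuous_primitive f a :
  (forall x, {for x, continuous f}) ->
  exists P : R -> R, [/\ P a = 0, forall x, a <= x -> der P x (f x) &
    forall x, a <= x -> \int[lebesgue_measure]_(s in `[a, x]) f s = P x].
Proof.
move=> cf.
have fi u v : lebesgue_measure.-integrable `[u, v] (EFin \o f).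
  apply: continuous_compact_integrable; first exact: segment_compact.
  by apply: continuous_within => x _; exact: cf.
(* Starting at [a - 1] makes [a] an interior point, so the derivative at [a] is two-sided. *)
pose F (x : R) := \int[lebesgue_measure]_(t in `[a - 1, x]) f t.
exists (fun x => F x - F a); split=> [|x ax|x ax]; first by rewrite subrr.
- have ax1 : a - 1 < x by lra.
  have [|] := @continuous_FTC1_closed _ f (a - 1) x (x + 1) _ (fi _ _) ax1 (cf x).
    by rewrite ltrDl.
  move=> dF F'; have hF : der F x (f x) by apply: DeriveDef; rewrite -?derive1E.
  by apply: der_eq (derD hF (der_cst _ _)) _; rewrite addr0.
- rewrite /F Rintegral_itvB ?bnd_simp//; last by lra.
  rewrite Rintegral_itv_obnd_cbnd//.
  by apply: (integrableS _ _ _ (fi a x)) => //; apply: subset_itvr; rewrite bnd_simp.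
Qed.

Lemma segment_primitive f a b : a <= b ->
  (forall x, a <= x <= b -> {for x, continuous f}) ->
  exists P : R -> R, [/\ P a = 0, forall x, a <= x <= b -> der P x (f x) &
    \int[lebesgue_measure]_(s in `[a, b]) f s = P b].
Proof.
move=> ab cf.
(* Composition with [clamp] extends [f] continuously to the line, constant outside the segment, so
   the primitive is differentiable at the endpoints too. *)
pose clamp x := Num.max a (Num.min b x).
have clampE x : a <= x <= b -> clamp x = x.
  by move=> /andP[ax xb]; rewrite /clamp (min_idPr _)// (max_idPr _).
have clampab x : a <= clamp x <= b.
  by rewrite /clamp le_max lexx /= ge_max ab /= ge_min lexx.
have cclamp x : {for x, continuous clamp}.
  apply: (@continuous_max _ _ (cst a) (fun x => Num.min b x)); first exact: cst_continuous.
  by apply: (@continuous_min _ _ (cst b) id); [exact: cst_continuous|exact: cvg_id].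
have [|P [Pa dP intP]] := @continuous_primitive (fun x => f (clamp x)) a.
  move=> x; apply: (@continuous_comp _ _ _ clamp f); first exact: cclamp.
  exact: cf.
exists P; split=> //.
  by move=> x hx; have /andP[ax _] := hx; have := dP x ax; rewrite clampE.
rewrite -intP//; apply: eq_Rintegral => x.
by rewrite inE /= in_itv /= => hx; rewrite clampE.
Qed.

End Calculus.

(** The first group of patterns catches eta-reduced functions such as [-%R]. Side conditions
    (nonvanishing, positivity) and derivatives of opaque functions are left as goals. *)
Ltac der :=
  repeat first [lazymatch goal with
  | |- der ( *%R ?c) _ _ => eapply (@derM _ (fun=> c) (fun u => u))
  | |- der ( +%R ?c) _ _ => eapply (@derD _ (fun=> c) (fun u => u))
  | |- der -%R _ _ => eapply (@derN _ (fun u => u))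
  | |- der GRing.inv _ _ => eapply (@derV _ (fun u => u))
  end | exact: der_cst | exact: der_id | lazymatch goal with
  | |- der (fun u => @?f u + @?g u) _ _ => eapply (@derD _ f g)
  | |- der (fun u => - @?f u) _ _ => eapply (@derN _ f)
  | |- der (fun u => @?f u * @?g u) _ _ => eapply (@derM _ f g)
  | |- der (fun u => @?f u ^+ ?n) _ _ => eapply (@derX _ f n)
  | |- der (fun u => (@?f u)^-1) _ _ => eapply (@derV _ f)
  | |- der (fun u => cos (@?f u)) _ _ => eapply (@der_cos _ f)
  | |- der (fun u => sin (@?f u)) _ _ => eapply (@der_sin _ f)
  | |- der (fun u => expR (@?f u)) _ _ => eapply (@der_exp _ f)
  | |- der (fun u => Num.sqrt (@?f u)) _ _ => eapply (@der_sqrt _ f)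
  end].

(** * Airy's equation *)

Section Limits.
Context {R : realType}.
Implicit Types (f g : R -> R).

Lemma der_lipschitz_ball f df (x y M : R) :
  (forall u, `|u - x| <= `|y - x| -> der f u (df u)) ->
  (forall u, `|u - x| <= `|y - x| -> `|df u| <= M) ->
  `|f y - f x| <= M * `|y - x|.
Proof.
move=> hf hM; have [xy|/ltW yx] := leP x y.
  have e : `|y - x| = y - x by rewrite ger0_norm ?subr_ge0.
  rewrite e in hf hM *; apply: der_lipschitz => // u hu.
    by apply: hf; rewrite ler_norml; lra.
  by apply: hM; rewrite ler_norml; lra.
have e : `|y - x| = x - y by rewrite distrC ger0_norm ?subr_ge0.
rewrite e in hf hM *; rewrite distrC; apply: der_lipschitz => // u hu.
  by apply: hf; rewrite ler_norml; lra.
by apply: hM; rewrite ler_norml; lra.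
Qed.

(** Lets the truncation [A] tend to infinity inside an inequality whose error is [O(1 / A)]. *)
Lemma le_of_divr (x y C A0 : R) :
  (forall A, A0 <= A -> 0 < A -> x <= y + C / A) -> x <= y.
Proof.
move=> h; apply/ler_addgt0Pr => e e0.
pose A := Num.max (Num.max A0 1) (`|C| / e).
have A1 : 1 <= A by rewrite !le_max lexx !orbT.
have A_gt0 : 0 < A by lra.
apply: (le_trans (h A _ _)) => //; first by rewrite !le_max lexx.
rewrite lerD2l ler_pdivrMr//; apply: (le_trans (ler_norm C)).
by rewrite mulrC -ler_pdivrMr// /A !le_max lexx !orbT.
Qed.

Lemma cvg_pinfty_rate f (A0 C : R) : 0 < A0 ->
  (forall A B, A0 <= A -> A <= B -> `|f B - f A| <= C / A) ->
  exists l, f A @[A --> +oo] --> l /\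
    forall A, A0 <= A -> `|l - f A| <= C / A.
Proof.
move=> A00 hf.
have : cvg (f A @[A --> +oo]).
  apply/cauchy_cvgP/cauchy_exP => e e0.
  pose A := Num.max A0 (`|C| / e + 1).
  have hA0 : A0 <= A by rewrite le_max lexx.
  have A_gt0 : 0 < A by lra.
  have hA : C / A < e.
    rewrite ltr_pdivrMr// (le_lt_trans (ler_norm C))// mulrC -ltr_pdivrMr//.
    by rewrite lt_max [X in _ || X]ltrDl ltr01 orbT.
  exists (f A); exists A; split; first exact: num_real.
  move=> B /ltW AB; rewrite /= /ball /= distrC.
  exact: le_lt_trans (hf _ _ _ _) hA.
move=> /cvg_ex[l fl]; exists l; split=> // A hA.
apply/ler_addgt0Pr => e e0.
have [M [_ hM]] : (\forall B \near +oo, `|l - f B| <= e).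
  by move/cvgrPdist_le : fl; exact.
pose B := Num.max A (M + 1).
have hB : `|l - f B| <= e by apply: hM; rewrite lt_max ltrDl ltr01 orbT.
have := hf A B hA; rewrite le_max lexx => /(_ isT) hAB.
rewrite (_ : l - f A = (l - f B) + (f B - f A)); last by ring.
by rewrite (le_trans (ler_normD _ _))// addrC lerD.
Qed.

End Limits.

Section AiryODE.
Context {R : realType}.
Implicit Types (z w s A : R).

Lemma cos_taylor (p e : R) : `|cos (p + e) - cos p + e * sin p| <= e ^+ 2.
Proof.
have h : `|(cos (p + e) + e * sin p) - (cos (p + 0) + 0 * sin p)|
    <= `|e| * `|e - 0|.
  apply: (der_lipschitz_ball (f := fun u => cos (p + u) + u * sin p)
    (df := fun u => - (sin (p + u) - sin p))) => u; rewrite !subr0 => hu.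
    by eapply der_eq; [der|]; rewrite /=; ring.
  rewrite normrN; apply: le_trans hu.
  have := @der_lipschitz_ball _ (fun u => sin (p + u)) (fun u => cos (p + u)) 0 u 1.
  rewrite addr0 subr0 mul1r; apply => v _.
    by eapply der_eq; [der|]; rewrite /=; ring.
  by rewrite ler_norml cos_geN1 cos_le1.
rewrite subr0 addr0 mul0r addr0 -expr2 real_normK ?num_real// in h.
by rewrite addrAC.
Qed.

Lemma sin_taylor (p e : R) : `|sin (p + e) - sin p - e * cos p| <= e ^+ 2.
Proof.
have := cos_taylor (p - pi / 2) e.
have E x : cos (x - pi / 2) = sin x :> R.
  by rewrite cosB sin_pihalf cos_pihalf mulr0 mulr1 add0r.
have E' x : sin (x - pi / 2) = - cos x :> R.
  by rewrite sinB sin_pihalf cos_pihalf mulr0 mulr1 add0r.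
by rewrite [p - _ + e]addrAC (E (p + e)) (E p) E' mulrN.
Qed.

Definition airy_phase z s := s ^+ 3 / 3 + z * s.

Lemma der_airy_phase z s : der (airy_phase z) s (s ^+ 2 + z).
Proof. by eapply der_eq; [rewrite /airy_phase; der|]; rewrite /=; field. Qed.

Lemma der_airy_phasez z s : der (airy_phase^~ s) z s.
Proof. by eapply der_eq; [rewrite /airy_phase; der|]; rewrite /=; field. Qed.

Lemma airy_phase0 z : airy_phase z 0 = 0.
Proof. by rewrite /airy_phase mulr0 expr0n mul0r addr0. Qed.

Lemma airy_phaseD z w s : airy_phase w s = airy_phase z s + (w - z) * s.
Proof. by rewrite /airy_phase /=; ring. Qed.

Lemma normr_cos (x : R) : `|cos x| <= 1.
Proof. by rewrite ler_norml cos_geN1 cos_le1. Qed.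

Lemma normr_sin (x : R) : `|sin x| <= 1.
Proof. by rewrite ler_norml sin_geN1 sin_le1. Qed.

(** [F z A] is the Airy integral truncated at [A], and [G z A] its formal derivative in [z]; both
    are given as primitives in [A] vanishing at 0. *)
Variables F G : R -> R -> R.
Hypothesis F0 : forall z, F z 0 = 0.
Hypothesis G0 : forall z, G z 0 = 0.
Hypothesis dF : forall z A, 0 <= A -> der (F z) A (cos (airy_phase z A)).
Hypothesis dG : forall z A, 0 <= A -> der (G z) A (- A * sin (airy_phase z A)).

(** Differentiating [G] in [z] leaves a boundary term [- sin] that does not decay in [A]. The
    correction [cos / A] tends to 0 and has exactly that derivative, so the truncated equation
    [H' = z F] is exact. *)
Let H z A := G z A - cos (airy_phase z A) / A.

(** Differentiation under the integral sign: the Taylor remainder of the integrand is at most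
    [(s (w - z))^2], and integrates to [A^3 / 3 * (w - z)^2]. *)
Lemma der_airy_Fz z A : 0 <= A -> der (F^~ A) z (G z A).
Proof.
move=> A0; apply: (@der_of_quadratic _ _ _ _ (A ^+ 3 / 3) 1) => // w _.
have := @der_le _ (fun s => F w s - F z s - G z s * (w - z))
  (fun s => s ^+ 3 / 3 * (w - z) ^+ 2)
  (fun s => cos (airy_phase w s) - cos (airy_phase z s)
     + s * sin (airy_phase z s) * (w - z)) (fun s => (s * (w - z)) ^+ 2) 0 A A0.
rewrite !F0 !G0 expr0n !mul0r !subr0; apply=> s /andP[s0 _].
- eapply der_eq; [apply: derD; [apply: derD; [exact: dF|apply: derN; exact: dF]|]|].
    by apply: derN; apply: derM; [exact: dG|exact: der_cst].
  by rewrite /=; ring.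
- by eapply der_eq; [der|]; rewrite /=; field.
- have := cos_taylor (airy_phase z s) ((w - z) * s).
  by rewrite -airy_phaseD (_ : _ * sin _ = s * sin (airy_phase z s) * (w - z))
    ?[s * (w - z)]mulrC//; ring.
Qed.

(** The formal derivative is the integral of [- s^2 cos], and [- s^2 = z - (s^2 + z)] where
    [(s^2 + z) cos] is the derivative of [sin (airy_phase z s)]. *)
Lemma der_airy_Gz z A : 0 <= A ->
  der (G^~ A) z (z * F z A - sin (airy_phase z A)).
Proof.
move=> A0; apply: (@der_of_quadratic _ _ _ _ (A ^+ 4 / 4) 1) => // w _.
have := @der_le _ (fun s => G w s - G z s
     - (z * F z s - sin (airy_phase z s)) * (w - z))
  (fun s => s ^+ 4 / 4 * (w - z) ^+ 2)
  (fun s => - s * (sin (airy_phase w s) - sin (airy_phase z s)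
     - s * cos (airy_phase z s) * (w - z)))
  (fun s => s * (s * (w - z)) ^+ 2) 0 A A0.
rewrite !F0 !G0 airy_phase0 sin0 expr0n /= !(mul0r, mulr0, subr0).
apply=> s /andP[s0 _].
- eapply der_eq; [apply: derD; [apply: derD; [exact: dG|apply: derN; exact: dG]|]|].
    apply: derN; apply: derM; last exact: der_cst.
    apply: derD; first by apply: derM; [exact: der_cst|exact: dF].
    by apply: derN; apply: der_sin; exact: der_airy_phase.
  by rewrite /airy_phase /=; ring.
- by eapply der_eq; [der|]; rewrite /=; field.
- have := sin_taylor (airy_phase z s) ((w - z) * s).
  rewrite -airy_phaseD (_ : _ * cos _ = s * cos (airy_phase z s) * (w - z)); last by ring.
  by rewrite normrM normrN (ger0_norm s0) [s * (w - z)]mulrC; exact: ler_wpM2l.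
Qed.

Lemma der_airy_Hz z A : 0 < A -> der (H^~ A) z (z * F z A).
Proof.
move=> A0; rewrite /H; eapply der_eq.
  apply: derD; first by apply: der_airy_Gz; exact: ltW.
  by apply: derN; apply: derM; [apply: der_cos; exact: der_airy_phasez|exact: der_cst].
by rewrite /=; field; lra.
Qed.

Section Rate.
Variables (Z A0 : R).
Hypotheses (A01 : 1 <= A0) (A0Z : 2 * Z <= A0 ^+ 2).

Lemma rate_dom z A : `|z| <= Z -> A0 <= A -> 1 <= A /\ `|z| <= A ^+ 2 / 2.
Proof.
move=> zZ A0A; split; first exact: le_trans A0A.
rewrite (le_trans zZ)// ler_pdivlMr// mulrC (le_trans A0Z)//.
have A00 : 0 <= A0 by move: A01; lra.
by rewrite lerXn2r ?nnegrE// (le_trans A00).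
Qed.

(** Integration by parts against [s^2 + z], the derivative of the phase, which is at least [s^2 / 2]
    beyond [A0]. Two boundary terms and one remainder, each at most [2 / A], make the 6. *)
Lemma airy_F_rate z A B : `|z| <= Z -> A0 <= A -> A <= B ->
  `|F z B - F z A| <= 6 / A.
Proof.
move=> zZ A0A AB.
have dom s : A <= s -> 1 <= s /\ s ^+ 2 / 2 <= s ^+ 2 + z.
  move=> As; have [s1] := rate_dom zZ (le_trans A0A As).
  by rewrite ler_norml => /andP[? ?]; split=> //; lra.
have pos s : A <= s -> 0 < s ^+ 2 + z.
  by move=> /dom[s1 h]; apply: lt_le_trans h; rewrite divr_gt0// exprn_gt0//; lra.
have A_gt0 : 0 < A by have [] := dom _ (lexx A); lra.
have inv_le s : A <= s -> (s ^+ 2 + z)^-1 <= 2 / A.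
  move=> As; have [s1 hs] := dom _ As.
  rewrite -[2 / A]invrK lef_pV2 ?posrE ?pos//; last by rewrite invr_gt0 divr_gt0.
  rewrite invf_div (le_trans _ hs)// ler_pM2r ?invr_gt0//.
  by rewrite (le_trans As)// expr2 ler_peMl//; lra.
have sin_le s : A <= s -> `|sin (airy_phase z s) / (s ^+ 2 + z)| <= 2 / A.
  move=> As; rewrite normrM normfV (gtr0_norm (pos _ As)).
  rewrite (le_trans _ (inv_le _ As))// ler_piMl ?normr_sin//.
  by rewrite invr_ge0 ltW ?pos.
have hD := @der_le _ (fun s => F z s - sin (airy_phase z s) / (s ^+ 2 + z))
  (fun s => - (s ^+ 2 + z)^-1)
  (fun s => sin (airy_phase z s) * (2 * s) / (s ^+ 2 + z) ^+ 2)
  (fun s => 2 * s / (s ^+ 2 + z) ^+ 2) A B AB.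
have {hD} : `|F z B - sin (airy_phase z B) / (B ^+ 2 + z)
    - (F z A - sin (airy_phase z A) / (A ^+ 2 + z))|
    <= - (B ^+ 2 + z)^-1 - - (A ^+ 2 + z)^-1.
  apply: hD => s /andP[As sB]; have s1 : 1 <= s by case: (dom s As).
  - have ps := pos _ As.
    eapply der_eq.
      apply: derD; first by apply: dF; lra.
      apply: derN; apply: derM; first by apply: der_sin; exact: der_airy_phase.
      by der; rewrite gt_eqF.
    by rewrite /=; field; rewrite gt_eqF.
  - have ps := pos _ As.
    eapply der_eq; first by der; rewrite gt_eqF.
    by rewrite /=; field; rewrite gt_eqF.
  - have ps := pos _ As.
    rewrite -mulrA normrM [leRHS](_ : _ = 1 * (2 * s / (s ^+ 2 + z) ^+ 2)); last by rewrite mul1r.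
    have h0 : 0 <= 2 * s / (s ^+ 2 + z) ^+ 2.
      by rewrite divr_ge0 ?exprn_ge0//; lra.
    by rewrite (ger0_norm h0) ler_wpM2r ?normr_sin.
have := sin_le _ (lexx A); have := sin_le _ AB; have := inv_le _ (lexx A).
have : 0 <= (B ^+ 2 + z)^-1 by rewrite invr_ge0 ltW// pos.
have -> : 6 / A = 3 * (2 / A) by field; have [] := dom _ (lexx A); lra.
by rewrite !ler_norml; lra.
Qed.

Lemma airy_H_rate z A B : `|z| <= Z -> A0 <= A -> A <= B ->
  `|H z B - H z A| <= 10 / A.
Proof.
move=> zZ A0A AB.
have dom s : A <= s -> [/\ 1 <= s, - (s ^+ 2 / 2) <= z & z <= s ^+ 2 / 2].
  move=> As; have [s1] := rate_dom zZ (le_trans A0A As).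
  by rewrite ler_norml => /andP[? ?].
have sq s : A <= s -> 0 < s ^+ 2.
  by move=> /dom[s1 _ _]; rewrite exprn_gt0//; lra.
have pos s : A <= s -> 0 < s ^+ 2 + z.
  by move=> As; have := sq _ As; have [] := dom _ As; lra.
(* [H + q] equals [G - s cos / (s^2 + z)], that is [G] minus the boundary term of its integration by
   parts, whose derivative is [O(s^(-2))]. *)
pose q s := z * cos (airy_phase z s) / (s * (s ^+ 2 + z)).
have qle s : A <= s -> `|q s| <= A^-1.
  move=> As; have [s1 z1 z2] := dom _ As; have := sq _ As; have ps := pos _ As => s2.
  have s0 : 0 < s by lra.
  rewrite /q normrM normfV (@gtr0_norm _ (s * _)) ?mulr_gt0//.
  rewrite ler_pdivrMr ?mulr_gt0// normrM.
  apply: (@le_trans _ _ (s ^+ 2 + z)).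
    apply: (@le_trans _ _ (`|z| * 1)); first by rewrite ler_wpM2l ?normr_cos.
    by rewrite mulr1 ler_norml; lra.
  rewrite mulrA ler_peMl//; first exact: ltW.
  by rewrite ler_pdivlMl ?mulr1//; have [] := dom _ (lexx A); lra.
have hD := @der_le _ (fun s => H z s + q s) (fun s => - (8 / s))
  (fun s => cos (airy_phase z s) / s ^+ 2
     * (1 - z * (3 * s ^+ 2 + z) / (s ^+ 2 + z) ^+ 2))
  (fun s => 8 / s ^+ 2) A B AB.
have {hD} : `|H z B + q B - (H z A + q A)| <= - (8 / B) - - (8 / A).
  apply: hD => s /andP[As sB]; have [s1 z1 z2] := dom s As; have s0 : 0 < s by lra.
  - have ps := pos _ As.
    eapply der_eq.
      rewrite /H /q; apply: derD.
        apply: derD; first by apply: dG; lra.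
        apply: derN; apply: derM; first by apply: der_cos; exact: der_airy_phase.
        by der; rewrite gt_eqF.
      apply: derM.
        by apply: derM; [exact: der_cst|apply: der_cos; exact: der_airy_phase].
      by der; rewrite gt_eqF// mulr_gt0.
    by rewrite /=; field; rewrite !gt_eqF.
  - by eapply der_eq; [der; rewrite gt_eqF|rewrite /=; field; rewrite gt_eqF].
  - have ps := pos _ As; have s2 := sq _ As.
    rewrite -mulrA [X in `|X|]mulrCA [8 / _]mulrC normrM ger0_norm ?invr_ge0 ?(ltW s2)//.
    rewrite ler_wpM2l ?invr_ge0 ?(ltW s2)// normrM -[8]mul1r ler_pM ?normr_cos//.
    have e7 : `|z * (3 * s ^+ 2 + z) / (s ^+ 2 + z) ^+ 2| <= 7.
      rewrite normrM normfV (@gtr0_norm _ (_ ^+ 2)) ?exprn_gt0//.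
      rewrite ler_pdivrMr ?exprn_gt0// ler_norml; nra.
    by move: e7; rewrite !ler_norml; lra.
have := qle _ (lexx A); have := qle _ AB.
have B0 : 0 < B by have [] := dom _ AB; lra.
have : 0 < B^-1 by rewrite invr_gt0.
by rewrite !ler_norml; lra.
Qed.

End Rate.
End AiryODE.

Section AiryEquation.
Context {R : realType}.

(** Near a fixed [z] the truncated functions obey Taylor bounds whose constants do not depend on
    [A], and they approach their limits at rate [1 / A]. Hence the limits satisfy the same Taylor
    bounds: [Fi' = Hi] and [Hi' = z Fi]. *)
Theorem airy_ode : exists dA : R -> R,
  forall z, der airy z (dA z) /\ der dA z (z * airy z).
Proof.
have /choice[F hF] : forall z : R, exists P : R -> R, [/\ P 0 = 0,
    forall A, 0 <= A -> der P A (cos (airy_phase z A)) &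
    forall A, 0 <= A ->
      \int[lebesgue_measure]_(s in `[0, A]) cos (airy_phase z s) = P A].
  move=> z; apply: continuous_primitive => s.
  by apply: der_continuous; apply: der_cos; exact: der_airy_phase.
have /choice[G hG] : forall z : R, exists P : R -> R, [/\ P 0 = 0,
    forall A, 0 <= A -> der P A (- A * sin (airy_phase z A)) &
    forall A, 0 <= A ->
      \int[lebesgue_measure]_(s in `[0, A]) (- s * sin (airy_phase z s)) = P A].
  move=> z; apply: (@continuous_primitive _ (fun s => - s * sin (airy_phase z s))) => s.
  apply: der_continuous; apply: derM; first by der.
  by apply: der_sin; exact: der_airy_phase.
have F0 z : F z 0 = 0 by case: (hF z).
have G0 z : G z 0 = 0 by case: (hG z).
have dF z A : 0 <= A -> der (F z) A (cos (airy_phase z A)).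
  by case: (hF z) => _ h _; exact: h.
have dG z A : 0 <= A -> der (G z) A (- A * sin (airy_phase z A)).
  by case: (hG z) => _ h _; exact: h.
pose H z A := G z A - cos (airy_phase z A) / A.
pose Fi z := pi * airy z : R.
pose Hi z := lim (H z A @[A --> +oo]).
have rates Z A0 : 1 <= A0 -> 2 * Z <= A0 ^+ 2 -> forall z, `|z| <= Z ->
    forall A, A0 <= A -> `|Fi z - F z A| <= 6 / A /\ `|Hi z - H z A| <= 10 / A.
  move=> A01 A0Z z zZ A A0A; have A0_gt0 : 0 < A0 by lra.
  have [l [Fl hl]] := cvg_pinfty_rate A0_gt0
    (fun A B => @airy_F_rate _ F dF _ _ A01 A0Z z A B zZ).
  have [m [Hm hm]] := cvg_pinfty_rate A0_gt0
    (fun A B => @airy_H_rate _ G dG _ _ A01 A0Z z A B zZ).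
  split; last by rewrite /Hi (cvg_lim _ Hm)//; exact: hm.
  rewrite /Fi /airy (_ : lim _ = l); last first.
    apply: cvg_lim => //; apply: cvg_trans Fl; apply: near_eq_cvg.
    near=> B; have [_ _ <-//] := hF z; near: B; exact: nbhs_pinfty_ge.
  by rewrite mulrA divff ?gt_eqF ?pi_gt0// mul1r; exact: hl.
have key z : der Fi z (Hi z) /\ der Hi z (z * Fi z).
  pose Z := `|z| + 1; pose A0 := 2 * Z + 1.
  have Z1 : 1 <= Z by rewrite lerDr.
  have A01 : 1 <= A0 by rewrite /A0; lra.
  have A0_gt0 : 0 < A0 by lra.
  have A0Z : 2 * Z <= A0 ^+ 2 by rewrite /A0; nra.
  have {}rates := rates Z A0 A01 A0Z.
  (* Crude bounds at [A0] ([A0] for [F], [A0^2 / 2 + 1] for [H]) plus twice the rates 6 and 10,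
     since [1 / A <= 1]. *)
  pose M1 := A0 + 12; pose M2 := A0 ^+ 2 / 2 + 21.
  have inv1 A : A0 <= A -> A^-1 <= 1 by move=> hA; rewrite invf_le1; lra.
  have F_le w A : `|w| <= Z -> A0 <= A -> `|F w A| <= M1.
    move=> wZ hA; have [h1 _] := rates w wZ _ (lexx A0).
    have [h2 _] := rates w wZ _ hA.
    have h3 : `|F w A0| <= A0.
      have := @der_lipschitz _ (F w) (fun s => cos (airy_phase w s)) 0 A0 1 (ltW A0_gt0).
      rewrite F0 !subr0 mul1r; apply=> s /andP[s0 _]; first exact: dF.
      exact: normr_cos.
    have := inv1 _ hA; have := inv1 _ (lexx A0).
    by move: h1 h2 h3; rewrite /M1 !ler_norml; lra.
  have H_le w A : `|w| <= Z -> A0 <= A -> `|H w A| <= M2.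
    move=> wZ hA; have [_ h1] := rates w wZ _ (lexx A0).
    have [_ h2] := rates w wZ _ hA.
    have h3 : `|G w A0| <= A0 ^+ 2 / 2.
      have := @der_le _ (G w) (fun s => s ^+ 2 / 2)
        (fun s => - s * sin (airy_phase w s)) (fun s => s) 0 A0 (ltW A0_gt0).
      rewrite G0 expr0n mul0r !subr0; apply=> s /andP[s0 _]; first exact: dG.
        by eapply der_eq; [der|rewrite /=; field].
      by rewrite normrM normrN (ger0_norm s0) ler_piMr ?normr_sin.
    have h4 : `|cos (airy_phase w A0) / A0| <= 1.
      rewrite normrM normfV (gtr0_norm A0_gt0) -[leRHS]mul1r.
      by rewrite ler_pM ?normr_cos ?inv1// invr_ge0 ltW.
    have := inv1 _ hA; have := inv1 _ (lexx A0).
    have : H w A0 = G w A0 - cos (airy_phase w A0) / A0 by [].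
    by move: h1 h2 h3 h4; rewrite /M2 !ler_norml; lra.
  have in_ball w u : `|w - z| <= 1 -> `|u - z| <= `|w - z| -> `|u| <= Z.
    move=> h1 h2; rewrite (_ : u = (u - z) + z); last by ring.
    by rewrite (le_trans (ler_normD _ _))// addrC /Z lerD2l (le_trans h2).
  have z_in : `|z| <= Z by rewrite lerDl.
  have dH u A : A0 <= A -> der (H^~ A) u (u * F u A).
    by move=> hA; apply: (der_airy_Hz F0 G0 dF dG); lra.
  have F_lip w A : `|w - z| <= 1 -> A0 <= A ->
      `|F w A - F z A| <= (M2 + 1) * `|w - z|.
    move=> wz hA; have A_gt0 : 0 < A by lra.
    apply: (der_lipschitz_ball (f := F^~ A) (df := G^~ A)) => u hu.
      by apply: (der_airy_Fz F0 G0 dF dG); lra.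
    have := H_le u A (in_ball _ _ wz hu) hA.
    have : `|cos (airy_phase u A) / A| <= 1.
      rewrite normrM normfV (gtr0_norm A_gt0) -[leRHS]mul1r.
      by rewrite ler_pM ?normr_cos ?inv1// invr_ge0 ltW.
    by rewrite /H !ler_norml; lra.
  have H_lip w A : `|w - z| <= 1 -> A0 <= A ->
      `|H w A - H z A| <= Z * M1 * `|w - z|.
    move=> wz hA; apply: (der_lipschitz_ball (f := H^~ A)) => u hu.
      exact: dH.
    by rewrite normrM ler_pM ?F_le// (in_ball w).
  split.
    apply: (@der_of_quadratic _ _ _ _ (Z * M1) 1) => // w wz.
    (* The error gathers two truncations of [F] (6 each), one of [H] (10), and the difference
       [cos / A] between [G] and [H]. *)
    apply: (@le_of_divr _ _ _ (`|w - z| + 12 + 10 * `|w - z|) A0) => A hA A_gt0.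
    have [f1 _] := rates z z_in _ hA.
    have [f2 _] := rates w (in_ball _ _ wz (lexx _)) _ hA.
    have [_ f3] := rates z z_in _ hA.
    have f4 : `|(F w A - w * H z A) - (F z A - z * H z A)|
        <= (Z * M1 * `|w - z| + A^-1) * `|w - z|.
      apply: (der_lipschitz_ball (f := fun u => F u A - u * H z A)
        (df := fun u => G u A - H z A)) => u hu.
        eapply der_eq.
          apply: derD; first by apply: (der_airy_Fz F0 G0 dF dG); lra.
          by apply: derN; der.
        by rewrite /=; ring.
      have u1 : `|u - z| <= 1 by exact: le_trans wz.
      have -> : G u A - H z A = (H u A - H z A) + cos (airy_phase u A) / A.
        by rewrite /H; ring.
      rewrite (le_trans (ler_normD _ _))// lerD//.
        rewrite (le_trans (H_lip _ _ u1 hA))// ler_wpM2l// mulr_ge0//; first by lra.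
        by rewrite /M1; lra.
      rewrite normrM normfV (gtr0_norm A_gt0) ler_piMl ?normr_cos//.
      by rewrite invr_ge0 ltW.
    have -> : Fi w - Fi z - Hi z * (w - z) = (Fi w - F w A) - (Fi z - F z A)
       - (Hi z - H z A) * (w - z)
       + ((F w A - w * H z A) - (F z A - z * H z A)) by ring.
    have f5 : `|(Hi z - H z A) * (w - z)| <= 10 / A * `|w - z|.
      by rewrite normrM ler_wpM2r.
    rewrite -[(w - z) ^+ 2]real_normK ?num_real//.
    have -> : Z * M1 * `|w - z| ^+ 2 + (`|w - z| + 12 + 10 * `|w - z|) / A
      = 6 / A + 6 / A + 10 / A * `|w - z| + (Z * M1 * `|w - z| + A^-1) * `|w - z|.
      by field; lra.
    rewrite (le_trans (ler_normD _ _))// lerD// (le_trans (ler_normB _ _))// lerD//.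
    by rewrite (le_trans (ler_normB _ _))// lerD.
  apply: (@der_of_quadratic _ _ _ _ (M1 + Z * (M2 + 1)) 1) => // w wz.
  apply: (@le_of_divr _ _ _ (20 + 6 * `|z| * `|w - z|) A0) => A hA A_gt0.
  have [f3 f1] := rates z z_in _ hA.
  have [_ f2] := rates w (in_ball _ _ wz (lexx _)) _ hA.
  have f4 : `|(H w A - w * (z * F z A)) - (H z A - z * (z * F z A))|
      <= ((M1 + Z * (M2 + 1)) * `|w - z|) * `|w - z|.
    apply: (der_lipschitz_ball (f := fun u => H u A - u * (z * F z A))
      (df := fun u => u * F u A - z * F z A)) => u hu.
      by eapply der_eq; [apply: derD; [exact: dH|der]|rewrite /=; ring].
    have u1 : `|u - z| <= 1 by exact: le_trans wz.
    rewrite (_ : _ - _ = (u - z) * F u A + z * (F u A - F z A)); last by ring.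
    rewrite (le_trans (ler_normD _ _))// [leRHS]mulrDl lerD//.
      rewrite normrM mulrC ler_pM// F_le//; exact: in_ball wz hu.
    rewrite normrM -mulrA ler_pM//.
    rewrite (le_trans (F_lip _ _ u1 hA))// ler_wpM2l//.
    by rewrite /M2; nra.
  have -> : Hi w - Hi z - z * Fi z * (w - z) = (Hi w - H w A) - (Hi z - H z A)
     - z * (Fi z - F z A) * (w - z)
     + ((H w A - w * (z * F z A)) - (H z A - z * (z * F z A))) by ring.
  have f5 : `|z * (Fi z - F z A) * (w - z)| <= 6 / A * `|z| * `|w - z|.
    by rewrite normrM ler_wpM2r// normrM mulrC ler_wpM2r.
  rewrite -[(w - z) ^+ 2]real_normK ?num_real//.
  have -> : (M1 + Z * (M2 + 1)) * `|w - z| ^+ 2 + (20 + 6 * `|z| * `|w - z|) / A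
    = 10 / A + 10 / A + 6 / A * `|z| * `|w - z|
      + ((M1 + Z * (M2 + 1)) * `|w - z|) * `|w - z|.
    by field; lra.
  rewrite (le_trans (ler_normD _ _))// lerD// (le_trans (ler_normB _ _))// lerD//.
  by rewrite (le_trans (ler_normB _ _))// lerD.
have airyE z : airy z = pi^-1 * Fi z.
  by rewrite /Fi mulrA mulVf ?mul1r// gt_eqF ?pi_gt0.
exists (fun z => pi^-1 * Hi z) => z; have [k1 k2] := key z; split.
  apply: (@der_ext _ (fun z => pi^-1 * Fi z)) => [u|]; first by rewrite airyE.
  by eapply der_eq; [apply: derM; [exact: der_cst|exact: k1]|rewrite /=; ring].
eapply der_eq; first by apply: derM; [exact: der_cst|exact: k2].
by rewrite airyE /=; ring.
Unshelve. all: by end_near.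
Qed.

End AiryEquation.

(** * Real solutions of y'' = - s y *)

Section OscillatorODE.
Context {R : realType}.
Variables y dy : R -> R.
Hypothesis der_y : forall s, der y s (dy s).
Hypothesis der_dy : forall s, der dy s (- s * y s).

(** Gronwall for [y^2 + dy^2], whose derivative [2 (1 - s) y dy] is at most [K] times it between
    [s0] and [s1]; one exponential weight for each direction. *)
Lemma ode_unique (s0 s1 : R) : y s0 = 0 -> dy s0 = 0 -> y s1 = 0.
Proof.
move=> y0 dy0; pose K := 1 + `|s0| + `|s1|.
pose N s := y s ^+ 2 + dy s ^+ 2.
pose dN s := 2 * (1 - s) * (y s * dy s).
have der_N s : der N s (dN s).
  eapply der_eq; first by rewrite /N; apply: derD; apply: derX; [exact: der_y|exact: der_dy].
  by rewrite /dN /=; ring.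
have N_ge0 s : 0 <= N s by rewrite addr_ge0 ?sqr_ge0.
have dN_le s : `|s| <= `|s0| + `|s1| -> `|dN s| <= K * N s.
  move=> hs; have h1 : `|1 - s| <= K.
    by rewrite (le_trans (ler_normB _ _))// normr1 /K -addrA lerD2l.
  have h2 : `|2 * (y s * dy s)| <= N s.
    have := sqr_ge0 (y s - dy s); have := sqr_ge0 (y s + dy s).
    by rewrite /N ler_norml; lra.
  have -> : dN s = (1 - s) * (2 * (y s * dy s)) by rewrite /dN; ring.
  by rewrite normrM ler_pM.
have Ns0 : N s0 = 0 by rewrite /N y0 dy0 expr0n addr0.
suff : N s1 <= 0.
  by move=> h; apply/eqP; rewrite -sqrf_eq0; apply/eqP; move: h; rewrite /N; nra.
have [le01|/ltW le10] := leP s0 s1.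
  have := @der_nondecreasing _ (fun s => - (N s * expR (- K * s)))
    (fun s => (K * N s - dN s) * expR (- K * s)) s0 s1 le01.
  rewrite Ns0 mul0r oppr0 oppr_ge0 pmulr_lle0 ?expR_gt0//; apply=> s hs.
    eapply der_eq; first by apply: derN; apply: derM; [exact: der_N|der].
    by rewrite /=; ring.
  rewrite mulr_ge0 ?expR_ge0// subr_ge0 (le_trans (ler_norm _))// dN_le//.
  have [s_ge0|s_lt0] := leP 0 s.
    rewrite ger0_norm//; have /andP[_] := hs; move=> h.
    by rewrite (le_trans h)// (le_trans (ler_norm _))// lerDr.
  rewrite ltr0_norm//; have /andP[h _] := hs.
  by have := ler_norm (- s0); rewrite normrN; have := normr_ge0 s1; lra.
have := @der_nondecreasing _ (fun s => (N s * expR (K * s)))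
  (fun s => (K * N s + dN s) * expR (K * s)) s1 s0 le10.
rewrite Ns0 mul0r pmulr_lle0 ?expR_gt0//; apply=> s hs.
  eapply der_eq; first by apply: derM; [exact: der_N|der].
  by rewrite /=; ring.
have hdN : `|dN s| <= K * N s.
  apply: dN_le; have [s_ge0|s_lt0] := leP 0 s.
    rewrite ger0_norm//; have /andP[_] := hs; move=> h.
    by rewrite (le_trans h)// (le_trans (ler_norm _))// lerDl.
  rewrite ltr0_norm//; have /andP[h _] := hs.
  by have := ler_norm (- s1); rewrite normrN; have := normr_ge0 s0; lra.
rewrite mulr_ge0 ?expR_ge0//.
by move: hdN; rewrite ler_norml; lra.
Qed.

(** An explicit primitive of [y^2] along the equation: it converts statements on [L^2] norms into
    pointwise ones. *)
Definition ode_energy s := s * y s ^+ 2 + dy s ^+ 2.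

Lemma der_ode_energy s : der ode_energy s (y s ^+ 2).
Proof.
eapply der_eq.
  by apply: derD; [apply: derM; [exact: der_id|exact: derX]|exact: derX].
by rewrite /=; ring.
Qed.

Lemma ode_energy_le s s' : s <= s' -> ode_energy s <= ode_energy s'.
Proof.
move=> h; apply: (der_nondecreasing h) => [u _|u _]; first exact: der_ode_energy.
exact: sqr_ge0.
Qed.

Hypothesis y_neq0 : exists s, y s != 0.

Lemma ode_double_zero s : y s = 0 -> dy s != 0.
Proof.
move=> ys; apply/negP => /eqP dys; have [s1 /eqP] := y_neq0.
by apply; exact: ode_unique dys.
Qed.

Section Decay.
Variable B : R.
(** Integrability of [y^2] at minus infinity in disguise; it selects the decaying solution, Ai,
    among all solutions. *)
Hypothesis energy_ge : forall s, B <= ode_energy s.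

Let m s := y s * dy s.

Let der_m s : der m s (dy s ^+ 2 - s * y s ^+ 2).
Proof. by eapply der_eq; [exact: derM|rewrite /=; ring]. Qed.

Let der_sq s : der (fun u => y u ^+ 2) s (2 * m s).
Proof. by eapply der_eq; [exact: derX|rewrite /m /=; ring]. Qed.

Let m_le s s' : s <= s' -> s' <= 0 -> m s <= m s'.
Proof.
move=> ss' s'0; apply: (der_nondecreasing ss') => u hu; first exact: der_m.
have /andP[_ us'] := hu.
have : 0 <= - u * y u ^+ 2 by rewrite mulr_ge0 ?sqr_ge0//; lra.
by have := sqr_ge0 (dy u); lra.
Qed.

(* A negative value of [(y^2)'] would make [y^2] grow linearly towards
   minus infinity, against the bound on the energy. *)
Let m_ge0 s : s <= 0 -> 0 <= m s.
Proof.
move=> s0; rewrite leNgt; apply/negP => ms.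
have hsq u : u <= s -> - (2 * m s) * (s - u) <= y u ^+ 2.
  move=> us.
  have := @der_nondecreasing _ (fun v => 2 * m s * v - y v ^+ 2)
    (fun v => 2 * m s - 2 * m v) u s us.
  have h1 v : u <= v <= s ->
      der (fun v => 2 * m s * v - y v ^+ 2) v (2 * m s - 2 * m v).
    move=> _; eapply der_eq.
      by apply: derD; [der|apply: derN; exact: der_sq].
    by rewrite /=; ring.
  have h2 v : u <= v <= s -> 0 <= 2 * m s - 2 * m v.
    by move=> /andP[_ vs]; have := m_le vs s0; lra.
  move=> /(_ h1 h2); have := sqr_ge0 (y s); lra.
have hen u : u <= s -> - m s * (s - u) ^+ 2 <= ode_energy s - ode_energy u.
  move=> us.
  have := @der_nondecreasing _ (fun v => ode_energy v - m s * (s - v) ^+ 2)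
    (fun v => y v ^+ 2 + 2 * m s * (s - v)) u s us.
  have h1 v : u <= v <= s -> der (fun v => ode_energy v - m s * (s - v) ^+ 2) v
      (y v ^+ 2 + 2 * m s * (s - v)).
    move=> _; eapply der_eq; first by apply: derD; [exact: der_ode_energy|der].
    by rewrite /=; ring.
  have h2 v : u <= v <= s -> 0 <= y v ^+ 2 + 2 * m s * (s - v).
    by move=> /andP[_ vs]; have := hsq v vs; lra.
  by move=> /(_ h1 h2); rewrite subrr expr0n /= mulr0; lra.
(* At distance [D + 1] the energy would have dropped by [- m s * (D + 1)^2], more than the available
   [- m s * D]. *)
pose D := (ode_energy s - B) / - m s.
have D0 : 0 <= D by rewrite divr_ge0// ?subr_ge0//; lra.
have := hen (s - (D + 1)) ltac:(lra); have := energy_ge (s - (D + 1)).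
have -> : s - (s - (D + 1)) = D + 1 by ring.
have : D * - m s = ode_energy s - B by rewrite /D divfK// oppr_eq0 lt_eqF.
by nra.
Qed.

(** On the negative axis [y^2] is nondecreasing, so its integral over [[s, 0]], an energy
    difference, is at least [|s| y(s)^2]. *)
Lemma ode_decay s : s < 0 -> - s * y s ^+ 2 <= ode_energy 0 - B.
Proof.
move=> s0; have sq_le u : s <= u <= 0 -> y s ^+ 2 <= y u ^+ 2.
  move=> /andP[su u0]; apply: (der_nondecreasing (f := fun v => y v ^+ 2) su) => v hv; first exact: der_sq.
  by rewrite mulr_ge0// m_ge0//; lra.
have [c hc] := @der_MVT _ ode_energy (fun u => y u ^+ 2) s 0 (ltW s0)
  (fun u _ => der_ode_energy u).
have := energy_ge s; have := sq_le _ hc; rewrite sub0r.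
by nra.
Qed.

(** At a zero [s <= 0], the monotonicity of [y^2] forces [y = 0] on the whole half-line to the left,
    hence a double zero. *)
Lemma ode_zero_gt0 s : y s = 0 -> 0 < s.
Proof.
move=> ys; rewrite ltNge; apply/negP => s0.
have ms : m s = 0 by rewrite /m ys mul0r.
have y0 u : u <= s -> y u = 0.
  move=> us; apply/eqP; rewrite -sqrf_eq0 eq_le sqr_ge0 andbT.
  rewrite (_ : 0 = y s ^+ 2); last by rewrite ys expr0n.
  apply: (der_nondecreasing (f := fun v => y v ^+ 2) us) => v hv; first exact: der_sq.
  by rewrite mulr_ge0// m_ge0//; lra.
have s1 : s - 1 <= s by lra.
have [c hc hyc] := @der_MVT _ y dy (s - 1) s s1 (fun u _ => der_y u).
have yc : y c = 0 by apply: y0; lra.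
have /eqP := ode_double_zero yc; apply.
by move: hyc; rewrite ys y0//; lra.
Qed.

End Decay.

(** A weak Sturm comparison: at the point [c] where [|y|] is maximal [dy c = 0], and integrating
    [y'' = - s y] twice back to [a] gives [|y c| <= b (b - a)^2 |y c|]. *)
Lemma ode_zero_gap a b : 0 < a -> a < b -> y a = 0 -> y b = 0 ->
  1 <= b * (b - a) ^+ 2.
Proof.
move=> a0 ab ya yb.
have dsq s : der (fun u => y u ^+ 2) s (2 * y s * dy s).
  by eapply der_eq; [exact: derX|rewrite /=; ring].
have [|c] := @EVT_max _ (fun u => y u ^+ 2) a b (ltW ab).
  by apply: continuous_within => x _; exact: der_continuous (dsq x).
rewrite in_itv /= => /andP[ac cb] hmax.
have yc0 : y c != 0.
  apply/negP => /eqP yc.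
  have y0 u : a <= u <= b -> y u = 0.
    move=> hu; have := hmax u; rewrite in_itv /= yc expr0n => /(_ hu) h.
    by apply/eqP; rewrite -sqrf_eq0 eq_le sqr_ge0 andbT.
  have [d hd hyd] := @der_MVT _ y dy a b (ltW ab) (fun u _ => der_y u).
  have /eqP := ode_double_zero (y0 _ hd); apply.
  move: hyd; rewrite ya yb subrr => /esym/eqP.
  by rewrite mulf_eq0 subr_eq0 (gt_eqF ab) orbF => /eqP.
have hac : a < c.
  by rewrite lt_neqAle ac andbT; apply: contra_neq yc0 => <-.
have hcb : c < b.
  by rewrite lt_neqAle cb andbT; apply: contra_neq yc0 => ->.
have dyc : dy c = 0.
  have := @derive1_at_max _ (fun u => y u ^+ 2) a b c (ltW ab).
  have h1 t : t \in `]a, b[ -> derivable (fun u => y u ^+ 2) t 1.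
    by move=> _; exact: der_derivable (dsq t).
  have h2 : c \in `]a, b[ by rewrite in_itv /= hac hcb.
  have h3 t : t \in `]a, b[ -> y t ^+ 2 <= y c ^+ 2.
    rewrite in_itv /= => /andP[at_ tb]; apply: hmax.
    by rewrite in_itv /= !ltW.
  move=> /(_ h1 h2 h3) [_ h]; have [_] := dsq c; rewrite h => /esym/eqP.
  by rewrite !mulf_eq0 (negbTE yc0) orbF pnatr_eq0 /= => /eqP.
have ymax u : a <= u <= b -> `|y u| <= `|y c|.
  move=> hu; have := hmax u; rewrite in_itv /= => /(_ hu) h.
  by rewrite -(@ler_pXn2r _ 2)// ?nnegrE// !real_normK ?num_real.
have b0 : 0 < b by lra.
have dyle u : a <= u <= c -> `|dy u| <= b * `|y c| * (b - a).
  move=> /andP[au uc].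
  have := @der_lipschitz _ dy (fun s => - s * y s) u c (b * `|y c|) uc.
  rewrite dyc sub0r normrN => h; apply: le_trans (h _ _) _ => [v _|v /andP[uv vc]|].
  - exact: der_dy.
  - have v0 : 0 <= v by lra.
    rewrite normrM normrN (ger0_norm v0).
    by rewrite ler_pM// ?ymax//; lra.
  - by rewrite ler_wpM2l ?mulr_ge0 ?(ltW b0)//; lra.
have := @der_lipschitz _ y dy a c (b * `|y c| * (b - a)) ac (fun u _ => der_y u) dyle.
rewrite ya subr0 => h.
have h' : `|y c| <= `|y c| * (b * (b - a) ^+ 2).
  apply: (le_trans h); rewrite expr2 [leRHS](_ : _ = b * `|y c| * (b - a) * (b - a)); last by ring.
  by rewrite ler_wpM2l ?mulr_ge0 ?(ltW b0)//; lra.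
by rewrite -(ler_pM2l (x := `|y c|)) ?mulr1// normr_gt0.
Qed.

End OscillatorODE.

(** * The Liouville transform and the polar form *)

Section Liouville.
Context {R : realType}.
Implicit Types s : R.

(** Fractional powers of [s] become integer powers of [root4 s], so derivatives reduce to identities
    proved by [field]. *)
Definition root4 s : R := Num.sqrt (Num.sqrt s).

Lemma root4_gt0 s : 0 < s -> 0 < root4 s.
Proof. by move=> s0; rewrite !sqrtr_gt0. Qed.

Lemma root4_2 s : root4 s ^+ 2 = Num.sqrt s.
Proof. by rewrite sqr_sqrtr ?sqrtr_ge0. Qed.

Lemma root4_4 s : 0 <= s -> root4 s ^+ 4 = s.
Proof. by move=> s0; rewrite (exprM _ 2 2) root4_2 sqr_sqrtr. Qed.

Lemma root4_ge1 s : 1 <= s -> 1 <= root4 s.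
Proof. by move=> s1; rewrite -sqrtr1 ler_wsqrtr// -sqrtr1 ler_wsqrtr. Qed.

Lemma der_root4 s : 0 < s -> der root4 s (4 * root4 s ^+ 3)^-1.
Proof.
move=> s0; have s1 : 0 < Num.sqrt s by rewrite sqrtr_gt0.
have q0 := root4_gt0 s0.
eapply der_eq.
  by apply: (@der_sqrt _ Num.sqrt _ _ s1); apply: (@der_sqrt _ id _ _ s0); exact: der_id.
rewrite /= -/(root4 s) -root4_2; field.
by rewrite gt_eqF.
Qed.

(* xi = (2/3) s^(3/2), the phase of Ai (- s). *)
Definition airy_xi s : R := 2 / 3 * root4 s ^+ 6.

Lemma der_airy_xi s : 0 < s -> der airy_xi s (root4 s ^+ 2).
Proof.
move=> s0; have q0 := root4_gt0 s0; eapply der_eq.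
  by rewrite /airy_xi; der; exact: der_root4.
by rewrite /=; field; rewrite gt_eqF.
Qed.

Variables y dy : R -> R.
Hypothesis der_y : forall s, der y s (dy s).
Hypothesis der_dy : forall s, der dy s (- s * y s).
Hypothesis y_neq0 : exists s, y s != 0.

(* The Liouville transform [u = s^(1/4) y] satisfies
   [u'' + (1 + O(xi^-2)) u = 0] in the variable [xi]; [liou1] is its derivative
   in [xi]. *)
Definition liou s : R := root4 s * y s.
Definition liou1 s : R := dy s / root4 s + y s / (4 * root4 s ^+ 5).

Lemma der_liou s : 0 < s -> der liou s (root4 s ^+ 2 * liou1 s).
Proof.
move=> s0; have q0 := root4_gt0 s0; eapply der_eq.
  by apply: derM; [exact: der_root4|exact: der_y].
by rewrite /liou1; field; rewrite gt_eqF.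
Qed.

Lemma der_liou1 s : 0 < s ->
  der liou1 s (- root4 s ^+ 2 * liou s - 5 / 16 * liou s / root4 s ^+ 10).
Proof.
move=> s0; have q0 := root4_gt0 s0; eapply der_eq.
  rewrite /liou1; apply: derD; apply: derM; [exact: der_dy| |exact: der_y|].
    by der; [rewrite gt_eqF|exact: der_root4].
  by der; [rewrite gt_eqF// mulr_gt0// exprn_gt0|exact: der_root4].
rewrite /liou /= -[s in - s * _](root4_4 (ltW s0)).
by field; rewrite gt_eqF.
Qed.

Definition liou_energy s := liou s ^+ 2 + liou1 s ^+ 2.

(** The logarithmic derivative of the energy is at most [s^(-2)], which is integrable: multiplied by
    [exp (- 1/s)] the energy is nondecreasing, by [exp (1/s)] nonincreasing. It is positive at 1
    because a solution has no double zero. *)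
Lemma liou_energy_bounds : exists e0 e1 : R, 0 < e0 /\
  forall s, 1 <= s -> e0 <= liou_energy s <= e1.
Proof.
pose dE s := - (5 / 8) * (liou s * liou1 s) / root4 s ^+ 10.
have derE s : 0 < s -> der liou_energy s (dE s).
  move=> s0; eapply der_eq.
    rewrite /liou_energy; apply: derD; apply: derX; first exact: der_liou.
    exact: der_liou1.
  by rewrite /dE /=; field; rewrite gt_eqF ?root4_gt0.
have dE_le s : 1 <= s -> `|dE s| <= liou_energy s / s ^+ 2.
  move=> s1; have q1 := root4_ge1 s1; have q0 : 0 < root4 s by lra.
  rewrite /dE normrM normfV (@gtr0_norm _ (_ ^+ 10)) ?exprn_gt0//.
  apply: ler_pM => //; first by rewrite invr_ge0 exprn_ge0// ltW.
    have := sqr_ge0 (liou s + liou1 s); have := sqr_ge0 (liou s - liou1 s).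
    have := sqr_ge0 (liou s); have := sqr_ge0 (liou1 s).
    by rewrite /liou_energy ler_norml; lra.
  rewrite lef_pV2 ?posrE ?exprn_gt0//; last by lra.
  rewrite -[s in s ^+ 2]root4_4 -?exprM; last by lra.
  by rewrite ler_weXn2l.
pose e0 := liou_energy 1.
have e0_gt0 : 0 < e0.
  have sq0 : 0 <= e0 by rewrite addr_ge0 ?sqr_ge0.
  rewrite lt_neqAle sq0 andbT eq_sym; apply/negP => /eqP.
  rewrite /e0 /liou_energy /liou /liou1 /root4 !sqrtr1 mul1r => h0.
  have y1 : y 1 = 0.
    apply/eqP; rewrite -sqrf_eq0 eq_le sqr_ge0 andbT.
    by rewrite -h0 lerDl sqr_ge0.
  have dy1 : dy 1 = 0.
    by move/eqP: h0; rewrite y1 expr0n add0r sqrf_eq0 mul0r addr0 divr1 => /eqP.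
  by have /eqP := ode_double_zero der_y der_dy y_neq0 y1; apply.
exists (e0 * expR (- 1)), (e0 * expR 1); split; first by rewrite mulr_gt0 ?expR_gt0.
move=> s s1.
have posx x : 1 <= x <= s -> 0 < x by lra.
have E0 x : 0 <= liou_energy x by rewrite addr_ge0 ?sqr_ge0.
apply/andP; split.
  have h := @der_nondecreasing _ (fun x => liou_energy x * expR (- x^-1))
    (fun x => (dE x + liou_energy x / x ^+ 2) * expR (- x^-1)) 1 s s1.
  have {h} : e0 * expR (- 1^-1) <= liou_energy s * expR (- s^-1).
    apply: h => x hx; have x0 := posx x hx.
      eapply der_eq.
        by apply: derM; [exact: derE|der; rewrite gt_eqF].
      by rewrite /=; field; rewrite gt_eqF.
    rewrite mulr_ge0 ?expR_ge0//; have /andP[x1 _] := hx.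
    by have := dE_le x x1; rewrite ler_norml; lra.
  rewrite invr1 => h; apply: (le_trans h).
  rewrite ler_piMr// -expR0 ler_expR oppr_le0 invr_ge0; lra.
have h := @der_nondecreasing _ (fun x => - (liou_energy x * expR (x^-1)))
  (fun x => (liou_energy x / x ^+ 2 - dE x) * expR (x^-1)) 1 s s1.
have {h} : - (e0 * expR (1^-1)) <= - (liou_energy s * expR (s^-1)).
  apply: h => x hx; have x0 := posx x hx.
    eapply der_eq.
      by apply: derN; apply: derM; [exact: derE|der; rewrite gt_eqF].
    by rewrite /=; field; rewrite gt_eqF.
  rewrite mulr_ge0 ?expR_ge0//; have /andP[x1 _] := hx.
  by have := dE_le x x1; rewrite ler_norml; lra.
rewrite invr1 lerN2; apply: le_trans.
rewrite ler_peMr// -[leLHS]expR0 ler_expR invr_ge0; lra.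
Qed.

(** Variation of constants: [(liou, liou1)] in the frame rotating with the phase. Without the
    [5 / 16] term in the derivative of [liou1], these two coordinates would be constant. *)
Definition liou_cos s := liou s * cos (airy_xi s) - liou1 s * sin (airy_xi s).
Definition liou_sin s := liou s * sin (airy_xi s) + liou1 s * cos (airy_xi s).

Lemma liou_polar s : 0 < s ->
  y s = (liou_cos s * cos (airy_xi s) + liou_sin s * sin (airy_xi s)) / root4 s.
Proof.
move=> s0; have q0 := root4_gt0 s0.
have -> : liou_cos s * cos (airy_xi s) + liou_sin s * sin (airy_xi s)
    = liou s * (cos (airy_xi s) ^+ 2 + sin (airy_xi s) ^+ 2).
  by rewrite /liou_cos /liou_sin; ring.
by rewrite cos2Dsin2 mulr1 /liou mulrC mulKf// gt_eqF.
Qed.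

(** The derivatives are in fact [O(s^(-5/2))]; the form [C / s] is the one that balances the
    logarithmic derivative of the Airy argument in [amplitude_airy]. *)
Lemma liou_polar_bounds : exists C : R, 0 < C /\ exists dc ds : R -> R,
  forall s, 1 <= s ->
  [/\ der liou_cos s (dc s), der liou_sin s (ds s),
      `|liou_cos s| <= C /\ `|liou_sin s| <= C &
      `|dc s| <= C / s /\ `|ds s| <= C / s].
Proof.
have [e0 [e1 [e0_gt0 hE]]] := liou_energy_bounds.
have e1_gt0 : 0 < e1 by have /andP[] := hE 1 (lexx 1); lra.
exists (e1 + 1); split; first by lra.
exists (fun s => 5 / 16 * liou s / root4 s ^+ 10 * sin (airy_xi s)),
  (fun s => - (5 / 16 * liou s / root4 s ^+ 10 * cos (airy_xi s))) => s s1.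
have s0 : 0 < s by lra.
have q1 := root4_ge1 s1; have q0 := root4_gt0 s0.
have abs_le (x : R) : x ^+ 2 <= e1 -> `|x| <= e1 + 1.
  by move=> h; rewrite ler_norml; nra.
have amp : liou_cos s ^+ 2 + liou_sin s ^+ 2 <= e1.
  have /andP[_] := hE s s1.
  rewrite (_ : liou_energy s = liou_cos s ^+ 2 + liou_sin s ^+ 2)//.
  rewrite /liou_cos /liou_sin [RHS](_ : _ = liou_energy s
    * (cos (airy_xi s) ^+ 2 + sin (airy_xi s) ^+ 2)); first by rewrite cos2Dsin2 mulr1.
  by rewrite /liou_energy; ring.
have u_le : `|liou s| <= e1 + 1.
  apply: abs_le; have /andP[_] := hE s s1; apply: le_trans.
  by rewrite lerDl sqr_ge0.
have small x : `|x| <= 1 ->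
    `|5 / 16 * liou s / root4 s ^+ 10 * x| <= (e1 + 1) / s.
  move=> x1; rewrite normrM -[leRHS]mulr1 ler_pM// normrM.
  apply: ler_pM => //; first by rewrite normrM ger0_norm//; lra.
  rewrite normfV gtr0_norm ?exprn_gt0// lef_pV2 ?posrE ?exprn_gt0//.
  by rewrite -[leLHS]root4_4 ?(ltW s0)// ler_weXn2l.
split.
- eapply der_eq.
    apply: derD; first apply: derM; [exact: der_liou|by apply: der_cos; exact: der_airy_xi|].
    apply: derN; apply: derM; first exact: der_liou1.
    by apply: der_sin; exact: der_airy_xi.
  by rewrite /=; field; rewrite gt_eqF.
- eapply der_eq.
    apply: derD; first apply: derM; [exact: der_liou|by apply: der_sin; exact: der_airy_xi|].
    apply: derM; first exact: der_liou1.
    by apply: der_cos; exact: der_airy_xi.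
  by rewrite /=; field; rewrite gt_eqF.
- by split; apply: abs_le; apply: le_trans amp; rewrite ?lerDl ?lerDr sqr_ge0.
- by rewrite normrN; split; apply: small; [exact: normr_sin|exact: normr_cos].
Qed.

(** At a zero the Liouville energy is [dy^2 / sqrt s]. This lower bound on the slope is what bounds
    the normalizing constants from above. *)
Lemma ode_zero_slope : exists e0 : R, 0 < e0 /\
  forall s, 1 <= s -> y s = 0 -> e0 * Num.sqrt s <= dy s ^+ 2.
Proof.
have [e0 [e1 [e0_gt0 hE]]] := liou_energy_bounds.
exists e0; split=> // s s1 ys; have /andP[+ _] := hE s s1.
have q0 : 0 < root4 s by apply: root4_gt0; lra.
rewrite /liou_energy /liou /liou1 ys mulr0 mul0r addr0 expr0n add0r.
by rewrite expr_div_n ler_pdivlMr ?exprn_gt0// root4_2.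
Qed.

Lemma ode_amplitude : exists C : R, 0 < C /\
  forall s, 1 <= s -> y s ^+ 2 * Num.sqrt s <= C.
Proof.
have [e0 [e1 [e0_gt0 hE]]] := liou_energy_bounds.
have e1_gt0 : 0 < e1 by have /andP[] := hE 1 (lexx 1); lra.
exists e1; split=> // s s1; have /andP[_] := hE s s1; apply: le_trans.
by rewrite -root4_2 -exprMn mulrC lerDl sqr_ge0.
Qed.

End Liouville.

(** * Zeros of Ai and normalization of the modes *)

Section AiryModes.
Context {R : realType}.
Implicit Types s : R.

(** The constant in the product of the two eigenfunctions of a mode; kept whole, it is estimated
    directly in terms of [om k]. *)
Definition mode_weight (f : nat -> R) (k : nat) : R := (f k / k%:R `^ 6^-1) ^+ 2.

Lemma airy_reflected_ode : exists dy : R -> R,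
  forall s, der (fun s => airy (- s)) s (dy s) /\ der dy s (- s * airy (- s)).
Proof.
have [dA hA] := @airy_ode R; exists (fun s => - dA (- s)) => s; split.
  eapply der_eq; first by apply: (@der_comp _ -%R airy); [exact: (hA (- s)).1|der].
  by rewrite mulrN1.
eapply der_eq.
  by apply: derN; apply: (@der_comp _ -%R dA); [exact: (hA (- s)).2|der].
by ring.
Qed.

Lemma airy_polar : (exists s, airy (- s) != 0) ->
  exists C : R, 0 < C /\ exists al be dal dbe : R -> R, forall s, 1 <= s ->
  [/\ airy (- s) = (al s * cos (airy_xi s) + be s * sin (airy_xi s)) / root4 s,
      der al s (dal s) /\ der be s (dbe s),
      `|al s| <= C /\ `|be s| <= C & `|dal s| <= C / s /\ `|dbe s| <= C / s].
Proof.
move=> y_neq0; have [dy hy] := airy_reflected_ode.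
pose y s := airy (- s).
have dery s : der y s (dy s) by case: (hy s).
have derdy s : der dy s (- s * y s) by case: (hy s).
have [C [C0 [dc [ds hC]]]] := liou_polar_bounds dery derdy y_neq0.
exists C; split=> //; exists (liou_cos y dy), (liou_sin y dy), dc, ds => s s1.
by have [h1 h2 h3 h4] := hC s s1; split=> //; apply: (liou_polar y dy); lra.
Qed.

Variables om f : nat -> R.
Hypothesis om_zeros : airy_zeros om.
Hypothesis f_norm : normalizing om f.

Let y s := airy (- s).

Let y_om k : (1 <= k)%N -> y (om k) = 0.
Proof. by case: om_zeros => h _ _; exact: h. Qed.

Lemma airy_zeros_lt k l : (1 <= k)%N -> (k < l)%N -> om k < om l.
Proof. by case: om_zeros => _ h _ hk hl; have := h k l hk hl; rewrite ltrN2. Qed.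

Lemma airy_zeros_le k l : (1 <= k)%N -> (k <= l)%N -> om k <= om l.
Proof.
move=> hk; rewrite leq_eqVlt => /predU1P[->//|hl]; apply: ltW.
exact: airy_zeros_lt.
Qed.

Lemma eigenfun1E k x : eigenfun om f k x 1 ^+ 2 = mode_weight f k * y (om k - x) ^+ 2.
Proof.
by rewrite /eigenfun !powR1 !mul1r /mode_weight /y opprB !exprMn mulrA.
Qed.

(** An identically zero Ai would give modes of norm 0, not 1. *)
Lemma airy_nontrivial : exists s, airy (- s) != 0.
Proof.
apply: contrapT => h; have y0 s : y s = 0.
  by apply/eqP; apply: contrapT => hs; apply: h; exists s; apply/negP.
have [_ /(_ 1 ltr01)] := f_norm (leqnn 1).
under eq_integral do rewrite eigenfun1E y0 expr0n mulr0.
by rewrite integral0 => /eqP; rewrite eqe eq_sym oner_eq0.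
Qed.

Section Slope.
Variable dy : R -> R.
Hypothesis der_y : forall s, der y s (dy s).
Hypothesis der_dy : forall s, der dy s (- s * y s).

(** As the energy is a primitive of [y^2], the left side is the mass of the mode at [eta = 1] on
    [[0, om k - s]], a part of its total mass 1. *)
Lemma mode_energy k s : (1 <= k)%N -> s <= om k ->
  mode_weight f k * (ode_energy y dy (om k) - ode_energy y dy s) <= 1.
Proof.
move=> k1; rewrite le_eqVlt => /predU1P[->|sk]; first by rewrite subrr mulr0.
have W0 : 0 <= mode_weight f k by exact: sqr_ge0.
have [_ /(_ 1 ltr01) hint] := f_norm k1.
pose X := om k - s; have X0 : 0 < X by rewrite subr_gt0.
pose P x := - (mode_weight f k * ode_energy y dy (om k - x)).
have derP x : der P x (mode_weight f k * y (om k - x) ^+ 2).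
  eapply der_eq.
    apply: derN; apply: derM; first exact: der_cst.
    by apply: (@der_comp _ (fun x => om k - x)); [exact: der_ode_energy|der].
  by rewrite /=; ring.
have dery2 x : der (fun x => y (om k - x) ^+ 2) x (- (2 * y (om k - x) * dy (om k - x))).
  eapply der_eq.
    by apply: derX; apply: (@der_comp _ (fun x => om k - x)); [exact: der_y|der].
  by rewrite /=; ring.
have hFTC := @continuous_FTC2 _ (fun x => mode_weight f k * y (om k - x) ^+ 2) P 0 X X0.
have {hFTC} intP : (\int[lebesgue_measure]_(x in `[0%R, X])
    (eigenfun om f k x 1 ^+ 2)%:E = (P X)%:E - (P 0)%:E)%E.
  rewrite -hFTC.
  - by apply: eq_integral => x _; rewrite eigenfun1E.
  - apply: continuous_within => x _; apply: der_continuous.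
    by apply: derM; [exact: der_cst|exact: dery2].
  - split.
    + by move=> x _; exact: der_derivable (derP x).
    + by apply: cvg_at_right_filter; exact: der_continuous (derP 0).
    + by apply: cvg_at_left_filter; exact: der_continuous (derP X).
  - by move=> x _; rewrite derive1E; case: (derP x).
rewrite -lee_fin -hint.
have -> : mode_weight f k * (ode_energy y dy (om k) - ode_energy y dy s) = P X - P 0.
  by rewrite /P /X subr0 (_ : om k - (om k - s) = s); ring.
rewrite EFinB -intP; apply: ge0_subset_integral => //=.
- apply/measurable_EFinP; apply: measurable_funTS.
  apply: continuous_measurable_fun => x.
  have -> : (fun x => eigenfun om f k x 1 ^+ 2) =
    (fun x => mode_weight f k * y (om k - x) ^+ 2).
    by apply/funext => x'; rewrite eigenfun1E.
  apply: der_continuous; apply: derM; first exact: der_cst.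
  exact: dery2.
- by move=> x _; rewrite lee_fin sqr_ge0.
- by move=> x /=; rewrite !in_itv /= => /andP[->].
Qed.

End Slope.

Lemma mode_weight_gt0 k : (1 <= k)%N -> 0 < mode_weight f k.
Proof.
move=> k1; have [fk _] := f_norm k1.
by rewrite exprn_gt0// divr_gt0// powR_gt0// ltr0n.
Qed.

(** Normalization of the first mode alone yields the lower bound on the energy, hence the decay of
    Ai and the positivity of all [om k]. *)
Lemma airy_energy_ge dy : (forall s, der y s (dy s)) ->
  (forall s, der dy s (- s * y s)) ->
  exists B, forall s, B <= ode_energy y dy s.
Proof.
move=> dery derdy; exists (ode_energy y dy (om 1%N) - (mode_weight f 1%N)^-1) => s.
have W0 := mode_weight_gt0 (leqnn 1).
have [h|/ltW h] := leP s (om 1%N).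
  have := mode_energy dery derdy (leqnn 1) h.
  by rewrite mulrC -ler_pdivlMr// mul1r; lra.
apply: (@le_trans _ _ (ode_energy y dy (om 1%N))).
  by rewrite gerBl invr_ge0 ltW.
exact: (ode_energy_le dery derdy).
Qed.

Lemma airy_zeros_gt0 k : (1 <= k)%N -> 0 < om k.
Proof.
move=> k1; have [dy hy] := airy_reflected_ode.
have dery s : der y s (dy s) by case: (hy s).
have derdy s : der dy s (- s * y s) by case: (hy s).
have [B hB] := airy_energy_ge dery derdy.
exact: (ode_zero_gt0 dery derdy airy_nontrivial hB (y_om k1)).
Qed.

Lemma airy_zeros_gap k : (1 <= k)%N -> 1 <= om k.+1 * (om k.+1 - om k) ^+ 2.
Proof.
move=> k1; have [dy hy] := airy_reflected_ode.
have dery s : der y s (dy s) by case: (hy s).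
have derdy s : der dy s (- s * y s) by case: (hy s).
apply: (ode_zero_gap dery derdy airy_nontrivial).
- exact: airy_zeros_gt0.
- exact: airy_zeros_lt.
- exact: y_om.
- exact: y_om.
Qed.

(** Three ranges: the Liouville amplitude for [s >= 1], compactness for [|s| <= 1], and [ode_decay]
    for [s < -1], where it gives even [1 / |s|]. *)
Lemma airy_sqr_bound : exists C : R, 0 < C /\
  forall s, airy (- s) ^+ 2 * Num.sqrt (1 + `|s|) <= C.
Proof.
have [dy hy] := airy_reflected_ode.
have dery s : der y s (dy s) by case: (hy s).
have derdy s : der dy s (- s * y s) by case: (hy s).
have [B hB] := airy_energy_ge dery derdy.
have [C [C0 hC]] := ode_amplitude dery derdy airy_nontrivial.
have dsq s : der (fun u => y u ^+ 2) s (2 * y s * dy s).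
  by eapply der_eq; [apply: derX; exact: dery|rewrite /=; ring].
have [|c] := @EVT_max _ (fun u => y u ^+ 2) (-1) 1 (ltac:(lra) : -1 <= 1 :> R).
  by apply: continuous_within => x _; exact: der_continuous (dsq x).
rewrite in_itv /= => _ hmax.
pose D := ode_energy y dy 0 - B.
have D0 : 0 <= D by rewrite subr_ge0.
exists (2 * C + 2 * D + 2 * y c ^+ 2); split.
  by have := sqr_ge0 (y c); lra.
move=> s; have yc := sqr_ge0 (y c).
have sq_le2 (x z : R) : 0 <= z -> x <= z ^+ 2 -> Num.sqrt x <= z.
  by move=> z0 h; rewrite -[leRHS](ger0_norm z0) -sqrtr_sqr ler_wsqrtr.
have [s1|s1] := leP 1 s.
  have h : Num.sqrt (1 + `|s|) <= 2 * Num.sqrt s.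
    apply: sq_le2; first by rewrite mulr_ge0 ?sqrtr_ge0.
    by rewrite exprMn sqr_sqrtr ?ger0_norm; lra.
  have := hC s s1; have := sqr_ge0 (y s).
  have := ler_wpM2l (sqr_ge0 (y s)) h; rewrite -/(y s); lra.
have [s2|s2] := leP (-1) s.
  have h : Num.sqrt (1 + `|s|) <= 2.
    apply: sq_le2 => //.
    have : `|s| <= 1 by rewrite ler_norml; lra.
    by lra.
  have := hmax s; rewrite in_itv /= s2 (ltW s1) => /(_ isT).
  have := ler_wpM2l (sqr_ge0 (y s)) h; rewrite -/(y s); lra.
have h : Num.sqrt (1 + `|s|) <= 2 * - s.
  by apply: sq_le2; [lra|rewrite ltr0_norm; nra].
have := ode_decay dery derdy hB (ltac:(lra) : s < 0).
have := ler_wpM2l (sqr_ge0 (y s)) h; rewrite -/(y s) -/D; lra.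
Qed.

(** At [om k] the energy is [dy^2 >= e0 sqrt (om k)], and [mode_energy] at [s = 0] bounds the weight
    times [Q (om k) - Q 0]. The uniform bound [1 / p0] on the weights absorbs [Q 0], of unknown
    sign, and settles the case [om k < 1]. *)
Lemma mode_weight_bound : exists C : R, 0 < C /\
  forall k, (1 <= k)%N -> mode_weight f k * Num.sqrt (om k) <= C.
Proof.
have [dy hy] := airy_reflected_ode.
have dery s : der y s (dy s) by case: (hy s).
have derdy s : der dy s (- s * y s) by case: (hy s).
have [e0 [e0_gt0 hslope]] := ode_zero_slope dery derdy airy_nontrivial.
pose Q := ode_energy y dy.
have om1 := airy_zeros_gt0 (leqnn 1).
pose p0 := Q (om 1%N) - Q 0.
(* Otherwise [Ai] would vanish somewhere in ]- om 1, 0]. *)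
have p0_gt0 : 0 < p0.
  rewrite subr_gt0; have h0 : 0 <= om 1%N / 2 by lra.
  have [c hc hQ] := @der_MVT _ Q (fun s => y s ^+ 2) _ _ h0
    (fun u _ => der_ode_energy dery derdy u).
  have h1 : om 1%N / 2 <= om 1%N by lra.
  have hQ1 := ode_energy_le dery derdy h1.
  apply: lt_le_trans hQ1; rewrite -subr_gt0 -/Q hQ subr0 mulr_gt0//; last by lra.
  rewrite lt_neqAle sqr_ge0 andbT eq_sym sqrf_eq0; apply/negP => /eqP yc.
  case: om_zeros => _ _ /(_ (- c) yc) [j j1 /eqP].
  by rewrite eqr_opp => /eqP cj; have := airy_zeros_le (leqnn 1) j1; lra.
have W_le k : (1 <= k)%N -> mode_weight f k <= p0^-1.
  move=> k1; have ok := airy_zeros_gt0 k1.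
  have := mode_energy dery derdy k1 (ltW ok).
  have : p0 <= Q (om k) - Q 0.
    by rewrite lerD2r; apply: (ode_energy_le dery derdy); exact: airy_zeros_le.
  have := mode_weight_gt0 k1; rewrite -/Q => W0 hp hW.
  rewrite -[leRHS]mul1r ler_pdivlMr// (le_trans _ hW)//.
  by rewrite ler_wpM2l// ltW.
exists ((1 + `|Q 0| / p0) / e0 + p0^-1); split.
  by rewrite ltr_wpDl ?invr_gt0// divr_ge0 ?(ltW e0_gt0)// addr_ge0// divr_ge0// ltW.
move=> k k1; have W0 := mode_weight_gt0 k1; have Wle := W_le k k1.
have ok := airy_zeros_gt0 k1.
have t1 : 0 <= (1 + `|Q 0| / p0) / e0.
  by rewrite divr_ge0 ?(ltW e0_gt0)// addr_ge0// divr_ge0// ltW.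
have p0V : 0 < p0^-1 by rewrite invr_gt0.
have [ge1|lt1] := leP 1 (om k).
  suff : mode_weight f k * Num.sqrt (om k) <= (1 + `|Q 0| / p0) / e0; first by move=> ?; lra.
  rewrite ler_pdivlMr//.
  have hs := hslope _ ge1 (y_om k1).
  have := mode_energy dery derdy k1 (ltW ok).
  rewrite /ode_energy y_om// expr0n mulr0 add0r -/(ode_energy y dy 0) -/Q => hW.
  have h1 := ler_wpM2l (ltW W0) hs.
  have h2 : mode_weight f k * Q 0 <= `|Q 0| / p0.
    apply: (le_trans (ler_norm _)); rewrite normrM mulrC (gtr0_norm W0).
    by rewrite ler_wpM2l.
  lra.
suff : mode_weight f k * Num.sqrt (om k) <= p0^-1; first by move=> ?; lra.
rewrite (le_trans _ Wle)// ler_piMr ?(ltW W0)//.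
by rewrite -sqrtr1 ler_wsqrtr// ltW.
Qed.

End AiryModes.

(** * Sums over a sequence with gaps *)

Section GappedSums.
Context {R : realType}.
Implicit Types s b : R.

(** Replaces a bound in terms of the last [om n] by one in terms of the cutoff [L]: by induction,
    either [om n <= L] and monotonicity of [G] concludes, or the last term is dropped. *)
Lemma le_sum_cond (om a : nat -> R) (G : R -> R) :
  (forall k, (1 <= k)%N -> 0 <= a k) ->
  (forall n, (1 <= n)%N -> \sum_(1 <= k < n.+1) a k <= G (om n)) ->
  (forall x y, 0 < x -> x <= y -> G x <= G y) ->
  (forall k, (1 <= k)%N -> 0 < om k) ->
  forall (L : R) n, 0 <= G L -> \sum_(1 <= k < n | om k <= L) a k <= G L.
Proof.
move=> a0 hG Gmono om0 L n GL0; elim: n => [|n IH]; first by rewrite big_geq.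
have [->|n1] := posnP n; first by rewrite big_geq.
have [omL|Lom] := leP (om n) L.
  apply: le_trans (Gmono _ _ (om0 n n1) omL); apply: le_trans (hG n n1).
  rewrite [leRHS](bigID (fun k => om k <= L)) /= lerDl.
  rewrite big_seq_cond sumr_ge0// => k; rewrite mem_index_iota => /andP[/andP[k1 _] _].
  exact: a0.
by rewrite big_mkcond big_nat_recr//= (lt_geF Lom) addr0 -big_mkcond.
Qed.

Lemma sqrtB_le (p q : R) : 0 <= q -> q <= p ->
  Num.sqrt p - Num.sqrt q <= Num.sqrt (p - q).
Proof.
move=> q0 qp; rewrite lerBlDr.
rewrite -(@ler_pXn2r _ 2)// ?nnegrE ?addr_ge0 ?sqrtr_ge0//.
rewrite sqrrD !sqr_sqrtr//; [|by lra|by lra].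
have : 0 <= Num.sqrt (p - q) * Num.sqrt q by rewrite mulr_ge0 ?sqrtr_ge0.
by lra.
Qed.

Lemma sqrtB_ge (p d : R) : 0 <= d -> d <= p ->
  d / (2 * Num.sqrt p) <= Num.sqrt p - Num.sqrt (p - d).
Proof.
move=> d0 dp; have [p0|p0] := ltP 0 p; last first.
  have -> : p = 0 by lra.
  have -> : d = 0 by lra.
  by rewrite mul0r subrr subrr.
have sp : 0 < Num.sqrt p by rewrite sqrtr_gt0.
rewrite ler_pdivrMr ?mulr_gt0//.
have e1 : Num.sqrt p ^+ 2 = p by rewrite sqr_sqrtr// ltW.
have e2 : Num.sqrt (p - d) ^+ 2 = p - d by rewrite sqr_sqrtr// subr_ge0.
by have := sqr_ge0 (Num.sqrt p - Num.sqrt (p - d)); nra.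
Qed.

(* An odd primitive of [1 / (2 sqrt (1 + |s|))]. *)
Definition ssqrt s : R :=
  if 0 <= s then Num.sqrt (1 + s) - 1 else 1 - Num.sqrt (1 - s).

Lemma ssqrt_le s s' : s <= s' -> ssqrt s <= ssqrt s'.
Proof.
move=> h; rewrite /ssqrt; have [s0|s0] := leP 0 s.
  have -> : 0 <= s' by lra.
  by rewrite lerD2r ler_wsqrtr//; lra.
have h1 : 1 <= Num.sqrt (1 - s) by rewrite -[leLHS]sqrtr1 ler_wsqrtr//; lra.
have [s'0|s'0] := leP 0 s'.
  have : 1 <= Num.sqrt (1 + s') by rewrite -[leLHS]sqrtr1 ler_wsqrtr//; lra.
  by lra.
by rewrite lerD2l lerN2 ler_wsqrtr//; lra.
Qed.

(** By subadditivity of the square root the increment is controlled by the length alone; this is the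
    source of the uniformity in the centre [b]. *)
Lemma ssqrtB_le s s' : s' <= s -> ssqrt s - ssqrt s' <= 2 * Num.sqrt (s - s').
Proof.
move=> h; rewrite /ssqrt.
have nn : 0 <= Num.sqrt (s - s') by exact: sqrtr_ge0.
have [s0|s0] := leP 0 s; have [s'0|s'0] := leP 0 s'; last 2 first.
- by lra.
- have := @sqrtB_le (1 - s') (1 - s).
  rewrite (_ : 1 - s' - (1 - s) = s - s'); last by ring.
  by move=> /(_ ltac:(lra) ltac:(lra)); lra.
- have := @sqrtB_le (1 + s) (1 + s').
  rewrite (_ : 1 + s - (1 + s') = s - s'); last by ring.
  by move=> /(_ ltac:(lra) ltac:(lra)); lra.
have h1 := @sqrtB_le (1 + s) 1 ler01 ltac:(lra).
have h2 := @sqrtB_le (1 - s') 1 ler01 ltac:(lra).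
rewrite sqrtr1 in h1 h2.
have h3 : Num.sqrt (1 + s - 1) <= Num.sqrt (s - s') by rewrite ler_wsqrtr//; lra.
have h4 : Num.sqrt (1 - s' - 1) <= Num.sqrt (s - s') by rewrite ler_wsqrtr//; lra.
by lra.
Qed.

(** Over a step [d <= 1] the weight [1 + |.|] is at most twice its value at [s], whence 4 in place
    of 2. *)
Lemma ssqrtB_ge s d : 0 <= d -> d <= 1 ->
  d / (4 * Num.sqrt (1 + `|s|)) <= ssqrt s - ssqrt (s - d).
Proof.
move=> d0 d1.
have key (e p q : R) : 0 <= e -> 0 < q -> q <= 4 * p ->
    e / (4 * Num.sqrt p) <= e / (2 * Num.sqrt q).
  move=> e0 q0 qp; have p0 : 0 < p by lra.
  have sp : 0 < Num.sqrt p by rewrite sqrtr_gt0.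
  have sq : 0 < Num.sqrt q by rewrite sqrtr_gt0.
  have : Num.sqrt q <= 2 * Num.sqrt p.
    rewrite -(@ler_pXn2r _ 2)// ?nnegrE ?sqrtr_ge0 ?mulr_ge0 ?sqrtr_ge0//.
    by rewrite exprMn !sqr_sqrtr; lra.
  move=> h; rewrite ler_wpM2l// lef_pV2 ?posrE ?mulr_gt0//; lra.
rewrite /ssqrt; have [s0|s0] := leP 0 s; have [s'0|s'0] := leP 0 (s - d).
- rewrite ger0_norm//.
  have h1 := key d (1 + s) (1 + s) d0 ltac:(lra) ltac:(lra).
  have h2 := @sqrtB_ge (1 + s) d d0 ltac:(lra).
  by rewrite addrA; lra.
- rewrite ger0_norm//.
  have h1 := key s (1 + s) (1 + s) s0 ltac:(lra) ltac:(lra).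
  have h2 := @sqrtB_ge (1 + s) s s0 ltac:(lra).
  have h3 := key (d - s) (1 + s) (1 - (s - d)) ltac:(lra) ltac:(lra) ltac:(lra).
  have h4 := @sqrtB_ge (1 - (s - d)) (d - s) ltac:(lra) ltac:(lra).
  rewrite addrK sqrtr1 in h2.
  rewrite (_ : 1 - (s - d) - (d - s) = 1) ?sqrtr1 in h4; last by ring.
  have -> : d / (4 * Num.sqrt (1 + s))
    = s / (4 * Num.sqrt (1 + s)) + (d - s) / (4 * Num.sqrt (1 + s)) by ring.
  by lra.
- by lra.
- rewrite ltr0_norm//.
  have h1 := key d (1 - s) (1 - (s - d)) d0 ltac:(lra) ltac:(lra).
  have h2 := @sqrtB_ge (1 - (s - d)) d d0 ltac:(lra).
  rewrite (_ : 1 - (s - d) - d = 1 - s) in h2; last by ring.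
  by lra.
Qed.

(** With sixth roots, the exponents [1/2], [1/3], [4/3] and [1/6] of [om k] all become integers. *)
Definition root6 s : R := s `^ 6^-1.

Lemma root6_gt0 s : 0 < s -> 0 < root6 s.
Proof. exact: powR_gt0. Qed.

Lemma root6_6 s : 0 <= s -> root6 s ^+ 6 = s.
Proof.
move=> s0; rewrite /root6 -powR_mulrn ?powR_ge0// -powRrM mulVf ?powRr1//.
Qed.

Lemma root6X s : 0 <= s -> root6 (s ^+ 6) = s.
Proof. by move=> s0; rewrite /root6 -powR_mulrn// -powRrM mulfV ?powRr1. Qed.

Lemma root6_le x z : 0 < x -> x <= z -> root6 x <= root6 z.
Proof. by move=> x0 xz; rewrite ge0_ler_powR// nnegrE; lra. Qed.

Variable om : nat -> R.
Hypothesis om_gt0 : forall k, (1 <= k)%N -> 0 < om k.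
Hypothesis om_lt : forall k l, (1 <= k)%N -> (k < l)%N -> om k < om l.
Hypothesis om_gap : forall k, (1 <= k)%N -> 1 <= om k.+1 * (om k.+1 - om k) ^+ 2.

Lemma sqrt_gap k : (1 <= k)%N -> 1 <= Num.sqrt (om k.+1) * (om k.+1 - om k).
Proof.
move=> k1; have d0 : 0 <= om k.+1 - om k by rewrite subr_ge0 ltW ?om_lt.
rewrite -(@ler_pXn2r _ 2)// ?nnegrE ?mulr_ge0 ?sqrtr_ge0//.
by rewrite expr1n exprMn sqr_sqrtr ?(ltW (om_gt0 _))//; exact: om_gap.
Qed.

(** The gap condition makes [om^(3/2)] grow by at least 1 per step. Beyond [K] the modes lie outside
    the range of [psi2], so the series defining the kernel is finite. *)
Lemma gapped_unbounded (L : R) : exists2 K, (1 <= K)%N &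
  forall k, (K <= k)%N -> L < om k.
Proof.
have grow n : n%:R <= om n.+1 * Num.sqrt (om n.+1).
  elim: n => [|n IH]; first by rewrite mulr_ge0 ?sqrtr_ge0 ?(ltW (om_gt0 _)).
  have g := sqrt_gap (ltn0Sn n); have lt12 := om_lt (ltn0Sn n) (ltnSn n.+1).
  have o1 := om_gt0 (ltn0Sn n).
  have h : Num.sqrt (om n.+1) <= Num.sqrt (om n.+2) by rewrite ler_wsqrtr// ltW.
  have := ler_wpM2l (ltW o1) h; rewrite -natr1; lra.
pose B := Num.max 1 L; have B1 : 1 <= B by rewrite le_max lexx.
exists (Num.truncn (B * B)).+2 => // k hk; rewrite ltNge; apply/negP => omL.
have k1 : (0 < k)%N by exact: leq_trans hk.
have := grow k.-1; rewrite prednK// => hg.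
have okB : om k <= B by rewrite le_max omL orbT.
have sB : Num.sqrt (om k) <= B.
  rewrite -[leRHS]ger0_norm ?(le_trans _ B1)// -sqrtr_sqr ler_wsqrtr//.
  by rewrite (le_trans okB)// expr2 ler_peMr//; lra.
have : om k * Num.sqrt (om k) <= B * B.
  by rewrite ler_pM ?sqrtr_ge0 ?(ltW (om_gt0 _)).
have h1 := truncnS_gt (B * B).
have h2 : (Num.truncn (B * B)).+1%:R <= k.-1%:R :> R by rewrite ler_nat -ltnS prednK.
lra.
Qed.

(** Integral comparison: the intervals [[om k - del k, om k]] have disjoint interiors, each term is
    at most a constant times the increment of [ssqrt] over its interval, and the increments
    telescope. *)
Lemma gapped_sum_sqrt : exists C : R, 0 < C /\ forall b n, (1 <= n)%N ->
  \sum_(1 <= k < n.+1) (Num.sqrt (om k) * Num.sqrt (1 + `|om k - b|))^-1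
    <= C * Num.sqrt (om n).
Proof.
have o1 := om_gt0 (leqnn 1); have so1 : 0 < Num.sqrt (om 1%N) by rewrite sqrtr_gt0.
(* The three bounds give in turn: [del k] below the gap, [del k <= 1] for [ssqrtB_ge], and
   [del 1 <= om 1], so that the intervals stay in [[0, om n]]. *)
pose kap := Num.min 1 (Num.min (Num.sqrt (om 1%N)) (om 1%N * Num.sqrt (om 1%N))).
have kap0 : 0 < kap by rewrite !lt_min ltr01 so1 mulr_gt0.
have kap1 : kap <= 1 by rewrite ge_min lexx.
have kap2 : kap <= Num.sqrt (om 1%N) by rewrite !ge_min lexx orbT.
have kap3 : kap <= om 1%N * Num.sqrt (om 1%N) by rewrite !ge_min lexx !orbT.
exists (8 / kap); split; first by rewrite divr_gt0.
move=> b n n1.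
pose del k := kap / Num.sqrt (om k).
have so_gt0 k : (1 <= k)%N -> 0 < Num.sqrt (om k) by move=> ?; rewrite sqrtr_gt0 om_gt0.
have om1_le k : (1 <= k)%N -> om 1%N <= om k.
  by rewrite leq_eqVlt => /predU1P[<-//|hk]; exact/ltW/om_lt.
have del_ge0 k : (1 <= k)%N -> 0 <= del k by move=> hk; rewrite divr_ge0 ?ltW// so_gt0.
have del_le1 k : (1 <= k)%N -> del k <= 1.
  move=> hk; rewrite ler_pdivrMr ?so_gt0// mul1r (le_trans kap2)//.
  by rewrite ler_wsqrtr// om1_le.
have term k : (1 <= k)%N ->
    (Num.sqrt (om k) * Num.sqrt (1 + `|om k - b|))^-1
    <= 4 / kap * (ssqrt (om k - b) - ssqrt (om k - b - del k)).
  move=> hk; have := ssqrtB_ge (om k - b) (del_ge0 k hk) (del_le1 k hk).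
  have s0 : 0 < Num.sqrt (1 + `|om k - b|) by rewrite sqrtr_gt0 ltr_wpDr.
  have -> : (Num.sqrt (om k) * Num.sqrt (1 + `|om k - b|))^-1
     = 4 / kap * (del k / (4 * Num.sqrt (1 + `|om k - b|))).
    by rewrite /del; field; rewrite !gt_eqF ?so_gt0.
  by apply: ler_wpM2l; rewrite divr_ge0 ?ltW.
have main : \sum_(1 <= k < n.+1) (Num.sqrt (om k) * Num.sqrt (1 + `|om k - b|))^-1
    <= 4 / kap * (ssqrt (om n - b) - ssqrt (om 1%N - b - del 1%N)).
  elim: n n1 => // -[|n] IH _; first by rewrite big_nat1 term.
  rewrite big_nat_recr//= (le_trans (lerD (IH _) (term _ _)))// -mulrDr.
  rewrite ler_wpM2l ?divr_ge0 ?(ltW kap0)//.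
  suff : ssqrt (om n.+1 - b) <= ssqrt (om n.+2 - b - del n.+2) by lra.
  apply: ssqrt_le; have g := sqrt_gap (ltn0Sn n).
  have : del n.+2 <= om n.+2 - om n.+1.
    by rewrite ler_pdivrMr ?so_gt0// (le_trans kap1)// mulrC.
  by lra.
apply: (le_trans main).
have del1 : del 1%N <= om 1%N by rewrite ler_pdivrMr.
have h0 : om 1%N - b - del 1%N <= om n - b.
  by have := om1_le n n1; have := del_ge0 1%N (leqnn 1); lra.
have h1 := ssqrtB_le h0.
have h2 : Num.sqrt (om n - b - (om 1%N - b - del 1%N)) <= Num.sqrt (om n).
  by rewrite ler_wsqrtr//; lra.
have -> : 8 / kap * Num.sqrt (om n) = 4 / kap * (2 * Num.sqrt (om n)) by ring.
by rewrite ler_wpM2l ?divr_ge0 ?(ltW kap0)//; lra.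
Qed.

(** With [v], [w] consecutive sixth roots, the gap reads [1 <= w^3 (w^6 - v^6) <= 6 w^8 (w - v)], so
    each term is at most 6 times an increment. The second part of the constant pays for the first
    term. *)
Lemma gapped_sum_root6 : exists C : R, 0 < C /\ forall n, (1 <= n)%N ->
  \sum_(1 <= k < n.+1) (root6 (om k) ^+ 8)^-1 <= C * root6 (om n).
Proof.
have o1 := om_gt0 (leqnn 1); have v1 := root6_gt0 o1.
have c0 : 0 < (root6 (om 1%N) ^+ 9)^-1 by rewrite invr_gt0 exprn_gt0.
exists (6 + (root6 (om 1%N) ^+ 9)^-1); split; first by lra.
elim=> // -[|n] IH _.
  rewrite big_nat1 mulrDl.
  have -> : (root6 (om 1%N) ^+ 9)^-1 * root6 (om 1%N) = (root6 (om 1%N) ^+ 8)^-1.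
    by field; rewrite gt_eqF.
  by rewrite lerDr mulr_ge0// ltW.
rewrite big_nat_recr//=; apply: le_trans (lerD (IH _) (lexx _)) _ => //.
have on := om_gt0 (ltn0Sn n); have on' := om_gt0 (ltn0Sn n.+1).
have vn := root6_gt0 on; have vn' := root6_gt0 on'.
have g := sqrt_gap (ltn0Sn n).
have hv : root6 (om n.+1) <= root6 (om n.+2).
  by apply: root6_le => //; exact/ltW/om_lt.
have e3 : Num.sqrt (om n.+2) = root6 (om n.+2) ^+ 3.
  rewrite -[in LHS](root6_6 (ltW on')) (exprM _ 3 2) sqrtr_sqr ger0_norm//.
  by rewrite exprn_ge0// ltW.
have {g e3} : 1 <= root6 (om n.+2) ^+ 3 * (root6 (om n.+2) ^+ 6 - root6 (om n.+1) ^+ 6).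
  by rewrite (root6_6 (ltW on')) (root6_6 (ltW on)) -e3.
set v := root6 (om n.+1) in vn hv *; set w := root6 (om n.+2) in vn' hv *.
move=> g; have dw : w ^+ 6 - v ^+ 6 <= 6 * w ^+ 5 * (w - v).
  have h := @der_lipschitz _ (fun x => x ^+ 6) (fun x => 6 * x ^+ 5) v w (6 * w ^+ 5) hv.
  apply: le_trans (ler_norm _) _; apply: h => x /andP[vx xw].
    by eapply der_eq; [der|rewrite /=; ring].
  rewrite normrM normrX !ger0_norm//; last by lra.
  by rewrite ler_wpM2l// lerXn2r ?nnegrE//; lra.
have key : (w ^+ 8)^-1 <= 6 * (w - v).
  rewrite -[leLHS]mul1r ler_pdivrMr ?exprn_gt0//.
  apply: (le_trans g); apply: (@le_trans _ _ (w ^+ 3 * (6 * w ^+ 5 * (w - v)))).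
    by rewrite ler_wpM2l// exprn_ge0// ltW.
  by rewrite le_eqVlt; apply/orP; left; apply/eqP; ring.
have : (root6 (om 1%N) ^+ 9)^-1 * v <= (root6 (om 1%N) ^+ 9)^-1 * w.
  by rewrite ler_wpM2l// ltW.
by lra.
Qed.

End GappedSums.

(** * Van der Corput's lemma *)

Section VanDerCorput.
Context {R : realType}.
Implicit Types (a b z rho K l mu : R).

Lemma cos_primitive_lip (P Psi : R -> R) a b :
  (forall x, a <= x <= b -> der P x (cos (Psi x))) ->
  forall u v, a <= u -> u <= v -> v <= b -> `|P v - P u| <= v - u.
Proof.
move=> hP u v au uv vb; rewrite -[leRHS]mul1r.
apply: (der_lipschitz (df := fun x => cos (Psi x))) => // x hx.
  by apply: hP; lra.
exact: normr_cos.
Qed.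

(** Throughout, [P] is a primitive and [P b - P a] the oscillatory integral. The neighbourhood of
    the critical point [z] is paid by its length, each side by [K]. *)
Lemma split_around (P : R -> R) a b z rho K : a <= z <= b -> 0 < rho -> 0 <= K ->
  (forall u v, a <= u -> u <= v -> v <= b -> `|P v - P u| <= v - u) ->
  (forall v, a <= v -> v <= z - rho -> `|P v - P a| <= K) ->
  (forall u, z + rho <= u -> u <= b -> `|P b - P u| <= K) ->
  `|P b - P a| <= 2 * K + 2 * rho.
Proof.
move=> /andP[az zb] rho0 K0 lip hl hr.
pose a' := Num.max a (z - rho); pose b' := Num.min b (z + rho).
have aa' : a <= a' by rewrite le_max lexx.
have a'z : a' <= z by rewrite ge_max az; lra.
have zb' : z <= b' by rewrite le_min zb; lra.
have b'b : b' <= b by rewrite ge_min lexx.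
have a'm : z - rho <= a' by rewrite le_max lexx orbT.
have b'm : b' <= z + rho by rewrite ge_min lexx orbT.
have h1 : `|P a' - P a| <= K.
  have [h|h] := leP (z - rho) a.
    by rewrite (_ : a' = a) ?subrr ?normr0//; apply/max_idPl.
  by apply: hl => //; rewrite /a' (max_idPr (ltW h)).
have h2 : `|P b - P b'| <= K.
  have [h|h] := leP b (z + rho).
    by rewrite (_ : b' = b) ?subrr ?normr0//; apply/min_idPl.
  by apply: hr => //; rewrite /b' (min_idPr (ltW h)).
have h3 := lip a' b' aa' (le_trans a'z zb') b'b.
by move: h1 h2 h3; rewrite !ler_norml; lra.
Qed.

Section Phase.
Variables (P Psi p dp : R -> R) (a b : R).
Hypothesis ab : a <= b.
Hypothesis der_P : forall x, a <= x <= b -> der P x (cos (Psi x)).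
Hypothesis der_Psi : forall x, a <= x <= b -> der Psi x (p x).
Hypothesis der_p : forall x, a <= x <= b -> der p x (dp x).

(** Integration by parts; since [p] is monotone, the total variation of [1 / p] is the difference of
    its end values. Two boundary terms and these two values make [4 / mu]. *)
Lemma van_der_corput1 mu : 0 < mu ->
  (forall x, a <= x <= b -> 0 <= dp x) ->
  (forall x, a <= x <= b -> mu <= `|p x|) -> `|P b - P a| <= 4 / mu.
Proof.
move=> mu0 dp0 hp.
have p0 x : a <= x <= b -> p x != 0.
  by move=> hx; rewrite -normr_gt0 (lt_le_trans mu0)// hp.
have inv_le x : a <= x <= b -> `|(p x)^-1| <= mu^-1.
  by move=> hx; rewrite normfV lef_pV2 ?posrE// ?normr_gt0 ?p0// hp.
have sin_le x : a <= x <= b -> `|sin (Psi x) / p x| <= mu^-1.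
  move=> hx; rewrite normrM -[leRHS]mul1r.
  by rewrite ler_pM ?normr_sin ?inv_le.
have := @der_le _ (fun x => P x - sin (Psi x) / p x) (fun x => - (p x)^-1)
  (fun x => sin (Psi x) * (dp x / p x ^+ 2)) (fun x => dp x / p x ^+ 2) a b ab.
have h1 x : a <= x <= b -> der (fun x => P x - sin (Psi x) / p x) x
    (sin (Psi x) * (dp x / p x ^+ 2)).
  move=> hx; eapply der_eq.
    apply: derD; first exact: der_P.
    apply: derN; apply: derM; first by apply: der_sin; exact: der_Psi.
    by apply: derV; [exact: p0|exact: der_p].
  by rewrite /=; field; rewrite p0.
have h2 x : a <= x <= b -> der (fun x => - (p x)^-1) x (dp x / p x ^+ 2).
  move=> hx; eapply der_eq.
    by apply: derN; apply: derV; [exact: p0|exact: der_p].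
  by rewrite opprK.
have h3 x : a <= x <= b -> `|sin (Psi x) * (dp x / p x ^+ 2)| <= dp x / p x ^+ 2.
  move=> hx; have h0 : 0 <= dp x / p x ^+ 2 by rewrite divr_ge0 ?sqr_ge0 ?dp0.
  by rewrite normrM (ger0_norm h0) ler_piMl ?normr_sin.
move=> /(_ h1 h2 h3).
have ha : a <= a <= b by rewrite lexx.
have hb : a <= b <= b by rewrite lexx andbT.
have := sin_le a ha; have := sin_le b hb.
have := inv_le a ha; have := inv_le b hb.
by rewrite !ler_norml; lra.
Qed.

End Phase.

Section Second.
Variables (P Psi p dp : R -> R) (a b : R).
Hypothesis ab : a <= b.
Hypothesis der_P : forall x, a <= x <= b -> der P x (cos (Psi x)).
Hypothesis der_Psi : forall x, a <= x <= b -> der Psi x (p x).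
Hypothesis der_p : forall x, a <= x <= b -> der p x (dp x).

(** The bound on [dp] is written [sig^2] because [1 / sig] is the radius to remove around the
    critical point: outside it [|p| >= sig], and [10 = 2 * 4 + 2]. *)
Lemma van_der_corput2 sig : 0 < sig ->
  (forall x, a <= x <= b -> sig ^+ 2 <= dp x) -> `|P b - P a| <= 10 / sig.
Proof.
move=> sig0 hdp.
have grow u v : a <= u -> u <= v -> v <= b -> sig ^+ 2 * (v - u) <= p v - p u.
  move=> au uv vb.
  have := @der_nondecreasing _ (fun x => p x - sig ^+ 2 * x)
    (fun x => dp x - sig ^+ 2) u v uv.
  have h1 x : u <= x <= v -> der (fun x => p x - sig ^+ 2 * x) x (dp x - sig ^+ 2).
    move=> hx; eapply der_eq.
      by apply: derD; [apply: der_p; lra|der].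
    by rewrite /=; ring.
  have h2 x : u <= x <= v -> 0 <= dp x - sig ^+ 2.
    by move=> hx; rewrite subr_ge0 hdp//; lra.
  by move=> /(_ h1 h2); lra.
have s2 : 0 < sig ^+ 2 by rewrite exprn_gt0.
(* [z] is the point where [|p|] is minimal. *)
have [z hz [zl zr]] : exists2 z, a <= z <= b &
    (forall x, a <= x -> x < z -> p x <= - sig ^+ 2 * (z - x)) /\
    (forall x, z < x -> x <= b -> sig ^+ 2 * (x - z) <= p x).
  have [pa|pa] := leP 0 (p a).
    exists a; rewrite ?lexx//; split=> x; first by lra.
    by move=> ax xb; have := grow a x (lexx a) (ltW ax) xb; lra.
  have [pb|pb] := leP (p b) 0.
    exists b; rewrite ?lexx ?andbT//; split=> x; last by lra.
    by move=> ax xb; have := grow x b ax (ltW xb) (lexx b); lra.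
  have [||z hz pz] := @der_IVT _ p a b ab.
  - by move=> x /der_p /der_continuous.
  - by left; rewrite !ltW.
  exists z => //; have /andP[az zb] := hz; split=> x h1 h2.
    by have := grow x z h1 (ltW h2) zb; lra.
  by have := grow z x az (ltW h1) h2; lra.
have /andP[az zb] := hz.
have si0 : 0 < sig^-1 by rewrite invr_gt0.
have ss : sig ^+ 2 * sig^-1 = sig by field; rewrite gt_eqF.
have -> : 10 / sig = 2 * (4 / sig) + 2 * sig^-1 by field; rewrite gt_eqF.
apply: (split_around hz si0); first by rewrite divr_ge0// ltW.
- exact: cos_primitive_lip der_P.
- move=> v av vz.
  have sub x : a <= x <= v -> a <= x <= b by lra.
  apply: (van_der_corput1 av (fun x hx => der_P (sub x hx))
    (fun x hx => der_Psi (sub x hx)) (fun x hx => der_p (sub x hx)) sig0) => x hx.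
    by have := hdp x (sub x hx); lra.
  have := zl x; rewrite ler_normr => h; apply/orP; right.
  have := ler_wpM2l (ltW s2) (ltac:(lra) : sig^-1 <= z - x).
  by rewrite ss; have := h ltac:(lra) ltac:(lra); lra.
- move=> u uz ub.
  have sub x : u <= x <= b -> a <= x <= b by lra.
  apply: (van_der_corput1 ub (fun x hx => der_P (sub x hx))
    (fun x hx => der_Psi (sub x hx)) (fun x hx => der_p (sub x hx)) sig0) => x hx.
    by have := hdp x (sub x hx); lra.
  have := zr x; rewrite ler_normr => h; apply/orP; left.
  have := ler_wpM2l (ltW s2) (ltac:(lra) : sig^-1 <= x - z).
  by rewrite ss; have := h ltac:(lra) ltac:(lra); lra.
Qed.

End Second.

Section Third.
Variables (P Psi p dp : R -> R) (a b : R).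
Hypothesis ab : a <= b.
Hypothesis der_P : forall x, a <= x <= b -> der P x (cos (Psi x)).
Hypothesis der_Psi : forall x, a <= x <= b -> der Psi x (p x).
Hypothesis der_p : forall x, a <= x <= b -> der p x (dp x).

(** Only the factor [G] of the second derivative is differentiated. Outside the radius [1 / l]
    around the sign change of [G], [|dp| >= kap0 g0 / l = l^2], so the second-order test applies,
    and [22 = 2 * 10 + 2]. *)
Lemma van_der_corput3 (kap G dG : R -> R) (kap0 g0 l : R) :
  0 < kap0 -> 0 < g0 -> 0 < l -> l ^+ 3 = kap0 * g0 ->
  (forall x, a <= x <= b -> dp x = kap x * G x) ->
  (forall x, a <= x <= b -> kap0 <= kap x) ->
  (forall x, a <= x <= b -> der G x (dG x)) ->
  (forall x, a <= x <= b -> dG x <= - g0) -> `|P b - P a| <= 22 / l.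
Proof.
move=> kap0_gt0 g0_gt0 l0 l3 dpE hkap derG hdG.
have grow u v : a <= u -> u <= v -> v <= b -> g0 * (v - u) <= G u - G v.
  move=> au uv vb.
  have := @der_nondecreasing _ (fun x => - G x - g0 * x)
    (fun x => - dG x - g0) u v uv.
  have h1 x : u <= x <= v -> der (fun x => - G x - g0 * x) x (- dG x - g0).
    move=> hx; eapply der_eq.
      by apply: derD; [apply: derN; apply: derG; lra|der].
    by rewrite /=; ring.
  have h2 x : u <= x <= v -> 0 <= - dG x - g0.
    by move=> hx; have := hdG x ltac:(lra); lra.
  by move=> /(_ h1 h2); lra.
have [z hz [zl zr]] : exists2 z, a <= z <= b &
    (forall x, a <= x -> x < z -> g0 * (z - x) <= G x) /\
    (forall x, z < x -> x <= b -> G x <= - g0 * (x - z)).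
  have [Ga|Ga] := leP (G a) 0.
    exists a; rewrite ?lexx//; split=> x; first by lra.
    by move=> ax xb; have := grow a x (lexx a) (ltW ax) xb; lra.
  have [Gb|Gb] := leP 0 (G b).
    exists b; rewrite ?lexx ?andbT//; split=> x; last by lra.
    by move=> ax xb; have := grow x b ax (ltW xb) (lexx b); lra.
  have [||z hz Gz] := @der_IVT _ G a b ab.
  - by move=> x /derG /der_continuous.
  - by right; rewrite !ltW.
  exists z => //; have /andP[az zb] := hz; split=> x h1 h2.
    by have := grow x z h1 (ltW h2) zb; lra.
  by have := grow z x az (ltW h1) h2; lra.
have /andP[az zb] := hz.
have li0 : 0 < l^-1 by rewrite invr_gt0.
have ll : kap0 * (g0 * l^-1) = l ^+ 2 by rewrite mulrA -l3; field; rewrite gt_eqF.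
have -> : 22 / l = 2 * (10 / l) + 2 * l^-1 by field; rewrite gt_eqF.
apply: (split_around hz li0); first by rewrite divr_ge0// ltW.
- exact: cos_primitive_lip der_P.
- move=> v av vz.
  have sub x : a <= x <= v -> a <= x <= b by lra.
  apply: (van_der_corput2 av (fun x hx => der_P (sub x hx))
    (fun x hx => der_Psi (sub x hx)) (fun x hx => der_p (sub x hx)) l0) => x hx.
  rewrite dpE ?sub// -ll; apply: ler_pM; rewrite ?(ltW kap0_gt0) ?hkap ?sub//.
    by rewrite mulr_ge0// ltW.
  apply: (le_trans _ (zl x _ _)); [|lra|lra].
  by rewrite ler_wpM2l ?(ltW g0_gt0)//; lra.
- move=> u uz ub.
  have sub x : u <= x <= b -> a <= x <= b by lra.
  (* To the right of [z] the second derivative is negative; the cosine being even, the test is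
     applied to [- Psi]. *)
  apply: (@van_der_corput2 P (fun x => - Psi x) (fun x => - p x) (fun x => - dp x)
    u b ub _ _ _ l l0) => x hx.
  - by rewrite cosN; apply: der_P; exact: sub.
  - by apply: derN; apply: der_Psi; exact: sub.
  - by apply: derN; apply: der_p; exact: sub.
  rewrite dpE ?sub// -ll -mulrN; apply: ler_pM; rewrite ?(ltW kap0_gt0) ?hkap ?sub//.
    by rewrite mulr_ge0// ltW.
  have := zr x ltac:(lra) ltac:(lra).
  have := ler_wpM2l (ltW g0_gt0) (ltac:(lra) : l^-1 <= x - z).
  by lra.
Qed.

End Third.

(** Where [G >= g0] the second derivative is at least [l^3], hence at least [l^2] if [l >= 1]; if
    [l < 1] the trivial bound [b - a] is already below [(b - a) / l]. Both alternatives thus share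
    the third-order rate. *)
Lemma van_der_corput (P Psi p kap G dG : R -> R) a b (kap0 g0 l : R) : a <= b ->
  0 < kap0 -> 0 < g0 -> 0 < l -> l ^+ 3 = kap0 * g0 ->
  (forall x, a <= x <= b -> der P x (cos (Psi x))) ->
  (forall x, a <= x <= b -> der Psi x (p x)) ->
  (forall x, a <= x <= b -> der p x (kap x * G x)) ->
  (forall x, a <= x <= b -> kap0 <= kap x) ->
  (forall x, a <= x <= b -> g0 <= G x) \/
  (forall x, a <= x <= b -> der G x (dG x) /\ dG x <= - g0) ->
  `|P b - P a| <= (22 + (b - a)) / l.
Proof.
move=> ab kap0_gt0 g0_gt0 l0 l3 hP hPsi hp hkap hG.
have ab0 : 0 <= (b - a) / l by rewrite divr_ge0 ?(ltW l0)// subr_ge0.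
rewrite mulrDl; case: hG => [hG|hG]; last first.
  have := @van_der_corput3 P Psi p (fun x => kap x * G x) a b ab hP hPsi hp kap G dG
    kap0 g0 l kap0_gt0 g0_gt0 l0 l3 (fun _ _ => erefl) hkap
    (fun x hx => (hG x hx).1) (fun x hx => (hG x hx).2).
  by lra.
have li0 : 0 < l^-1 by rewrite invr_gt0.
have [l1|l1] := leP 1 l.
  have := @van_der_corput2 P Psi p (fun x => kap x * G x) a b ab hP hPsi hp l l0.
  have h x : a <= x <= b -> l ^+ 2 <= kap x * G x.
    move=> hx; apply: (@le_trans _ _ (l ^+ 3)); first by rewrite ler_weXn2l.
    by rewrite l3; apply: ler_pM; rewrite ?hkap ?hG// ltW.
  by move=> /(_ h); lra.
have := cos_primitive_lip hP (lexx a) ab (lexx b).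
have : b - a <= (b - a) / l by rewrite ler_peMr ?subr_ge0// invf_ge1// ltW.
by lra.
Qed.

(** Integration by parts: the derivative of [Q - g (P - P a)] involves only [dg]. This requires the
    bound [K] on all partial integrals. *)
Lemma oscillatory_amplitude (P Q Psi g dg : R -> R) a b (K M : R) : a <= b -> 0 <= K ->
  (forall x, a <= x <= b -> der P x (cos (Psi x))) ->
  (forall x, a <= x <= b -> der Q x (g x * cos (Psi x))) ->
  (forall x, a <= x <= b -> der g x (dg x)) ->
  (forall x, a <= x <= b -> `|P x - P a| <= K) ->
  (forall x, a <= x <= b -> `|g x| <= M /\ `|dg x| <= M) ->
  `|Q b - Q a| <= M * K * (1 + (b - a)).
Proof.
move=> ab K0 hP hQ hg hK hM.
have hb : a <= b <= b by rewrite lexx andbT.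
have M0 : 0 <= M by have [h _] := hM b hb; exact: le_trans h.
have := @der_lipschitz _ (fun x => Q x - g x * (P x - P a))
  (fun x => - (dg x * (P x - P a))) a b (M * K) ab.
have h1 x : a <= x <= b -> der (fun x => Q x - g x * (P x - P a)) x
    (- (dg x * (P x - P a))).
  move=> hx; eapply der_eq.
    apply: derD; first exact: hQ.
    apply: derN; apply: derM; first exact: hg.
    by apply: derD; [exact: hP|exact: der_cst].
  by rewrite /=; ring.
have h2 x : a <= x <= b -> `|- (dg x * (P x - P a))| <= M * K.
  by move=> hx; rewrite normrN normrM ler_pM ?hK//; case: (hM x hx).
move=> /(_ h1 h2); rewrite subrr mulr0 subr0.
have h3 : `|g b * (P b - P a)| <= M * K.
  by rewrite normrM ler_pM ?hK//; case: (hM b hb).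
by move: h3; rewrite !ler_norml; lra.
Qed.

End VanDerCorput.

(** * The phases *)

Section ModePhase.
Context {R : realType}.
Implicit Types (eta th om kap x : R).

Definition cbrt eta : R := eta `^ 3^-1.

Lemma cbrt_gt0 eta : 0 < eta -> 0 < cbrt eta.
Proof. exact: powR_gt0. Qed.

Lemma cbrt_3 eta : 0 <= eta -> cbrt eta ^+ 3 = eta.
Proof.
by move=> e0; rewrite /cbrt -powR_mulrn ?powR_ge0// -powRrM mulVf ?powRr1.
Qed.

Lemma cbrt_le eta1 eta2 : 0 < eta1 -> eta1 <= eta2 -> cbrt eta1 <= cbrt eta2.
Proof. by move=> h1 h2; rewrite ge0_ler_powR// nnegrE; lra. Qed.

Lemma der_cbrt eta : 0 < eta -> der cbrt eta (3 * cbrt eta ^+ 2)^-1.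
Proof.
move=> e0; have r0 := cbrt_gt0 e0.
have hd : der cbrt eta (3^-1 * eta `^ (3^-1 - 1)) by exact: is_derive1_powR.
apply: der_eq hd _; apply: (mulfI (_ : 3 * cbrt eta ^+ 2 != 0)).
  by rewrite gt_eqF// mulr_gt0// exprn_gt0.
rewrite mulfV; last by rewrite gt_eqF// mulr_gt0// exprn_gt0.
rewrite mulrACA mulfV// mul1r /cbrt -powR_mulrn ?powR_ge0// -powRrM -powRD.
  by rewrite (_ : 3^-1 * 2 + (3^-1 - 1) = 0) ?powRr0//; field.
by rewrite (gt_eqF e0) implybT.
Qed.

Definition mode_root th eta : R := Num.sqrt (cbrt eta ^+ 2 + th).

Lemma mode_root_gt0 th eta : 0 < eta -> 0 < th -> 0 < mode_root th eta.
Proof. by move=> e0 t0; rewrite sqrtr_gt0 addr_gt0// exprn_gt0// cbrt_gt0. Qed.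

Lemma mode_root_2 th eta : 0 < eta -> 0 < th ->
  mode_root th eta ^+ 2 = cbrt eta ^+ 2 + th.
Proof. by move=> e0 t0; rewrite sqr_sqrtr// ltW// addr_gt0// exprn_gt0// cbrt_gt0. Qed.

Lemma der_mode_root th eta : 0 < eta -> 0 < th ->
  der (mode_root th) eta (3 * cbrt eta * mode_root th eta)^-1.
Proof.
move=> e0 t0; have r0 := cbrt_gt0 e0; have s0 := mode_root_gt0 e0 t0.
eapply der_eq.
  apply: (@der_sqrt _ (fun u => cbrt u ^+ 2 + th)).
    by rewrite addr_gt0// exprn_gt0.
  by apply: derD; [apply: derX; exact: der_cbrt|exact: der_cst].
by rewrite -/(mode_root th eta) /=; field; rewrite !gt_eqF.
Qed.

(* h times the frequency of the mode, with th = om_k h^(2/3). *)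
Definition mode_freq th eta : R := cbrt eta ^+ 2 * mode_root th eta.

Definition mode_freq1 th eta : R :=
  (3 * cbrt eta ^+ 2 + 2 * th) / (3 * cbrt eta * mode_root th eta).

(** The second derivative of [mode_freq] stripped of [- th / (9 r^4)], [r = cbrt eta]. That factor
    matches, up to constants and powers of [kap], the one in [der_refl_phase1], so all the second
    derivatives add up inside one [G]. *)
Definition mode_curv th eta : R :=
  (cbrt eta ^+ 2 + 2 * th) / mode_root th eta ^+ 3.

Lemma th_mode_root th eta : 0 < eta -> 0 < th ->
  th = mode_root th eta ^+ 2 - cbrt eta ^+ 2.
Proof. by move=> e0 t0; rewrite mode_root_2//; ring. Qed.

Lemma der_mode_freq th eta : 0 < eta -> 0 < th ->
  der (mode_freq th) eta (mode_freq1 th eta).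
Proof.
move=> e0 t0; have r0 := cbrt_gt0 e0; have s0 := mode_root_gt0 e0 t0.
eapply der_eq.
  by apply: derM; [apply: derX; exact: der_cbrt|exact: der_mode_root].
rewrite /mode_freq1 /= [X in _ + 2 * X](th_mode_root e0 t0).
by field; rewrite !gt_eqF.
Qed.

Lemma der_mode_freq1 th eta : 0 < eta -> 0 < th ->
  der (mode_freq1 th) eta (- (th / (9 * cbrt eta ^+ 4) * mode_curv th eta)).
Proof.
move=> e0 t0; have r0 := cbrt_gt0 e0; have s0 := mode_root_gt0 e0 t0.
eapply der_eq.
  apply: derM.
    apply: derD; last exact: der_cst.
    by apply: derM; [exact: der_cst|apply: derX; exact: der_cbrt].
  apply: derV; first by rewrite gt_eqF// !mulr_gt0.
  apply: derM; last exact: der_mode_root.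
  by apply: derM; [exact: der_cst|exact: der_cbrt].
rewrite /mode_curv /=; have := th_mode_root e0 t0.
set r := cbrt eta in r0 *; set s := mode_root th eta in s0 *; move=> ->.
by field; rewrite !gt_eqF.
Qed.

Lemma der_mode_curv th eta : 0 < eta -> 0 < th -> der (mode_curv th) eta
  (- ((cbrt eta ^+ 2 + 4 * th) / (3 * cbrt eta * mode_root th eta ^+ 5))).
Proof.
move=> e0 t0; have r0 := cbrt_gt0 e0; have s0 := mode_root_gt0 e0 t0.
eapply der_eq.
  apply: derM.
    by apply: derD; [apply: derX; exact: der_cbrt|exact: der_cst].
  apply: derV; first by rewrite gt_eqF// exprn_gt0.
  by apply: derX; exact: der_mode_root.
rewrite /=; have := th_mode_root e0 t0.
set r := cbrt eta in r0 *; set s := mode_root th eta in s0 *; move=> ->.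
by field; rewrite !gt_eqF.
Qed.

(* The Airy argument om_k - (eta / h)^(2/3) x, with kap = h^(1/3). *)
Definition airy_arg om kap x eta : R := om - (cbrt eta / kap) ^+ 2 * x.

Lemma der_airy_arg om kap x eta : 0 < eta -> 0 < kap ->
  der (airy_arg om kap x) eta (- (2 * x / (3 * kap ^+ 2 * cbrt eta))).
Proof.
move=> e0 k0; have r0 := cbrt_gt0 e0; eapply der_eq.
  rewrite /airy_arg; apply: derD; first exact: der_cst.
  apply: derN; apply: derM; last exact: der_cst.
  by apply: derX; apply: derM; [exact: der_cbrt|exact: der_cst].
by rewrite /=; field; rewrite !gt_eqF.
Qed.

Definition refl_phase om kap x eta : R := airy_xi (airy_arg om kap x eta).
Definition refl_phase1 om kap x eta : R :=
  - (2 * x / (3 * kap ^+ 2 * cbrt eta) * Num.sqrt (airy_arg om kap x eta)).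
Definition refl_curv om kap x eta : R := x / Num.sqrt (airy_arg om kap x eta).

Lemma der_refl_phase om kap x eta : 0 < eta -> 0 < kap ->
  0 < airy_arg om kap x eta ->
  der (refl_phase om kap x) eta (refl_phase1 om kap x eta).
Proof.
move=> e0 k0 z0; eapply der_eq.
  by apply: der_comp; [exact: der_airy_xi|exact: der_airy_arg].
by rewrite root4_2 /refl_phase1; ring.
Qed.

Lemma der_refl_phase1 om kap x eta : 0 < eta -> 0 < kap ->
  0 < airy_arg om kap x eta ->
  der (refl_phase1 om kap x) eta
    (2 * om / (9 * kap ^+ 2 * cbrt eta ^+ 4) * refl_curv om kap x eta).
Proof.
move=> e0 k0 z0; have r0 := cbrt_gt0 e0.
have s0 : 0 < Num.sqrt (airy_arg om kap x eta) by rewrite sqrtr_gt0.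
eapply der_eq.
  apply: derN; apply: derM.
    apply: derM; first exact: der_cst.
    apply: derV; first by rewrite gt_eqF// !mulr_gt0// exprn_gt0.
    by apply: derM; [exact: der_cst|exact: der_cbrt].
  by apply: (@der_sqrt _ (airy_arg om kap x)); [|exact: der_airy_arg].
rewrite /refl_curv /=.
have omE : om = Num.sqrt (airy_arg om kap x eta) ^+ 2 + (cbrt eta / kap) ^+ 2 * x.
  by rewrite sqr_sqrtr ?(ltW z0)// /airy_arg; ring.
move: s0 omE; move: (Num.sqrt _) => s s0 ->.
by field; rewrite !gt_eqF.
Qed.

Lemma der_refl_curv om kap x eta : 0 < eta -> 0 < kap ->
  0 < airy_arg om kap x eta ->
  der (refl_curv om kap x) eta
    (x ^+ 2 / (3 * kap ^+ 2 * cbrt eta * Num.sqrt (airy_arg om kap x eta) ^+ 3)).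
Proof.
move=> e0 k0 z0; have r0 := cbrt_gt0 e0.
have s0 : 0 < Num.sqrt (airy_arg om kap x eta) by rewrite sqrtr_gt0.
eapply der_eq.
  apply: derM; first exact: der_cst.
  apply: derV; first by rewrite gt_eqF.
  by apply: (@der_sqrt _ (airy_arg om kap x)); [|exact: der_airy_arg].
by rewrite /=; field; rewrite !gt_eqF.
Qed.

(** The signs [s1], [s2] come from expanding a product of cosines; [s0] collects constant shifts,
    such as those turning sines into cosines. *)
Definition mode_phase om kap t y a x (s1 s2 s0 : R) eta : R :=
  kap ^- 3 * (y * eta - t * mode_freq (om * kap ^+ 2) eta)
  + s1 * refl_phase om kap a eta + s2 * refl_phase om kap x eta + s0.

Lemma mode_phase_vdc_pos (c d Th : R) : 0 < c -> c <= d -> 0 < Th ->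
  exists C : R, 0 < C /\ forall om kap t y a x s1 s2 s0 l : R,
  0 < om -> 0 < kap -> om * kap ^+ 2 <= Th -> 0 < t -> 0 <= x -> x <= a ->
  s1 = 1 \/ s1 = -1 -> s2 = 1 \/ s2 = -1 ->
  (forall eta, c <= eta <= d -> 0 < airy_arg om kap a eta) ->
  0 < l -> l ^+ 3 = om * t / kap ->
  forall (P : R -> R), (forall eta, c <= eta <= d ->
    der P eta (cos (mode_phase om kap t y a x s1 s2 s0 eta))) ->
  forall u, c <= u <= d -> `|P u - P c| <= C / l.
Proof.
move=> c0 cd Th0; have d0 : 0 < d by lra.
have rc0 := cbrt_gt0 c0; have rd0 := cbrt_gt0 d0.
set rc := cbrt c in rc0; set rd := cbrt d in rd0.
pose S := 1 + rd ^+ 2 + Th.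
have rd2 : 0 < rd ^+ 2 by rewrite exprn_gt0.
have S1 : 1 <= S by rewrite /S; lra.
have S0 : 0 < S by lra.
(* The first term bounds [mode_curv] below, the second minus its derivative, for every [th <= Th],
   as [mode_root <= S]. *)
pose m := Num.min (rc ^+ 2 / S ^+ 3) (rc ^+ 2 / (3 * rd * S ^+ 5)).
have m0 : 0 < m by rewrite lt_min !divr_gt0// ?mulr_gt0// exprn_gt0.
have e3 : 0 < m / (9 * rd ^+ 4) by rewrite divr_gt0// mulr_gt0// exprn_gt0.
(* Chosen so that [(l e)^3 = k0 (t m)], the relation required by [van_der_corput]. *)
pose e := cbrt (m / (9 * rd ^+ 4)); have e0 : 0 < e by exact: cbrt_gt0.
exists ((22 + (d - c)) / e); split; first by rewrite divr_gt0//; lra.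
move=> om kap t y a x s1 s2 s0 l om0 kap0 omTh t0 x0 xa hs1 hs2 harg l0 l3 P hP u.
move=> /andP[cu ud].
pose th := om * kap ^+ 2; have th0 : 0 < th by rewrite mulr_gt0// exprn_gt0.
have sub eta : c <= eta <= u -> c <= eta <= d by lra.
have eta_gt0 eta : c <= eta <= d -> 0 < eta by lra.
have rle eta : c <= eta <= d -> rc <= cbrt eta <= rd.
  move=> /andP[h1 h2]; rewrite !cbrt_le//; lra.
have sle eta : c <= eta <= d -> mode_root th eta <= S.
  move=> he; have /andP[h1 h2] := rle _ he; have r0 := cbrt_gt0 (eta_gt0 _ he).
  rewrite -(@ler_pXn2r _ 2)// ?nnegrE ?sqrtr_ge0 ?(ltW S0)//.
  rewrite (mode_root_2 (eta_gt0 _ he) th0).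
  have : cbrt eta ^+ 2 <= rd ^+ 2 by rewrite ler_pXn2r// nnegrE ltW.
  have : S <= S ^+ 2 by rewrite expr2 ler_peMl// ltW.
  have : th <= Th by [].
  by rewrite {1}/S; lra.
have argx eta : c <= eta <= d -> airy_arg om kap a eta <= airy_arg om kap x eta.
  by move=> _; rewrite lerD2l lerN2 ler_wpM2l// sqr_ge0.
have argx0 eta : c <= eta <= d -> 0 < airy_arg om kap x eta.
  by move=> he; exact: lt_le_trans (harg _ he) (argx _ he).
have a0 : 0 <= a by exact: le_trans xa.
pose p eta := kap ^- 3 * (y - t * mode_freq1 th eta)
  + s1 * refl_phase1 om kap a eta + s2 * refl_phase1 om kap x eta.
pose kp eta := th / (9 * kap ^+ 3 * cbrt eta ^+ 4).
pose G eta := t * mode_curv th eta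
  + 2 / kap * (s1 * refl_curv om kap a eta + s2 * refl_curv om kap x eta).
pose dF z eta : R :=
  z ^+ 2 / (3 * kap ^+ 2 * cbrt eta * Num.sqrt (airy_arg om kap z eta) ^+ 3).
pose dG eta :=
  t * - ((cbrt eta ^+ 2 + 4 * th) / (3 * cbrt eta * mode_root th eta ^+ 5))
  + 2 / kap * (s1 * dF a eta + s2 * dF x eta).
pose k0 := th / (9 * kap ^+ 3 * rd ^+ 4).
have k00 : 0 < k0 by rewrite divr_gt0// !mulr_gt0// exprn_gt0.
have tm0 : 0 < t * m by rewrite mulr_gt0.
have le0 : 0 < l * e by rewrite mulr_gt0.
have le3 : (l * e) ^+ 3 = k0 * (t * m).
  rewrite exprMn l3 /e cbrt_3 ?(ltW e3)// /k0 /th.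
  by field; rewrite !gt_eqF.
have -> : (22 + (d - c)) / e / l = (22 + (d - c)) / (l * e) by field; rewrite !gt_eqF.
apply: (@le_trans _ _ ((22 + (u - c)) / (l * e))); last first.
  by rewrite ler_wpM2r ?invr_ge0 ?(ltW le0)//; lra.
apply: (@van_der_corput _ P (mode_phase om kap t y a x s1 s2 s0) p kp G dG
  c u k0 (t * m) (l * e) cu k00 tm0 le0 le3) => [eta /sub|eta /sub|eta /sub|eta /sub|].
- exact: hP.
- move=> he; have e_0 := eta_gt0 _ he.
  eapply der_eq.
    apply: derD; last exact: der_cst.
    apply: derD; last by apply: derM; [exact: der_cst|apply: der_refl_phase => //; exact: argx0].
    apply: derD; last by apply: derM; [exact: der_cst|apply: der_refl_phase => //; exact: harg].
    apply: derM; first exact: der_cst.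
    apply: derD; first by der.
    by apply: derN; apply: derM; [exact: der_cst|exact: der_mode_freq].
  by rewrite /p /=; ring.
- move=> he; have e_0 := eta_gt0 _ he; have r0 := cbrt_gt0 e_0.
  eapply der_eq.
    apply: derD; last by apply: derM; [exact: der_cst|apply: der_refl_phase1 => //; exact: argx0].
    apply: derD; last by apply: derM; [exact: der_cst|apply: der_refl_phase1 => //; exact: harg].
    apply: derM; first exact: der_cst.
    apply: derD; first by der.
    by apply: derN; apply: derM; [exact: der_cst|exact: der_mode_freq1].
  by rewrite /kp /G /th /=; field; rewrite !gt_eqF.
- move=> he; have /andP[h1 h2] := rle _ he; have r0 := cbrt_gt0 (eta_gt0 _ he).
  rewrite ler_wpM2l ?(ltW th0)// lef_pV2 ?posrE ?mulr_gt0 ?exprn_gt0//.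
  by rewrite ler_wpM2l ?mulr_ge0 ?exprn_ge0 ?(ltW kap0)// lerXn2r ?nnegrE// ltW.
have F_ge0 z eta : 0 <= z -> 0 <= refl_curv om kap z eta.
  by move=> z0; rewrite divr_ge0// sqrtr_ge0.
have F_le eta : c <= eta <= d -> refl_curv om kap x eta <= refl_curv om kap a eta.
  move=> he; rewrite ler_pM ?invr_ge0 ?sqrtr_ge0//.
  by rewrite lef_pV2 ?posrE ?sqrtr_gt0 ?argx0 ?harg// ler_wsqrtr// argx.
have dF_ge0 z eta : c <= eta <= d -> 0 <= dF z eta.
  move=> he; have r0 := cbrt_gt0 (eta_gt0 _ he).
  by rewrite divr_ge0 ?sqr_ge0// !mulr_ge0 ?exprn_ge0 ?sqrtr_ge0 ?(ltW kap0) ?(ltW r0).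
have dF_le eta : c <= eta <= d -> dF x eta <= dF a eta.
  move=> he; have r0 := cbrt_gt0 (eta_gt0 _ he).
  have sa : 0 < Num.sqrt (airy_arg om kap a eta) by rewrite sqrtr_gt0 harg.
  have sx : 0 < Num.sqrt (airy_arg om kap x eta) by rewrite sqrtr_gt0 argx0.
  have pre : 0 < 3 * kap ^+ 2 * cbrt eta by rewrite !mulr_gt0// exprn_gt0.
  apply: ler_pM; rewrite ?sqr_ge0//.
  - by rewrite invr_ge0 mulr_ge0 ?exprn_ge0 ?(ltW pre)// ltW.
  - by rewrite lerXn2r// nnegrE.
  rewrite lef_pV2 ?posrE ?(mulr_gt0 pre) ?exprn_gt0// ler_wpM2l ?(ltW pre)//.
  by rewrite lerXn2r ?nnegrE ?ler_wsqrtr ?argx ?sqrtr_ge0.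
have k2 : 0 <= 2 / kap by rewrite divr_ge0// ltW.
(* The two reflection terms have a sign and a monotonicity dictated by the
   dominant one, so they never cancel both [t m] and its derivative. *)
case: hs1 => hs1; [left|right] => eta /sub he.
  have /andP[h1 h2] := rle _ he; have r0 := cbrt_gt0 (eta_gt0 _ he).
  have st0 := mode_root_gt0 (eta_gt0 _ he) th0.
  have hS : 0 <= s1 * refl_curv om kap a eta + s2 * refl_curv om kap x eta.
    have := F_ge0 a eta a0; have := F_ge0 x eta x0; have := F_le eta he.
    by rewrite hs1; case: hs2 => ->; lra.
  have hm : m <= mode_curv th eta.
    apply: (@le_trans _ _ (rc ^+ 2 / S ^+ 3)); first by rewrite ge_min lexx.
    apply: ler_pM; rewrite ?sqr_ge0 ?invr_ge0 ?exprn_ge0 ?(ltW S0)//.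
      have : rc ^+ 2 <= cbrt eta ^+ 2 by rewrite ler_pXn2r// nnegrE ltW.
      lra.
    rewrite lef_pV2 ?posrE ?exprn_gt0// lerXn2r ?nnegrE ?(ltW S0) ?(ltW st0)//.
    exact: sle.
  have := ler_wpM2l (ltW t0) hm; have := mulr_ge0 k2 hS.
  by rewrite /G; lra.
have e_0 := eta_gt0 _ he.
split.
  rewrite /G /dG; apply: derD.
    by eapply der_eq; [apply: derM; [exact: der_cst|exact: der_mode_curv]|rewrite mul0r add0r].
  eapply der_eq.
    apply: derM; first exact: der_cst.
    apply: derD; apply: derM; [exact: der_cst| |exact: der_cst|].
      by apply: der_refl_curv => //; exact: harg.
    by apply: der_refl_curv => //; exact: argx0.
  by rewrite /dF /=; ring.
have /andP[h1 h2] := rle _ he; have r0 := cbrt_gt0 (eta_gt0 _ he).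
have st0 := mode_root_gt0 (eta_gt0 _ he) th0.
have hS : 0 <= - (s1 * dF a eta + s2 * dF x eta).
  have := dF_ge0 a eta he; have := dF_ge0 x eta he; have := dF_le eta he.
  by rewrite hs1; case: hs2 => ->; lra.
have hm : m <= (cbrt eta ^+ 2 + 4 * th) / (3 * cbrt eta * mode_root th eta ^+ 5).
  apply: (@le_trans _ _ (rc ^+ 2 / (3 * rd * S ^+ 5))); first by rewrite ge_min lexx orbT.
  have pos1 : 0 < 3 * rd * S ^+ 5 by rewrite !mulr_gt0// exprn_gt0.
  have pos2 : 0 < 3 * cbrt eta * mode_root th eta ^+ 5.
    by rewrite !mulr_gt0// exprn_gt0.
  apply: ler_pM; rewrite ?sqr_ge0 ?invr_ge0 ?(ltW pos1)//.
    have : rc ^+ 2 <= cbrt eta ^+ 2 by rewrite ler_pXn2r// nnegrE ltW.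
    lra.
  rewrite lef_pV2 ?posrE//; apply: ler_pM; rewrite ?mulr_ge0 ?exprn_ge0 ?(ltW r0) ?(ltW st0)//.
    by rewrite ler_wpM2l.
  by rewrite lerXn2r ?nnegrE ?(ltW S0) ?(ltW st0)// sle.
have := ler_wpM2l (ltW t0) hm; have := mulr_ge0 k2 hS.
by rewrite /dG mulrN; lra.
Qed.

Lemma mode_phaseN om kap t y a x s1 s2 s0 eta :
  mode_phase om kap (- t) (- y) a x (- s1) (- s2) (- s0) eta
  = - mode_phase om kap t y a x s1 s2 s0 eta.
Proof. by rewrite /mode_phase; ring. Qed.

(** Negative times reduce to positive ones: the cosine is even, and negating the phase negates [t],
    [y], both signs and the shift. *)
Lemma mode_phase_vdc (c d Th : R) : 0 < c -> c <= d -> 0 < Th ->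
  exists C : R, 0 < C /\ forall om kap t y a x s1 s2 s0 l : R,
  0 < om -> 0 < kap -> om * kap ^+ 2 <= Th -> t != 0 -> 0 <= x -> x <= a ->
  s1 = 1 \/ s1 = -1 -> s2 = 1 \/ s2 = -1 ->
  (forall eta, c <= eta <= d -> 0 < airy_arg om kap a eta) ->
  0 < l -> l ^+ 3 = om * `|t| / kap ->
  forall (P : R -> R), (forall eta, c <= eta <= d ->
    der P eta (cos (mode_phase om kap t y a x s1 s2 s0 eta))) ->
  forall u, c <= u <= d -> `|P u - P c| <= C / l.
Proof.
move=> c0 cd Th0; have [C [C0 hC]] := mode_phase_vdc_pos c0 cd Th0.
exists C; split=> // om kap t y a x s1 s2 s0 l om0 kap0 omTh t0 x0 xa hs1 hs2 harg l0 l3 P hP.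
have [t_gt0|t_le0] := ltP 0 t.
  by apply: (hC om kap t y a x s1 s2 s0 l) => //; rewrite l3 gtr0_norm.
have tN : 0 < - t by rewrite oppr_gt0 lt_neqAle t0.
apply: (hC om kap (- t) (- y) a x (- s1) (- s2) (- s0) l) => //.
- by case: hs1 => ->; [right|left]; rewrite ?opprK.
- by case: hs2 => ->; [right|left]; rewrite ?opprK.
- by rewrite l3 ler0_norm.
by move=> eta he; rewrite mode_phaseN cosN; exact: hP.
Qed.

End ModePhase.

(** * The amplitudes *)

Section Oscillation.
Context {R : realType}.
Variables c d : R.
Hypothesis cd : c <= d.

Definition amplitude (f : R -> R) (M : R) := exists df : R -> R,
  forall x, c <= x <= d -> [/\ der f x (df x), `|f x| <= M & `|df x| <= M].

(** A bound on the integral of [F], read on primitives; the continuity clause provides a primitive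
    of each summand when a sum is split. *)
Definition oscillating (F : R -> R) (K : R) :=
  (forall x, c <= x <= d -> {for x, continuous F}) /\
  forall Q, (forall x, c <= x <= d -> der Q x (F x)) -> `|Q d - Q c| <= K.

Lemma amplitude_ge0 f M : amplitude f M -> 0 <= M.
Proof.
by move=> [df /(_ c)]; rewrite lexx cd => /(_ isT)[_ h _]; exact: le_trans h.
Qed.

Lemma amplitudeM f g M N : amplitude f M -> amplitude g N ->
  amplitude (fun x => f x * g x) (2 * M * N).
Proof.
move=> hM hN; have M0 := amplitude_ge0 hM; have N0 := amplitude_ge0 hN.
case: hM hN => df hf [dg hg]; exists (fun x => df x * g x + f x * dg x) => x hx.
have [h1 h2 h3] := hf x hx; have [h4 h5 h6] := hg x hx; split.
- exact: derM.
- have MN : 0 <= M * N by rewrite mulr_ge0.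
  by rewrite normrM (le_trans (ler_pM _ _ h2 h5))//; lra.
- rewrite (le_trans (ler_normD _ _))// !normrM -mulrA mulr2n mulrDl mul1r.
  by apply: lerD; exact: ler_pM.
Qed.

Lemma oscillatingD F1 F2 K1 K2 : oscillating F1 K1 -> oscillating F2 K2 ->
  oscillating (fun x => F1 x + F2 x) (K1 + K2).
Proof.
move=> [c1 h1] [c2 h2]; split=> [x hx|Q hQ].
  by apply: continuousD; [exact: c1|exact: c2].
have [Q1 [_ dQ1 _]] := segment_primitive cd c1.
have := h1 Q1 dQ1.
have := h2 (fun x => Q x - Q1 x) => h.
have {h} : `|Q d - Q1 d - (Q c - Q1 c)| <= K2.
  apply: h => x hx; eapply der_eq; first by apply: derD; [exact: hQ|apply: derN; exact: dQ1].
  by ring.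
by rewrite !ler_norml; lra.
Qed.

End Oscillation.

Section ModeAmplitude.
Context {R : realType}.

Lemma smooth_bound (u : R -> R) (a b : R) : smooth u -> a <= b ->
  exists M : R, 0 < M /\ exists du : R -> R, forall x, a <= x <= b ->
    [/\ der u x (du x), `|u x| <= M & `|du x| <= M].
Proof.
move=> su ab.
have bnd (f : R -> R) : (forall x, derivable f x 1) ->
    exists M : R, forall x, a <= x <= b -> `|f x| <= M.
  move=> df; have cf : {within `[a, b], continuous f}.
    by apply: continuous_within => x _; apply/differentiable_continuous/derivable1_diffP.
  have [y _ hy] := EVT_max ab cf; have [z _ hz] := EVT_min ab cf.
  exists (`|f y| + `|f z|) => x hx; rewrite ler_norml.
  have := hy x; have := hz x; rewrite in_itv /= hx => /(_ isT) h1 /(_ isT) h2.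
  have := ler_norm (f y); have := ler_norm (- f z); rewrite normrN.
  have := normr_ge0 (f y); have := normr_ge0 (f z); lra.
have [M1 h1] := bnd u (su 0%N); have [M2 h2] := bnd _ (su 1%N).
have ha : a <= a <= b by rewrite lexx.
have M10 : 0 <= M1 by exact: le_trans (h1 a ha).
have M20 : 0 <= M2 by exact: le_trans (h2 a ha).
exists (M1 + M2 + 1); split; first by lra.
exists (derive1n 1 u) => x hx; split.
- by rewrite /= ; apply: DeriveDef; [exact: (su 0%N)|rewrite derive1E].
- by have := h1 x hx; lra.
- by have := h2 x hx; lra.
Qed.

Variables c d Th : R.
Hypotheses (c0 : 0 < c) (cd : c <= d) (Th0 : 0 < Th).

Let eta_gt0 (eta : R) : c <= eta <= d -> 0 < eta.
Proof. by move: c0; lra. Qed.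

Let S : R := 1 + cbrt d ^+ 2 + Th.

Let rc0 : 0 < cbrt c. Proof. exact: cbrt_gt0. Qed.
Let rd0 : 0 < cbrt d. Proof. by apply: cbrt_gt0; move: c0 cd; lra. Qed.

Let S1 : 1 <= S.
Proof.
have : 0 < cbrt d ^+ 2 by rewrite exprn_gt0.
by rewrite /S; move: Th0; lra.
Qed.

Let cbrt_bounds (eta : R) : c <= eta <= d -> cbrt c <= cbrt eta <= cbrt d.
Proof. by move=> /andP[h1 h2]; rewrite !cbrt_le//; move: c0; lra. Qed.

Lemma mode_root_le th (eta : R) : 0 < th -> th <= Th -> c <= eta <= d ->
  mode_root th eta <= S.
Proof.
move=> th0 thTh he; have /andP[h1 h2] := cbrt_bounds he.
have e0 := eta_gt0 he; have r0 := cbrt_gt0 e0.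
have S0 : 0 <= S by apply: le_trans S1.
rewrite -(@ler_pXn2r _ 2)// ?nnegrE ?sqrtr_ge0// (mode_root_2 e0 th0).
have : cbrt eta ^+ 2 <= cbrt d ^+ 2 by rewrite ler_pXn2r// nnegrE ltW.
have : S <= S ^+ 2 by rewrite expr2 ler_peMl.
by rewrite {1}/S; lra.
Qed.

Lemma amplitude_mode_freq u : smooth u -> exists M : R, 0 < M /\
  forall th, 0 < th -> th <= Th -> amplitude c d (fun eta => u (mode_freq th eta)) M.
Proof.
move=> su; pose B := cbrt d ^+ 2 * S.
have S0 : 0 < S by apply: lt_le_trans S1.
have B0 : 0 <= B by rewrite mulr_ge0 ?exprn_ge0// ltW.
have [M [M0 [du hu]]] := smooth_bound su B0.
pose D := (3 * cbrt d ^+ 2 + 2 * Th) / (3 * cbrt c * cbrt c).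
have D0 : 0 < D.
  by rewrite divr_gt0 ?mulr_gt0// addr_gt0 ?mulr_gt0 ?exprn_gt0.
exists (M + M * D); split; first by rewrite addr_gt0// mulr_gt0.
move=> th th0 thTh; exists (fun eta => du (mode_freq th eta) * mode_freq1 th eta) => eta he.
have e0 := eta_gt0 he; have r0 := cbrt_gt0 e0; have s0 := mode_root_gt0 e0 th0.
have /andP[h1 h2] := cbrt_bounds he.
have [|k1 k2 k3] := hu (mode_freq th eta).
  rewrite mulr_ge0 ?exprn_ge0 ?(ltW r0) ?(ltW s0)//=.
  apply: ler_pM; rewrite ?exprn_ge0 ?(ltW r0) ?(ltW s0) ?mode_root_le//.
  by rewrite lerXn2r// nnegrE ltW.
have MD : 0 <= M * D by rewrite ltW// mulr_gt0.
split.
- by apply: der_comp => //; exact: der_mode_freq.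
- by lra.
- rewrite normrM; apply: (@le_trans _ _ (M * D)); last by lra.
  have p1 : 0 < 3 * cbrt eta ^+ 2 + 2 * th by rewrite addr_gt0 ?mulr_gt0 ?exprn_gt0.
  have p2 : 0 < 3 * cbrt eta * mode_root th eta by rewrite !mulr_gt0.
  apply: ler_pM => //; rewrite /mode_freq1 normrM normfV (gtr0_norm p1) (gtr0_norm p2).
  apply: ler_pM.
  + by rewrite addr_ge0 ?mulr_ge0 ?exprn_ge0 ?(ltW r0) ?(ltW th0).
  + by rewrite invr_ge0 !mulr_ge0 ?(ltW r0) ?(ltW s0).
  + have : cbrt eta ^+ 2 <= cbrt d ^+ 2 by rewrite lerXn2r// nnegrE ltW.
    by lra.
  + have rs : cbrt eta <= mode_root th eta.
      rewrite -(@ler_pXn2r _ 2)// ?nnegrE ?(ltW r0) ?(ltW s0)//.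
      by rewrite mode_root_2// lerDl ltW.
    rewrite lef_pV2 ?posrE ?mulr_gt0//; apply: ler_pM; rewrite ?mulr_ge0 ?(ltW rc0)//.
      by rewrite ler_wpM2l.
    exact: le_trans rs.
Qed.

Lemma amplitude_cbrt : exists M : R, 0 < M /\ forall W kap, 0 <= W -> 0 < kap ->
  amplitude c d (fun eta => W * (cbrt eta / kap) ^+ 2) (M * (W * kap ^- 2)).
Proof.
exists (cbrt d ^+ 2 + (cbrt c)^-1); split; first by rewrite addr_gt0 ?exprn_gt0 ?invr_gt0.
move=> W kap W0 kap0; exists (fun eta => 2 / (3 * cbrt eta) * (W * kap ^- 2)) => eta he.
have e0 := eta_gt0 he; have r0 := cbrt_gt0 e0; have /andP[h1 h2] := cbrt_bounds he.
have Wk : 0 <= W * kap ^- 2 by rewrite mulr_ge0// invr_ge0 exprn_ge0// ltW.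
have ci : (cbrt eta)^-1 <= (cbrt c)^-1 by rewrite lef_pV2.
have ci0 : 0 < (cbrt c)^-1 by rewrite invr_gt0.
have ei0 : 0 < (cbrt eta)^-1 by rewrite invr_gt0.
have d2 : 0 < cbrt d ^+ 2 by rewrite exprn_gt0.
split.
- eapply der_eq.
    apply: derM; first exact: der_cst.
    by apply: derX; apply: derM; [exact: der_cbrt|exact: der_cst].
  by rewrite /=; field; rewrite !gt_eqF.
- rewrite (_ : W * _ = cbrt eta ^+ 2 * (W * kap ^- 2)); last by field; rewrite gt_eqF.
  rewrite ger0_norm; last by rewrite mulr_ge0 ?exprn_ge0// ltW.
  have : cbrt eta ^+ 2 <= cbrt d ^+ 2 by rewrite lerXn2r// nnegrE ltW.
  by move=> h; rewrite ler_wpM2r//; lra.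
- rewrite ger0_norm; last by rewrite mulr_ge0// divr_ge0// mulr_ge0// ltW.
  rewrite ler_wpM2r//.
  have -> : 2 / (3 * cbrt eta) = 2 / 3 * (cbrt eta)^-1 by field; rewrite gt_eqF.
  by lra.
Qed.

(** Since [om <= 2 z], the argument [z] has [|dz / d eta| <= z / c], which cancels the factor
    [1 / z] in the derivatives of [al] and of [root4]. The bound is therefore independent of [kap]
    and [x]. *)
Lemma amplitude_airy (al dal : R -> R) (C : R) : 0 < C ->
  (forall s, 1 <= s -> [/\ der al s (dal s), `|al s| <= C & `|dal s| <= C / s]) ->
  forall om kap x, 2 <= om -> 0 < kap -> 0 <= x ->
  (forall eta, c <= eta <= d -> om / 2 <= airy_arg om kap x eta) ->
  amplitude c d (fun eta => al (airy_arg om kap x eta) / root4 (airy_arg om kap x eta))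
    ((2 * C + 4 * C / c) / root4 om).
Proof.
move=> C0 hal om kap x om2 kap0 x0 harg.
have om0 : 0 < om by lra.
have qom0 := root4_gt0 om0.
exists (fun eta => let z := airy_arg om kap x eta in
  - (2 * x / (3 * kap ^+ 2 * cbrt eta)) * (dal z / root4 z - al z / (4 * root4 z ^+ 5))) => eta he.
have e0 := eta_gt0 he; have r0 := cbrt_gt0 e0; have hz := harg _ he.
have dz := der_airy_arg om x e0 kap0.
set z := airy_arg om kap x eta in hz dz *.
have z1 : 1 <= z by lra.
have z0 : 0 < z by lra.
have q0 := root4_gt0 z0.
have [h1 h2 h3] := hal z z1.
have qV : (root4 z)^-1 <= 2 / root4 om.
  rewrite -[leRHS]invrK invf_div lef_pV2 ?posrE ?divr_gt0//.
  rewrite -(@ler_pXn2r _ 4)// ?nnegrE ?divr_ge0 ?(ltW q0) ?(ltW qom0)//.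
  by rewrite expr_div_n !root4_4 ?(ltW z0) ?(ltW om0)//; lra.
have q00 : 0 < (root4 z)^-1 by rewrite invr_gt0.
have Cc : 0 < C / c by rewrite divr_gt0.
have ME : (2 * C + 4 * C / c) / root4 om = (C + 2 * (C / c)) * (2 / root4 om).
  by field; rewrite !gt_eqF.
split.
- eapply der_eq.
    apply: derM; first by apply: (@der_comp _ (airy_arg om kap x) al); [exact: h1|exact: dz].
    apply: derV; first by rewrite gt_eqF.
    by apply: (@der_comp _ (airy_arg om kap x) root4); [exact: der_root4|exact: dz].
  by rewrite /= -/z; field; rewrite !gt_eqF.
- rewrite normrM normfV (gtr0_norm q0) ME; apply: ler_pM => //; lra.
- have hx : `|- (2 * x / (3 * kap ^+ 2 * cbrt eta))| <= z / c.
    rewrite normrN ger0_norm; last first.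
      by rewrite divr_ge0 ?mulr_ge0 ?exprn_ge0 ?(ltW kap0) ?(ltW r0).
    have -> : 2 * x / (3 * kap ^+ 2 * cbrt eta) = 2 / 3 * (om - z) / cbrt eta ^+ 3.
      by rewrite /z /airy_arg; field; rewrite !gt_eqF.
    rewrite (cbrt_3 (ltW e0)).
    have zE : om - z = (cbrt eta / kap) ^+ 2 * x by rewrite /z /airy_arg; ring.
    have z2 : 0 <= om - z by rewrite zE mulr_ge0 ?sqr_ge0.
    apply: ler_pM; rewrite ?invr_ge0 ?(ltW e0)//; [lra|lra|].
    by rewrite lef_pV2// ?posrE//; move: c0; lra.
  rewrite /= -/z normrM ME.
  have hd : `|dal z / root4 z - al z / (4 * root4 z ^+ 5)| <= 2 * (C / z) * (root4 z)^-1.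
    have g1 : `|dal z / root4 z| <= C / z * (root4 z)^-1.
      by rewrite normrM normfV (gtr0_norm q0) ler_wpM2r// ltW.
    have g2 : `|al z / (4 * root4 z ^+ 5)| <= C / z * (root4 z)^-1.
      have -> : al z / (4 * root4 z ^+ 5) = al z / 4 / z * (root4 z)^-1.
        by rewrite -[X in _ / 4 / X](root4_4 (ltW z0)); field; rewrite gt_eqF.
      rewrite normrM (gtr0_norm q00) ler_wpM2r ?(ltW q00)//.
      rewrite normrM (@gtr0_norm _ z^-1) ?invr_gt0// ler_wpM2r ?invr_ge0 ?(ltW z0)//.
      by rewrite normrM (@ger0_norm _ 4^-1) ?invr_ge0//; have := normr_ge0 (al z); lra.
    by rewrite (le_trans (ler_normB _ _))//; lra.
  apply: (@le_trans _ _ (z / c * (2 * (C / z) * (root4 z)^-1))); first exact: ler_pM.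
  have -> : z / c * (2 * (C / z) * (root4 z)^-1) = 2 * (C / c) * (root4 z)^-1.
    by field; rewrite !gt_eqF.
  by apply: ler_pM; rewrite ?(ltW q00)//; lra.
Qed.

End ModeAmplitude.

(** * The oscillatory integral of a single mode *)

Section OneMode.
Context {R : realType}.

Lemma amplitudeZ (c d : R) f (k M : R) : 0 <= k -> amplitude c d f M ->
  amplitude c d (fun x => k * f x) (k * M).
Proof.
move=> k0 [df hf]; exists (fun x => k * df x) => x hx; have [h1 h2 h3] := hf x hx.
split; last 2 first.
- by rewrite normrM (ger0_norm k0) ler_wpM2l.
- by rewrite normrM (ger0_norm k0) ler_wpM2l.
by eapply der_eq; [apply: derM; [exact: der_cst|exact: h1]|rewrite /=; ring].
Qed.

Lemma cos3 (x y z : R) : cos x * cos y * cos z =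
  4^-1 * (cos (x + y + z) + cos (x + y - z) + cos (x - y + z) + cos (x - y - z)).
Proof. by rewrite !(cosD, cosB, sinD, sinB, cosN, sinN); field. Qed.

(** A real building block of the kernel: [u1], [u2] are real or imaginary parts of the cutoffs, and
    [s0] is 0 for the cosine or [- pi / 2] for the sine of the exponential. *)
Definition mode_integrand (u1 u2 : R -> R) om kap t y a x s0 W eta : R :=
  cos (kap ^- 3 * (y * eta - t * mode_freq (om * kap ^+ 2) eta) + s0)
  * (u2 (mode_freq (om * kap ^+ 2) eta) * u1 eta * (W * (cbrt eta / kap) ^+ 2))
  * (airy (- airy_arg om kap a eta) * airy (- airy_arg om kap x eta)).

(** The product of three cosines is a mean of four cosines, one for each choice of signs; the van
    der Corput bound is uniform over these choices and over the shifts [al], [be]. *)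
Lemma oscillating_phase (c d Th : R) : 0 < c -> c <= d -> 0 < Th ->
  exists C : R, 0 < C /\ forall om kap t y a x s0 l : R,
  0 < om -> 0 < kap -> om * kap ^+ 2 <= Th -> t != 0 -> 0 <= x -> x <= a ->
  (forall eta, c <= eta <= d -> 0 < airy_arg om kap a eta) ->
  0 < l -> l ^+ 3 = om * `|t| / kap ->
  forall g M (al be : R), amplitude c d g M ->
  oscillating c d (fun eta => g eta *
    (cos (kap ^- 3 * (y * eta - t * mode_freq (om * kap ^+ 2) eta) + s0)
     * cos (refl_phase om kap a eta - al) * cos (refl_phase om kap x eta - be)))
    (C * M / l).
Proof.
move=> c0 cd Th0; have [C [C0 hC]] := mode_phase_vdc c0 cd Th0.
exists (C * (1 + (d - c))); split; first by rewrite mulr_gt0//; lra.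
move=> om kap t y a x s0 l om0 kap0 omTh t0 x0 xa harg l0 l3 g M al be hg.
have th0 : 0 < om * kap ^+ 2 by rewrite mulr_gt0// exprn_gt0.
have argx0 eta : c <= eta <= d -> 0 < airy_arg om kap x eta.
  move=> he; apply: lt_le_trans (harg _ he) _.
  by rewrite lerD2l lerN2 ler_wpM2l// sqr_ge0.
have M0 := amplitude_ge0 cd hg.
have one s1 s2 s : s1 = 1 \/ s1 = -1 -> s2 = 1 \/ s2 = -1 ->
    oscillating c d (fun eta => 4^-1 * g eta
      * cos (mode_phase om kap t y a x s1 s2 s eta)) (4^-1 * (C * (1 + (d - c)) * M / l)).
  move=> hs1 hs2.
  have dPsi eta : c <= eta <= d -> exists p, der (mode_phase om kap t y a x s1 s2 s) eta p.
    move=> he; have e0 : 0 < eta by lra.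
    eexists; apply: derD; last exact: der_cst.
    apply: derD; last by apply: derM; [exact: der_cst|apply: der_refl_phase => //; exact: argx0].
    apply: derD; last by apply: derM; [exact: der_cst|apply: der_refl_phase => //; exact: harg].
    apply: derM; first exact: der_cst.
    apply: derD; first by der.
    by apply: derN; apply: derM; [exact: der_cst|exact: der_mode_freq].
  have cPsi eta : c <= eta <= d ->
      {for eta, continuous (fun v => cos (mode_phase om kap t y a x s1 s2 s v))}.
    by move=> /dPsi [p hp]; exact: der_continuous (der_cos hp).
  have k4 : 0 <= 4^-1 :> R by rewrite invr_ge0.
  have [dg hdg] := amplitudeZ k4 hg.
  split=> [eta he|Q hQ].
    have [p hp] := dPsi _ he; have [h1 _ _] := hdg _ he.
    exact: der_continuous (derM h1 (der_cos hp)).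
  have [P [_ dP _]] := segment_primitive cd cPsi.
  have hP := hC om kap t y a x s1 s2 s l om0 kap0 omTh t0 x0 xa hs1 hs2 harg l0 l3 P dP.
  have -> : 4^-1 * (C * (1 + (d - c)) * M / l) = 4^-1 * M * (C / l) * (1 + (d - c)) by ring.
  apply: (oscillatory_amplitude cd _ dP hQ (dg := dg)).
  - by rewrite divr_ge0// ltW.
  - by move=> eta he; have [h1 _ _] := hdg _ he.
  - exact: hP.
  - by move=> eta he; have [_ h1 h2] := hdg _ he.
have -> : C * (1 + (d - c)) * M / l
  = 4^-1 * (C * (1 + (d - c)) * M / l) + 4^-1 * (C * (1 + (d - c)) * M / l)
    + 4^-1 * (C * (1 + (d - c)) * M / l) + 4^-1 * (C * (1 + (d - c)) * M / l).
  by field; rewrite gt_eqF.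
have e1 : 1 = 1 :> R \/ 1 = -1 :> R by left.
have e2 : -1 = 1 :> R \/ -1 = -1 :> R by right.
have := oscillatingD cd (oscillatingD cd (oscillatingD cd
  (one 1 1 (s0 - al - be) e1 e1) (one 1 (-1) (s0 - al + be) e1 e2))
  (one (-1) 1 (s0 + al - be) e2 e1)) (one (-1) (-1) (s0 + al + be) e2 e2).
congr oscillating; apply/funext => eta; rewrite cos3 /mode_phase -!mulrDr mulrAC mulrA.
rewrite mulrAC [in RHS]mulrA [g eta * _]mulrC.
congr (_ * (_ + _ + _ + _)); congr cos; ring.
Qed.

(** Both Airy factors are put in polar form, which gives four products; a sine is a cosine shifted
    by [pi / 2]. The factor [1 / sqrt om] comes from the two amplitudes [om^(-1/4)], and [1 / l]
    from the phase. *)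
Lemma mode_oscillation (c d Th : R) (u1 u2 : R -> R) :
  0 < c -> c <= d -> 0 < Th -> smooth u1 -> smooth u2 ->
  (exists s : R, airy (- s) != 0) ->
  exists C : R, 0 < C /\ forall om kap t y a x s0 W l : R,
  2 <= om -> 0 < kap -> om * kap ^+ 2 <= Th -> t != 0 -> 0 <= x -> x <= a -> 0 <= W ->
  (forall eta, c <= eta <= d -> om / 2 <= airy_arg om kap a eta) ->
  0 < l -> l ^+ 3 = om * `|t| / kap ->
  forall Q, (forall eta, c <= eta <= d ->
    der Q eta (mode_integrand u1 u2 om kap t y a x s0 W eta)) ->
  `|Q d - Q c| <= C * (W * kap ^- 2 / Num.sqrt om) / l.
Proof.
move=> c0 cd Th0 su1 su2 hai.
have [C0 [C0_gt0 hosc]] := oscillating_phase c0 cd Th0.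
have [M1 [M10 [du1 hu1]]] := smooth_bound su1 cd.
have [M2 [M20 hu2]] := amplitude_mode_freq c0 cd Th0 su2.
have [M3 [M30 hW]] := amplitude_cbrt c0 cd.
have [D [D0 [al [be [dal [dbe hpol]]]]]] := airy_polar hai.
pose M4 := 2 * D + 4 * D / c.
have M40 : 0 < M4 by rewrite addr_gt0// ?divr_gt0 ?mulr_gt0.
pose M := 2 * (2 * (2 * (2 * M2 * M1) * M3) * M4) * M4.
have M_gt0 : 0 < M by rewrite /M !mulr_gt0.
exists (4 * (C0 * M)); split; first by rewrite !mulr_gt0.
move=> om kap t y a x s0 W l om2 kap0 omTh t0 x0 xa W0 harg l0 l3 Q hQ.
have om0 : 0 < om by lra.
have th0 : 0 < om * kap ^+ 2 by rewrite mulr_gt0// exprn_gt0.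
have q0 := root4_gt0 om0.
have hargx eta : c <= eta <= d -> om / 2 <= airy_arg om kap x eta.
  move=> he; apply: le_trans (harg _ he) _.
  by rewrite lerD2l lerN2 ler_wpM2l// sqr_ge0.
have harg0 eta : c <= eta <= d -> 0 < airy_arg om kap a eta.
  by move=> he; apply: lt_le_trans (harg _ he); lra.
have a0 : 0 <= a by exact: le_trans xa.
pose G eta := u2 (mode_freq (om * kap ^+ 2) eta) * u1 eta * (W * (cbrt eta / kap) ^+ 2).
have hG : amplitude c d G (2 * (2 * M2 * M1) * (M3 * (W * kap ^- 2))).
  apply: amplitudeM => //; last exact: hW.
  by apply: amplitudeM => //; [exact: hu2|exists du1].
pose A (f : R -> R) z eta := f (airy_arg om kap z eta) / root4 (airy_arg om kap z eta).
have hal s : 1 <= s -> [/\ der al s (dal s), `|al s| <= D & `|dal s| <= D / s].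
  by move=> /hpol[_ [? _] [? _] [? _]].
have hbe s : 1 <= s -> [/\ der be s (dbe s), `|be s| <= D & `|dbe s| <= D / s].
  by move=> /hpol[_ [_ ?] [_ ?] [_ ?]].
have amp f1 df1 f2 df2 :
    (forall s, 1 <= s -> [/\ der f1 s (df1 s), `|f1 s| <= D & `|df1 s| <= D / s]) ->
    (forall s, 1 <= s -> [/\ der f2 s (df2 s), `|f2 s| <= D & `|df2 s| <= D / s]) ->
    amplitude c d (fun eta => G eta * A f1 a eta * A f2 x eta)
      (M * (W * kap ^- 2 / Num.sqrt om)).
  move=> hf1 hf2.
  have h1 := amplitude_airy c0 D0 hf1 om2 kap0 a0 harg.
  have h2 := amplitude_airy c0 D0 hf2 om2 kap0 x0 hargx.
  have := amplitudeM cd (amplitudeM cd hG h1) h2; congr amplitude.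
  by rewrite -/M4 /M -root4_2; field; rewrite !gt_eqF.
have pair f1 df1 f2 df2 sh1 sh2 h1 h2 :=
  hosc om kap t y a x s0 l om0 kap0 omTh t0 x0 xa harg0 l0 l3 _ _ sh1 sh2
    (amp f1 df1 f2 df2 h1 h2).
have [_ hsum] := oscillatingD cd (oscillatingD cd (oscillatingD cd
  (pair al dal al dal 0 0 hal hal) (pair al dal be dbe 0 (pi / 2) hal hbe))
  (pair be dbe al dal (pi / 2) 0 hbe hal))
  (pair be dbe be dbe (pi / 2) (pi / 2) hbe hbe).
have -> : 4 * (C0 * M) * (W * kap ^- 2 / Num.sqrt om) / l
  = C0 * (M * (W * kap ^- 2 / Num.sqrt om)) / l
    + C0 * (M * (W * kap ^- 2 / Num.sqrt om)) / l
    + C0 * (M * (W * kap ^- 2 / Num.sqrt om)) / l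
    + C0 * (M * (W * kap ^- 2 / Num.sqrt om)) / l.
  by ring.
apply: hsum => eta he; apply: der_eq (hQ eta he) _.
have z1 : 1 <= airy_arg om kap a eta by have := harg _ he; lra.
have z2 : 1 <= airy_arg om kap x eta by have := hargx _ he; lra.
have [p1 _ _ _] := hpol _ z1; have [p2 _ _ _] := hpol _ z2.
have sinE (v : R) : cos (v - pi / 2) = sin v.
  by rewrite cosB sin_pihalf cos_pihalf mulr0 mulr1 add0r.
rewrite /mode_integrand p1 p2 !sinE !subr0 /A /G /refl_phase.
by field; rewrite !gt_eqF// root4_gt0//; lra.
Qed.

End OneMode.

(** * Sums over the modes *)

Section ModeSum.
Context {R : realType}.

Lemma der_mode_integrand u1 u2 om kap t y a x s0 W (eta : R) : smooth u1 -> smooth u2 ->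
  0 < eta -> 0 < om -> 0 < kap ->
  exists p, der (mode_integrand u1 u2 om kap t y a x s0 W) eta p.
Proof.
move=> su1 su2 e0 om0 kap0.
have th0 : 0 < om * kap ^+ 2 by rewrite mulr_gt0// exprn_gt0.
have [dA hA] := @airy_ode R.
have du (u : R -> R) v : smooth u -> der u v ('D_1 u v).
  by move=> su; apply: DeriveDef => //; exact: (su 0%N).
have dai z : exists p, der (fun eta => airy (- airy_arg om kap z eta)) eta p.
  eexists; apply: (@der_comp _ (fun eta => - airy_arg om kap z eta) airy).
    exact: (hA _).1.
  by apply: derN; exact: der_airy_arg.
have [p1 h1] := dai a; have [p2 h2] := dai x.
eexists; apply: derM; last by apply: derM; [exact: h1|exact: h2].
apply: derM.
  apply: der_cos; apply: derD; last exact: der_cst.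
  apply: derM; first exact: der_cst.
  apply: derD; first by der.
  by apply: derN; apply: derM; [exact: der_cst|exact: der_mode_freq].
apply: derM.
  apply: derM; last exact: du.
  by apply: (@der_comp _ (mode_freq (om * kap ^+ 2)) u2); [exact: du|exact: der_mode_freq].
apply: derM; first exact: der_cst.
by apply: derX; apply: derM; [exact: der_cbrt|exact: der_cst].
Qed.

Definition mode_int c d u1 u2 om kap t y a x s0 W : R :=
  \int[lebesgue_measure]_(eta in `[c, d]) mode_integrand u1 u2 om kap t y a x s0 W eta.

Variables om f : nat -> R.
Hypothesis om_zeros : airy_zeros om.
Hypothesis f_norm : normalizing om f.

Let om_gt0 := airy_zeros_gt0 om_zeros f_norm.
Let om_gap := airy_zeros_gap om_zeros f_norm.
Let om_lt := airy_zeros_lt om_zeros.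

Let term c d u1 u2 kap t y a x s0 k :=
  mode_int c d u1 u2 (om k) kap t y a x s0 (mode_weight f k).

(** The inequality [2 |p q| <= p^2 + q^2] separates the two centres; then the bounds on weights and
    on squares of Ai lead to [gapped_sum_sqrt]. *)
Lemma weighted_airy_sum : exists C : R, 0 < C /\ forall (b b' L : R) n, 0 <= L ->
  \sum_(1 <= k < n | om k <= L)
    mode_weight f k * `|airy (- (om k - b)) * airy (- (om k - b'))| <= C * Num.sqrt L.
Proof.
have [C1 [C10 hW]] := mode_weight_bound om_zeros f_norm.
have [C2 [C20 hA]] := airy_sqr_bound f_norm.
have [C3 [C30 hS]] := gapped_sum_sqrt om_gt0 om_lt om_gap.
exists (C1 * C2 * C3); split; first by rewrite !mulr_gt0.
have W0 k : (1 <= k)%N -> 0 < mode_weight f k by exact: (mode_weight_gt0 f_norm).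
have single b k : (1 <= k)%N -> mode_weight f k * airy (- (om k - b)) ^+ 2
    <= C1 * C2 * (Num.sqrt (om k) * Num.sqrt (1 + `|om k - b|))^-1.
  move=> k1; have so : 0 < Num.sqrt (om k) by rewrite sqrtr_gt0 om_gt0.
  have s1 : 0 < Num.sqrt (1 + `|om k - b|) by rewrite sqrtr_gt0 ltr_wpDr.
  rewrite ler_pdivlMr ?mulr_gt0//.
  rewrite [leLHS](_ : _ = (mode_weight f k * Num.sqrt (om k)) *
    (airy (- (om k - b)) ^+ 2 * Num.sqrt (1 + `|om k - b|))); last by ring.
  apply: ler_pM; [|by rewrite mulr_ge0 ?sqr_ge0 ?sqrtr_ge0|exact: hW|exact: hA].
  by rewrite mulr_ge0 ?sqrtr_ge0// ltW// W0.
have sq b (L : R) n : 0 <= L -> \sum_(1 <= k < n | om k <= L)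
    mode_weight f k * airy (- (om k - b)) ^+ 2 <= C1 * C2 * C3 * Num.sqrt L.
  move=> L0; apply: (@le_sum_cond _ om _ (fun v => C1 * C2 * C3 * Num.sqrt v)).
  - by move=> k k1; rewrite mulr_ge0 ?sqr_ge0// ltW// W0.
  - move=> m m1; rewrite -(mulrA (C1 * C2)).
    apply: (@le_trans _ _ (C1 * C2 *
      \sum_(1 <= k < m.+1) (Num.sqrt (om k) * Num.sqrt (1 + `|om k - b|))^-1)).
      rewrite mulr_sumr big_seq [leRHS]big_seq; apply: ler_sum => k.
      by rewrite mem_index_iota => /andP[k1 _]; exact: single.
    by rewrite ler_wpM2l ?hS// mulr_ge0// ltW.
  - by move=> v w v0 vw; rewrite ler_wpM2l ?mulr_ge0 ?(ltW C10) ?(ltW C20) ?(ltW C30)// ler_wsqrtr.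
  - exact: om_gt0.
  - by rewrite !mulr_ge0 ?sqrtr_ge0// ltW.
move=> b b' L n L0.
apply: (@le_trans _ _ (2^-1 * (\sum_(1 <= k < n | om k <= L) mode_weight f k * airy (- (om k - b)) ^+ 2
  + \sum_(1 <= k < n | om k <= L) mode_weight f k * airy (- (om k - b')) ^+ 2))).
  rewrite -big_split mulr_sumr big_seq_cond [leRHS]big_seq_cond; apply: ler_sum => k.
  rewrite mem_index_iota => /andP[/andP[k1 _] _].
  rewrite /= -mulrDr [leRHS]mulrCA; apply: ler_wpM2l; first exact: ltW (W0 _ k1).
  set p := airy _; set q := airy _; have := sqr_ge0 (p - q); have := sqr_ge0 (p + q).
  by rewrite ler_norml; lra.
by have := sq b L n L0; have := sq b' L n L0; lra.
Qed.

Section Bounds.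
Variables (c d d2 : R) (u1 u2 : R -> R).
Hypotheses (c0 : 0 < c) (cd : c <= d) (su1 : smooth u1) (su2 : smooth u2).
Hypothesis u2_supp : forall v, u2 v != 0 -> 0 <= v <= d2.

Let u2_bounded : exists M : R, 0 < M /\ forall v, `|u2 v| <= M.
Proof.
have h : 0 <= Num.max 0 d2 by rewrite le_max lexx.
have [M [M0 [du hu]]] := smooth_bound su2 h; exists M; split=> // v.
have [->|v0] := eqVneq (u2 v) 0; first by rewrite normr0 ltW.
have /andP[v1 v2] := u2_supp v0.
by case: (hu v) => //; rewrite v1 le_max v2 orbT.
Qed.

(** As [mode_freq] is at least [cbrt c ^+ 2 * sqrt th], a larger [th] pushes it past [d2], off the
    support of [u2]. The added 1 makes [Th] positive. *)
Let Th : R := (d2 / cbrt c ^+ 2) ^+ 2 + 1.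

Let Th0 : 0 < Th. Proof. by rewrite ltr_wpDl ?sqr_ge0. Qed.

Lemma term_eq0 kap t y a x s0 k : (1 <= k)%N -> 0 < kap ->
  Th < om k * kap ^+ 2 -> term c d u1 u2 kap t y a x s0 k = 0.
Proof.
move=> k1 kap0 hTh; have th0 : 0 < om k * kap ^+ 2 by apply: lt_trans hTh.
rewrite /term /mode_int (@eq_Rintegral _ _ _ lebesgue_measure _ (fun=> 0)); first by rewrite /Rintegral integral0.
move=> eta; rewrite inE /= in_itv /= => /andP[h1 h2].
have e0 : 0 < eta by apply: lt_le_trans h1.
rewrite /mode_integrand (_ : u2 _ = 0) ?mul0r ?mulr0 ?mul0r//.
apply/eqP/negP => /negP/u2_supp/andP[_ hq].
have rc0 := cbrt_gt0 c0; have r0 := cbrt_gt0 e0.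
have r1 : cbrt c <= cbrt eta by exact: cbrt_le.
have s0' := mode_root_gt0 e0 th0.
have hs : mode_root (om k * kap ^+ 2) eta <= d2 / cbrt c ^+ 2.
  rewrite ler_pdivlMr ?exprn_gt0// mulrC (le_trans _ hq)//.
  by rewrite /mode_freq ler_wpM2r ?(ltW s0')// lerXn2r// nnegrE ltW.
have : mode_root (om k * kap ^+ 2) eta ^+ 2 <= (d2 / cbrt c ^+ 2) ^+ 2.
  rewrite lerXn2r// nnegrE ?(ltW s0')//.
  exact: le_trans (ltW s0') hs.
rewrite mode_root_2//; have := sqr_ge0 (cbrt eta); rewrite /Th in hTh; lra.
Qed.

Lemma term_primitive kap t y a x s0 k : (1 <= k)%N -> 0 < kap ->
  exists P : R -> R, (forall eta, c <= eta <= d ->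
    der P eta (mode_integrand u1 u2 (om k) kap t y a x s0 (mode_weight f k) eta)) /\
  term c d u1 u2 kap t y a x s0 k = P d - P c.
Proof.
move=> k1 kap0.
have [|P [Pc dP intP]] := @segment_primitive _
  (mode_integrand u1 u2 (om k) kap t y a x s0 (mode_weight f k)) c d cd.
  move=> eta he; have e0 : 0 < eta by move: c0; lra.
  have [p hp] := der_mode_integrand t y a x s0 (mode_weight f k) su1 su2 e0 (om_gt0 k1) kap0.
  exact: der_continuous hp.
by exists P; split=> //; rewrite Pc subr0 -intP.
Qed.

(** The bound on the Airy sum holds pointwise in [eta], with centres that move with [eta], so the
    primitives are summed first and the derivative of the sum is estimated. *)
Lemma mode_sum_trivial : exists C : R, 0 < C /\
  forall kap t y a x s0 (L : R) n, 0 < kap -> 0 <= L ->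
  `|\sum_(1 <= k < n | om k <= L) term c d u1 u2 kap t y a x s0 k|
    <= C * kap ^- 2 * Num.sqrt L.
Proof.
have [M1 [M10 [du1 hu1]]] := smooth_bound su1 cd.
have [M2 [M20 hu2]] := u2_bounded.
have [C [C0 hC]] := weighted_airy_sum.
have d0 : 0 < d by move: c0 cd; lra.
have rd0 := cbrt_gt0 d0.
pose B := M2 * M1 * cbrt d ^+ 2 * C.
have B0 : 0 < B by rewrite !mulr_gt0 ?exprn_gt0.
exists (B * (d - c + 1)); split; first by rewrite mulr_gt0//; move: cd; lra.
move=> kap t y a x s0 L n kap0 L0.
have /choice[P hP] : forall k, exists P : R -> R, (1 <= k)%N ->
    (forall eta, c <= eta <= d ->
      der P eta (mode_integrand u1 u2 (om k) kap t y a x s0 (mode_weight f k) eta)) /\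
    term c d u1 u2 kap t y a x s0 k = P d - P c.
  move=> k; case: (posnP k) => [->|k1]; first by exists (fun=> 0).
  by have [P hP] := term_primitive t y a x s0 k1 kap0; exists P.
have := @der_lipschitz _
  (fun eta => \sum_(1 <= k < n | (1 <= k)%N && (om k <= L)) P k eta)
  (fun eta => \sum_(1 <= k < n | (1 <= k)%N && (om k <= L))
     mode_integrand u1 u2 (om k) kap t y a x s0 (mode_weight f k) eta)
  c d (B * kap ^- 2 * Num.sqrt L) cd.
(* The range condition is moved into the predicate, the only place where [der_sum] sees it. *)
have condE (F : nat -> R) : \sum_(1 <= k < n | om k <= L) F k
    = \sum_(1 <= k < n | (1 <= k)%N && (om k <= L)) F k.
  rewrite big_nat_cond [RHS]big_nat_cond; apply: eq_bigl => k.
  by case: (1 <= k)%N.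
have -> : \sum_(1 <= k < n | om k <= L) term c d u1 u2 kap t y a x s0 k =
    \sum_(1 <= k < n | (1 <= k)%N && (om k <= L)) P k d
    - \sum_(1 <= k < n | (1 <= k)%N && (om k <= L)) P k c.
  rewrite condE -sumrB; apply: eq_bigr => k /andP[k1 _].
  by case: (hP k k1) => _ ->.
move=> h; apply: le_trans (h _ _) _ => [eta he|eta he|].
- by apply: der_sum => k /andP[k1 _]; case: (hP k k1) => h1 _; exact: h1.
- apply: le_trans (ler_norm_sum _ _ _) _.
  have e0 : 0 < eta by move: c0; lra.
  have r0 := cbrt_gt0 e0.
  have hr : (cbrt eta / kap) ^+ 2 <= cbrt d ^+ 2 * kap ^- 2.
    rewrite expr_div_n ler_wpM2r ?invr_ge0 ?exprn_ge0 ?(ltW kap0)//.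
    have /andP[_ ed] := he.
    by rewrite lerXn2r ?nnegrE ?(ltW r0) ?(ltW rd0)// cbrt_le.
  have K0 : 0 <= M2 * M1 * (cbrt d ^+ 2 * kap ^- 2).
    by rewrite !mulr_ge0 ?exprn_ge0 ?invr_ge0 ?exprn_ge0 ?(ltW M20) ?(ltW M10) ?(ltW kap0) ?(ltW rd0).
  apply: (@le_trans _ _ (M2 * M1 * (cbrt d ^+ 2 * kap ^- 2) *
    \sum_(1 <= k < n | om k <= L) mode_weight f k *
      `|airy (- (om k - (cbrt eta / kap) ^+ 2 * a)) * airy (- (om k - (cbrt eta / kap) ^+ 2 * x))|)).
    rewrite condE mulr_sumr; apply: ler_sum => k /andP[k1 _].
    have W0 := mode_weight_gt0 f_norm k1.
    rewrite /mode_integrand -/(airy_arg (om k) kap a eta) -/(airy_arg (om k) kap x eta).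
    rewrite [leRHS]mulrA normrM; apply: ler_wpM2r => //.
    rewrite normrM -[leRHS]mul1r ler_pM ?normr_cos//.
    rewrite normrM (normrM (u2 _)) (normrM (mode_weight f k)) (gtr0_norm W0) (@ger0_norm _ (_ ^+ 2)) ?sqr_ge0//.
    have [_ g1 _] := hu1 _ he.
    rewrite [leRHS](_ : _ = M2 * M1 * (mode_weight f k * (cbrt d ^+ 2 * kap ^- 2))); last by ring.
    have W1 := ltW W0; apply: ler_pM.
    - by rewrite mulr_ge0.
    - by rewrite mulr_ge0// sqr_ge0.
    - by apply: ler_pM => //; exact: hu2.
    - by apply: ler_wpM2l.
  rewrite [leRHS](_ : _ = M2 * M1 * (cbrt d ^+ 2 * kap ^- 2) * (C * Num.sqrt L)).
    by rewrite ler_wpM2l// hC.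
  by rewrite /B; ring.
- rewrite [leRHS](_ : _ = B * kap ^- 2 * Num.sqrt L * (d - c + 1)); last by ring.
  apply: ler_wpM2l; last by rewrite lerDl.
  rewrite mulr_ge0 ?sqrtr_ge0// mulr_ge0 ?(ltW B0)// invr_ge0 exprn_ge0//.
  exact: ltW.
Qed.

(** Here [chi ^+ 12] is [h^(1/3)]. Low modes are replaced by 0 instead of being excluded, so that
    the sum keeps the single condition expected by [le_sum_cond]. *)
Lemma mode_sum_oscillating : exists C L : R, [/\ 0 < C, 0 < L &
  forall chi t y a x s0 n, 0 < chi -> chi <= 1 -> t != 0 -> 0 <= x -> x <= a ->
  a <= chi ^+ 18 ->
  \sum_(1 <= k < n | om k <= Th / chi ^+ 24) (if om k <= L / chi ^+ 6 then 0 else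
     `|term c d u1 u2 (chi ^+ 12) t y a x s0 k|) <= C * chi ^- 24 / cbrt `|t|].
Proof.
have [C1 [C10 hosc]] := mode_oscillation c0 cd Th0 su1 su2
  (airy_nontrivial f_norm).
have [C2 [C20 hW]] := mode_weight_bound om_zeros f_norm.
have [C3 [C30 hS]] := gapped_sum_root6 om_gt0 om_lt om_gap.
have d0 : 0 < d by move: c0 cd; lra.
have rd0 := cbrt_gt0 d0; have rT := root6_gt0 Th0.
have rd2 : 0 < cbrt d ^+ 2 by rewrite exprn_gt0.
(* Makes [(cbrt eta / chi^12)^2 a <= cbrt d ^+ 2 / chi^6 <= om k / 2] for the high modes, and
   ensures [om k >= 2]. *)
pose L := 2 * cbrt d ^+ 2 + 2.
have L2 : 2 <= L by rewrite /L; lra.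
exists (C1 * C2 * C3 * root6 Th), L; split; [by rewrite !mulr_gt0|lra|].
move=> chi t y a x s0 n chi0 chi1 t0 x0 xa a_le.
have kap0 : 0 < chi ^+ 12 by rewrite exprn_gt0.
have tau0 : 0 < cbrt `|t| by rewrite cbrt_gt0// normr_gt0.
(* The exponent is [-24] from [kap^(-2)] plus 4 from [1 / l]. The eighth power of [root6] is 3 from
   the weight, 3 from the amplitudes and 2 from [l]. *)
pose K := C1 * C2 * chi ^- 20 / cbrt `|t|.
have K0 : 0 < K by rewrite !mulr_gt0// ?invr_gt0// exprn_gt0.
have single k : (1 <= k)%N -> om k <= Th / chi ^+ 24 ->
    (if om k <= L / chi ^+ 6 then 0 else
     `|term c d u1 u2 (chi ^+ 12) t y a x s0 k|) <= K * (root6 (om k) ^+ 8)^-1.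
  move=> k1 hTh; have ok := om_gt0 k1; have v0 := root6_gt0 ok.
  case: ifPn => [_|]; first by rewrite mulr_ge0 ?invr_ge0 ?exprn_ge0 ?(ltW K0) ?(ltW v0).
  rewrite -ltNge => hL.
  have c6 : 0 < chi ^+ 6 by rewrite exprn_gt0.
  have omL : L <= om k * chi ^+ 6 by rewrite -ler_pdivrMr// ltW.
  have om2 : 2 <= om k.
    by rewrite (le_trans L2)// (le_trans omL)// ler_piMr ?(ltW ok)// exprn_ile1// ltW.
  have [P [dP ->]] := term_primitive t y a x s0 k1 kap0.
  have c24 : 0 < chi ^+ 24 by rewrite exprn_gt0.
  have omTh : om k * (chi ^+ 12) ^+ 2 <= Th by rewrite -exprM -ler_pdivlMr.
  pose l := root6 (om k) ^+ 2 * cbrt `|t| / chi ^+ 4.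
  have l0 : 0 < l by rewrite divr_gt0 ?mulr_gt0 ?exprn_gt0.
  have l3 : l ^+ 3 = om k * `|t| / chi ^+ 12.
    rewrite -[in RHS](root6_6 (ltW ok)) -[in RHS](cbrt_3 (normr_ge0 t)) /l.
    by field; rewrite gt_eqF.
  have harg eta : c <= eta <= d -> om k / 2 <= airy_arg (om k) (chi ^+ 12) a eta.
    move=> /andP[ce ed]; have e0 : 0 < eta by apply: lt_le_trans ce.
    have r0 := cbrt_gt0 e0.
    suff : (cbrt eta / chi ^+ 12) ^+ 2 * a <= om k / 2 by rewrite /airy_arg => ?; lra.
    apply: (@le_trans _ _ (cbrt d ^+ 2 / chi ^+ 24 * chi ^+ 18)).
      apply: ler_pM; rewrite ?sqr_ge0 ?(le_trans x0)// expr_div_n -exprM.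
      rewrite ler_wpM2r ?invr_ge0 ?(ltW c24)//.
      by rewrite lerXn2r ?nnegrE ?(ltW r0) ?(ltW rd0)// cbrt_le.
    have -> : cbrt d ^+ 2 / chi ^+ 24 * chi ^+ 18 = cbrt d ^+ 2 / chi ^+ 6.
      by field; rewrite gt_eqF.
    rewrite ler_pdivrMr//; move: omL; rewrite /L; lra.
  have := hosc (om k) (chi ^+ 12) t y a x s0 (mode_weight f k) l om2 kap0 omTh t0 x0 xa
    (ltW (mode_weight_gt0 f_norm k1)) harg l0 l3 P dP.
  move=> h; apply: (le_trans h).
  have so : Num.sqrt (om k) = root6 (om k) ^+ 3.
    rewrite -[in LHS](root6_6 (ltW ok)) (exprM _ 3 2) sqrtr_sqr ger0_norm//.
    by rewrite exprn_ge0// ltW.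
  have so0 : 0 < Num.sqrt (om k) by rewrite sqrtr_gt0.
  have Wle : mode_weight f k <= C2 / root6 (om k) ^+ 3.
    by rewrite -so ler_pdivlMr// hW.
  have -> : K * (root6 (om k) ^+ 8)^-1 =
    C1 * (C2 / root6 (om k) ^+ 3 * (chi ^+ 12) ^- 2 / Num.sqrt (om k)) / l.
    by rewrite /K /l so; field; rewrite !gt_eqF.
  rewrite ler_wpM2r ?invr_ge0 ?(ltW l0)// ler_wpM2l ?(ltW C10)//.
  rewrite ler_wpM2r ?invr_ge0 ?(ltW so0)// ler_wpM2r// invr_ge0 exprn_ge0//.
  exact: ltW.
apply: (@le_trans _ _ (\sum_(1 <= k < n | om k <= Th / chi ^+ 24)
    K * (root6 (om k) ^+ 8)^-1)).
  rewrite big_nat_cond [leRHS]big_nat_cond; apply: ler_sum => k /andP[/andP[k1 _] hk].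
  exact: single.
have -> : C1 * C2 * C3 * root6 Th * chi ^- 24 / cbrt `|t|
   = K * C3 * root6 (Th / chi ^+ 24).
  have -> : root6 (Th / chi ^+ 24) = root6 Th / chi ^+ 4.
    have -> : Th / chi ^+ 24 = (root6 Th / chi ^+ 4) ^+ 6.
      by rewrite expr_div_n (root6_6 (ltW Th0)) -exprM.
    by rewrite root6X// divr_ge0 ?exprn_ge0 ?(ltW chi0) ?(ltW rT).
  by rewrite /K; field; rewrite !gt_eqF.
apply: (@le_sum_cond _ om _ (fun v => K * C3 * root6 v)).
- by move=> k k1; rewrite mulr_ge0 ?(ltW K0)// invr_ge0 exprn_ge0// powR_ge0.
- by move=> m m1; rewrite -mulr_sumr -mulrA ler_wpM2l ?(ltW K0)// hS.
- by move=> v w v1 vw; rewrite ler_wpM2l ?root6_le// mulr_ge0// ltW.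
- exact: om_gt0.
- by rewrite mulr_ge0 ?powR_ge0// mulr_ge0// ltW.
Qed.

(** The trivial estimate gives [chi^(-24) chi^(-12)] for all modes and
    [chi^(-24) chi^(-3) = chi^(-36) chi^9] for the low ones; the high ones give
    [chi^(-24) / |t|^(1/3)]. *)
Lemma mode_sum_bound : exists C : R, 0 < C /\
  forall chi t y a x s0 n, 0 < chi -> chi <= 1 -> 0 <= x -> x <= a -> a <= chi ^+ 18 ->
  let S := \sum_(1 <= k < n) term c d u1 u2 (chi ^+ 12) t y a x s0 k in
  `|S| <= C * chi ^- 36 /\
  (t != 0 -> `|S| <= C * chi ^- 36 * (chi ^+ 9 + chi ^+ 12 / cbrt `|t|)).
Proof.
have [C1 [C10 h1]] := mode_sum_trivial.
have [C2 [L [C20 L0 h2]]] := mode_sum_oscillating.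
have sT : 0 < Num.sqrt Th by rewrite sqrtr_gt0.
have sL : 0 < Num.sqrt L by rewrite sqrtr_gt0.
exists (C1 * Num.sqrt Th + C1 * Num.sqrt L + C2); split.
  by rewrite !addr_gt0 ?mulr_gt0.
move=> chi t y a x s0 n chi0 chi1 x0 xa a_le S.
have kap0 : 0 < chi ^+ 12 by rewrite exprn_gt0.
have c24 : 0 < chi ^+ 24 by rewrite exprn_gt0.
have c36 : 0 < chi ^- 36 by rewrite invr_gt0 exprn_gt0.
have SE : S = \sum_(1 <= k < n | om k <= Th / chi ^+ 24)
    term c d u1 u2 (chi ^+ 12) t y a x s0 k.
  rewrite /S (bigID (fun k => om k <= Th / chi ^+ 24)) /=.
  rewrite [X in _ + X]big_nat_cond [X in _ + X]big1 ?addr0// => k /andP[/andP[k1 _]].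
  rewrite -ltNge ltr_pdivrMr// => hk; apply: term_eq0 => //.
  by rewrite -exprM.
have P1 : 0 < C1 * Num.sqrt Th by rewrite mulr_gt0.
have P2 : 0 < C1 * Num.sqrt L by rewrite mulr_gt0.
have sqrt_even m (v : R) : 0 <= v -> Num.sqrt (v / chi ^+ (m * 2)) = Num.sqrt v / chi ^+ m.
  move=> v0; rewrite sqrtrM// exprM sqrtrV ?sqr_ge0// sqrtr_sqr ger0_norm//.
  by rewrite exprn_ge0// ltW.
split.
  have := h1 (chi ^+ 12) t y a x s0 (Th / chi ^+ 24) n kap0.
  rewrite -SE (sqrt_even 12)%N ?(ltW Th0)// => /(_ (ltW (divr_gt0 Th0 c24))).
  have -> : C1 * (chi ^+ 12) ^- 2 * (Num.sqrt Th / chi ^+ 12)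
     = C1 * Num.sqrt Th * chi ^- 36 by field; rewrite gt_eqF.
  move=> h; apply: (le_trans h); rewrite ler_wpM2r ?(ltW c36)//; lra.
move=> t0; have tau0 : 0 < cbrt `|t| by rewrite cbrt_gt0// normr_gt0.
have S2 := h2 chi t y a x s0 n chi0 chi1 t0 x0 xa a_le.
have c6 : 0 < chi ^+ 6 by rewrite exprn_gt0.
(* After [SE] the low modes satisfy both upper bounds, hence the minimum. *)
have S1 := h1 (chi ^+ 12) t y a x s0 (Num.min (L / chi ^+ 6) (Th / chi ^+ 24)) n kap0.
have hmin : 0 <= Num.min (L / chi ^+ 6) (Th / chi ^+ 24).
  by rewrite le_min !divr_ge0 ?(ltW L0) ?(ltW c6) ?(ltW Th0) ?(ltW c24).
have {}S1 := S1 hmin.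
have S1' : C1 * (chi ^+ 12) ^- 2 * Num.sqrt (Num.min (L / chi ^+ 6) (Th / chi ^+ 24))
    <= C1 * Num.sqrt L * chi ^- 36 * chi ^+ 9.
  apply: (@le_trans _ _ (C1 * (chi ^+ 12) ^- 2 * Num.sqrt (L / chi ^+ 6))).
    rewrite ler_wpM2l ?mulr_ge0 ?(ltW C10) ?invr_ge0 ?exprn_ge0 ?(ltW chi0)//.
    by rewrite ler_wsqrtr// ge_min lexx.
  rewrite (sqrt_even 3)%N ?(ltW L0)// le_eqVlt; apply/orP; left; apply/eqP.
  by field; rewrite gt_eqF.
have split2 : `|S| <= C1 * Num.sqrt L * chi ^- 36 * chi ^+ 9 + C2 * chi ^- 24 / cbrt `|t|.
  rewrite SE (bigID (fun k => om k <= L / chi ^+ 6)) /=.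
  apply: (le_trans (ler_normD _ _)); apply: lerD.
    apply: le_trans S1'; apply: le_trans S1.
    rewrite le_eqVlt; apply/orP; left; apply/eqP; congr `|_|.
    by apply: eq_bigl => k; rewrite le_min andbC.
  apply: le_trans S2; apply: (le_trans (ler_norm_sum _ _ _)).
  rewrite [leRHS](bigID (fun k => om k <= L / chi ^+ 6)) /=.
  rewrite [X in _ <= X + _]big1 ?add0r; last by move=> k /andP[_ ->].
  by apply: ler_sum => k /andP[_ /negbTE ->].
apply: (le_trans split2); rewrite mulrDr; apply: lerD.
  rewrite ler_wpM2r ?exprn_ge0 ?(ltW chi0)// ler_wpM2r ?(ltW c36)//; lra.
rewrite [leLHS](_ : _ = C2 * (chi ^- 24 / cbrt `|t|)); last by ring.
rewrite [leRHS](_ : _ = (C1 * Num.sqrt Th + C1 * Num.sqrt L + C2)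
  * (chi ^- 24 / cbrt `|t|)); last by field; rewrite !gt_eqF.
rewrite ler_wpM2r ?divr_ge0 ?invr_ge0 ?(ltW c24) ?(ltW tau0)//; lra.
Qed.

End Bounds.
End ModeSum.

(** * The Green function *)

Section GreenBound.
Context {R : realType}.
Local Open Scope complex_scope.

Lemma continuous_integrable (g : R -> R) (c d : R) :
  (forall x, c <= x <= d -> {for x, continuous g}) ->
  lebesgue_measure.-integrable `[c, d] (EFin \o g).
Proof.
move=> cg; apply: continuous_compact_integrable; first exact: segment_compact.
exact: continuous_within.
Qed.

Lemma Rintegral_support (G g : R -> R) (c d : R) :
  (forall x, c <= x <= d -> G x = g x) -> (forall x, ~~ (c <= x <= d) -> G x = 0) ->
  \int[lebesgue_measure]_x G x = \int[lebesgue_measure]_(x in `[c, d]) g x.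
Proof.
move=> h1 h2; rewrite [RHS]Rintegral_mkcond; apply: eq_Rintegral => x _.
rewrite patchE; case: ifPn => hx.
  by rewrite h1//; move: hx; rewrite inE /= in_itv.
by rewrite h2//; apply: contra hx => hx; rewrite inE /= in_itv.
Qed.

Definition continuous_seg (c d : R) (g : R -> R) : Prop :=
  forall x, c <= x <= d -> {for x, continuous g}.

Lemma continuous_segB c d g1 g2 : continuous_seg c d g1 -> continuous_seg c d g2 ->
  continuous_seg c d (fun x => g1 x - g2 x).
Proof. by move=> h1 h2 x hx; apply: continuousB; [exact: h1|exact: h2]. Qed.

Lemma continuous_segD c d g1 g2 : continuous_seg c d g1 -> continuous_seg c d g2 ->
  continuous_seg c d (fun x => g1 x + g2 x).
Proof. by move=> h1 h2 x hx; apply: continuousD; [exact: h1|exact: h2]. Qed.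

Lemma Rintegral_segB c d g1 g2 : continuous_seg c d g1 -> continuous_seg c d g2 ->
  \int[lebesgue_measure]_(x in `[c, d]) (g1 x - g2 x)
  = \int[lebesgue_measure]_(x in `[c, d]) g1 x - \int[lebesgue_measure]_(x in `[c, d]) g2 x.
Proof.
move=> h1 h2; apply: RintegralB; first exact: measurable_itv.
  exact: continuous_integrable.
exact: continuous_integrable.
Qed.

Lemma Rintegral_segD c d g1 g2 : continuous_seg c d g1 -> continuous_seg c d g2 ->
  \int[lebesgue_measure]_(x in `[c, d]) (g1 x + g2 x)
  = \int[lebesgue_measure]_(x in `[c, d]) g1 x + \int[lebesgue_measure]_(x in `[c, d]) g2 x.
Proof.
move=> h1 h2; apply: RintegralD; first exact: measurable_itv.
  exact: continuous_integrable.
exact: continuous_integrable.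
Qed.

Definition mode_kernel (om f : nat -> R) (psi1 psi2 : R -> R[i]) (a h t x y : R)
    (k : nat) (eta : R) : R[i] :=
  let rho := eta * Num.sqrt (1 + om k * (h / eta) `^ (2 / 3)) in
  expi (h^-1 * (y * eta - t * rho)) * psi2 rho * psi1 eta *
  (eigenfun om f k a (eta / h))%:C * (eigenfun om f k x (eta / h))%:C.

Lemma powR_23 (v : R) : 0 <= v -> v `^ (2 / 3) = cbrt v ^+ 2.
Proof.
by move=> v0; rewrite /cbrt -powR_mulrn ?powR_ge0// -powRrM mulrC.
Qed.

Lemma cbrtM (v w : R) : 0 <= v -> 0 <= w -> cbrt (v * w) = cbrt v * cbrt w.
Proof. by move=> v0 w0; rewrite /cbrt powRM. Qed.

Lemma cbrtV (v : R) : 0 < v -> cbrt v^-1 = (cbrt v)^-1.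
Proof.
move=> v0; have r0 := cbrt_gt0 v0; apply: (mulIf (_ : cbrt v != 0)); rewrite ?gt_eqF//.
rewrite -cbrtM ?invr_ge0 ?(ltW v0)// !mulVf ?gt_eqF//.
by rewrite /cbrt powR1.
Qed.

Lemma cbrtX (v : R) : 0 <= v -> cbrt (v ^+ 3) = v.
Proof. by move=> v0; rewrite /cbrt -powR_mulrn// -powRrM mulfV ?powRr1. Qed.

Section Kernel.
Variables (om f : nat -> R) (psi1 psi2 : R -> R[i]).

Lemma mode_kernelE a chi t x y k eta : 0 < chi -> 0 < om k -> 0 < eta ->
  mode_kernel om f psi1 psi2 a (chi ^+ 36) t x y k eta =
  expi ((chi ^+ 12) ^- 3 * (y * eta - t * mode_freq (om k * (chi ^+ 12) ^+ 2) eta))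
  * psi2 (mode_freq (om k * (chi ^+ 12) ^+ 2) eta) * psi1 eta
  * (f k / k%:R `^ 6^-1 * (cbrt eta / chi ^+ 12)
       * airy (- airy_arg (om k) (chi ^+ 12) a eta))%:C
  * (f k / k%:R `^ 6^-1 * (cbrt eta / chi ^+ 12)
       * airy (- airy_arg (om k) (chi ^+ 12) x eta))%:C.
Proof.
move=> chi0 om0 e0; have r0 := cbrt_gt0 e0.
have c36 : chi ^+ 36 = (chi ^+ 12) ^+ 3 by rewrite -exprM.
have k0 : 0 < chi ^+ 12 by rewrite exprn_gt0.
have h0 : 0 < chi ^+ 36 by rewrite exprn_gt0.
have ck : cbrt (chi ^+ 36) = chi ^+ 12 by rewrite c36 cbrtX// ltW.
have th0 : 0 < om k * (chi ^+ 12) ^+ 2 by rewrite mulr_gt0// exprn_gt0.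
(* With [r = cbrt eta] and [th = om k * chi^24], this is [r^3 sqrt (1 + th / r^2) = r^2 sqrt (r^2 +
   th)]. *)
have rhoE : eta * Num.sqrt (1 + om k * (chi ^+ 36 / eta) `^ (2 / 3))
    = mode_freq (om k * (chi ^+ 12) ^+ 2) eta.
  rewrite powR_23 ?divr_ge0 ?ltW// cbrtM ?invr_ge0 ?ltW// cbrtV// ck.
  rewrite /mode_freq -{1}(cbrt_3 (ltW e0)).
  have -> : 1 + om k * (chi ^+ 12 / cbrt eta) ^+ 2
     = (mode_root (om k * (chi ^+ 12) ^+ 2) eta / cbrt eta) ^+ 2.
    by rewrite !expr_div_n mode_root_2//; field; rewrite gt_eqF.
  rewrite sqrtr_sqr ger0_norm; last first.
    by rewrite divr_ge0 ?(ltW r0)// ltW// mode_root_gt0.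
  by field; rewrite gt_eqF.
have eigE z : eigenfun om f k z (eta / chi ^+ 36) =
    f k / k%:R `^ 6^-1 * (cbrt eta / chi ^+ 12) * airy (- airy_arg (om k) (chi ^+ 12) z eta).
  rewrite /eigenfun powR_23 ?divr_ge0 ?ltW// -/(cbrt _) cbrtM ?invr_ge0 ?ltW//.
  rewrite cbrtV// ck /airy_arg opprB; congr (_ * _).
  by rewrite mulrA mulrAC.
by rewrite /mode_kernel rhoE !eigE -c36.
Qed.

Definition re_part (psi : R -> R[i]) (v : R) : R := complex.Re (psi v).
Definition im_part (psi : R -> R[i]) (v : R) : R := complex.Im (psi v).

Hypothesis om_zeros : airy_zeros om.
Hypothesis f_norm : normalizing om f.
Variables (c d d2 : R).
Hypotheses (c0 : 0 < c) (cd : c <= d).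
Hypotheses (re1 : smooth (re_part psi1)) (im1 : smooth (im_part psi1)).
Hypotheses (re2 : smooth (re_part psi2)) (im2 : smooth (im_part psi2)).
Hypothesis psi1_supp : forall v, psi1 v != 0 -> c <= v <= d.
Hypothesis psi2_supp : forall v, psi2 v != 0 -> 0 <= v <= d2.

Let re2_supp v : re_part psi2 v != 0 -> 0 <= v <= d2.
Proof. by move=> h; apply: psi2_supp; apply: contra h => /eqP; rewrite /re_part => ->. Qed.

Let im2_supp v : im_part psi2 v != 0 -> 0 <= v <= d2.
Proof. by move=> h; apply: psi2_supp; apply: contra h => /eqP; rewrite /im_part => ->. Qed.

Let J u1 u2 chi t y a x s0 k :=
  mode_int c d u1 u2 (om k) (chi ^+ 12) t y a x s0 (mode_weight f k).

Let continuous_term u1 u2 chi t y a x s0 k : smooth u1 -> smooth u2 ->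
  (1 <= k)%N -> 0 < chi -> continuous_seg c d
    (mode_integrand u1 u2 (om k) (chi ^+ 12) t y a x s0 (mode_weight f k)).
Proof.
move=> s1 s2 k1 chi0 eta he; have e0 : 0 < eta by move: c0; lra.
have k0 : 0 < chi ^+ 12 by rewrite exprn_gt0.
have [p hp] := der_mode_integrand t y a x s0 (mode_weight f k) s1 s2 e0
  (airy_zeros_gt0 om_zeros f_norm k1) k0.
exact: der_continuous hp.
Qed.

(** The product of the exponential and the two complex cutoffs is expanded into real and imaginary
    parts, each a signed sum of four real oscillatory integrals. *)
Lemma mode_kernel_integral chi a t x y k : 0 < chi -> (1 <= k)%N ->
  Cintegral (mode_kernel om f psi1 psi2 a (chi ^+ 36) t x y k) =
  (J (re_part psi1) (re_part psi2) chi t y a x 0 k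
   - J (im_part psi1) (im_part psi2) chi t y a x 0 k
   - J (im_part psi1) (re_part psi2) chi t y a x (- (pi / 2)) k
   - J (re_part psi1) (im_part psi2) chi t y a x (- (pi / 2)) k) +i*
  (J (re_part psi1) (re_part psi2) chi t y a x (- (pi / 2)) k
   - J (im_part psi1) (im_part psi2) chi t y a x (- (pi / 2)) k
   + J (im_part psi1) (re_part psi2) chi t y a x 0 k
   + J (re_part psi1) (im_part psi2) chi t y a x 0 k).
Proof.
move=> chi0 k1; have om0 := airy_zeros_gt0 om_zeros f_norm k1.
have sinE (v : R) : cos (v - pi / 2) = sin v.
  by rewrite cosB sin_pihalf cos_pihalf mulr0 mulr1 add0r.
pose m u1 u2 s0 := mode_integrand u1 u2 (om k) (chi ^+ 12) t y a x s0 (mode_weight f k).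
have cm u1 u2 s0 : smooth u1 -> smooth u2 ->
    continuous_seg c d (m u1 u2 s0).
  by move=> s1 s2; exact: continuous_term.
have outside eta : ~~ (c <= eta <= d) ->
    mode_kernel om f psi1 psi2 a (chi ^+ 36) t x y k eta = 0.
  move=> he; have p0 : psi1 eta = 0.
    by apply/eqP; apply: contraNT he => /psi1_supp.
  by rewrite /mode_kernel p0 mulr0 !mul0r.
have inside eta : c <= eta <= d -> mode_kernel om f psi1 psi2 a (chi ^+ 36) t x y k eta =
    (m (re_part psi1) (re_part psi2) 0 eta - m (im_part psi1) (im_part psi2) 0 eta
     - m (im_part psi1) (re_part psi2) (- (pi / 2)) eta
     - m (re_part psi1) (im_part psi2) (- (pi / 2)) eta) +i*
    (m (re_part psi1) (re_part psi2) (- (pi / 2)) eta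
     - m (im_part psi1) (im_part psi2) (- (pi / 2)) eta
     + m (im_part psi1) (re_part psi2) 0 eta + m (re_part psi1) (im_part psi2) 0 eta).
  move=> he; have e0 : 0 < eta by move: c0; lra.
  rewrite mode_kernelE// /m /mode_integrand !sinE !addr0 /expi /re_part /im_part.
  case: (psi2 _) => A2 B2; case: (psi1 _) => A1 B1 /=; rewrite /mode_weight.
  by congr (_ +i* _); ring.
have c_rr s0 := cm _ _ s0 re1 re2; have c_ii s0 := cm _ _ s0 im1 im2.
have c_ir s0 := cm _ _ s0 im1 re2; have c_ri s0 := cm _ _ s0 re1 im2.
rewrite /Cintegral; congr (_ +i* _).
  rewrite (@Rintegral_support _ (fun eta =>
    m (re_part psi1) (re_part psi2) 0 eta - m (im_part psi1) (im_part psi2) 0 eta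
     - m (im_part psi1) (re_part psi2) (- (pi / 2)) eta
     - m (re_part psi1) (im_part psi2) (- (pi / 2)) eta) c d); last 2 first.
  - by move=> eta he; rewrite inside.
  - by move=> eta he; rewrite outside.
  rewrite Rintegral_segB//; last by do 2 apply: continuous_segB => //.
  by rewrite Rintegral_segB ?Rintegral_segB//; exact: continuous_segB.
rewrite (@Rintegral_support _ (fun eta =>
    m (re_part psi1) (re_part psi2) (- (pi / 2)) eta
     - m (im_part psi1) (im_part psi2) (- (pi / 2)) eta
     + m (im_part psi1) (re_part psi2) 0 eta + m (re_part psi1) (im_part psi2) 0 eta) c d); last 2 first.
- by move=> eta he; rewrite inside.
- by move=> eta he; rewrite outside.
rewrite Rintegral_segD//; last by apply: continuous_segD => //; exact: continuous_segB.
by rewrite Rintegral_segD ?Rintegral_segB//; exact: continuous_segB.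
Qed.

(** One factor [chi^(-36)] is the prefactor [1 / (2 pi h)], the other is the mode sum. The number of
    modes depends on [chi], but [mode_sum_bound] is uniform in it. *)
Lemma green_sum_bound : exists C : R, 0 < C /\
  forall chi a t x y, 0 < chi -> chi <= 1 -> 0 <= x -> x <= a -> a <= chi ^+ 18 ->
  let G := Cmodulus (green om f psi1 psi2 a (chi ^+ 36) t x y) in
  G <= C * chi ^- 72 /\
  (t != 0 -> G <= C * chi ^- 72 * (chi ^+ 9 + chi ^+ 12 / cbrt `|t|)).
Proof.
have [C1 [C10 h1]] := mode_sum_bound om_zeros f_norm c0 cd re1 re2 re2_supp.
have [C2 [C20 h2]] := mode_sum_bound om_zeros f_norm c0 cd im1 im2 im2_supp.
have [C3 [C30 h3]] := mode_sum_bound om_zeros f_norm c0 cd im1 re2 re2_supp.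
have [C4 [C40 h4]] := mode_sum_bound om_zeros f_norm c0 cd re1 im2 im2_supp.
pose C := C1 + C2 + C3 + C4.
exists (2 * C); split; first by rewrite mulr_gt0// /C !addr_gt0.
move=> chi a t x y chi0 chi1 x0 xa a_le.
have c36 : 0 < chi ^+ 36 by rewrite exprn_gt0.
have k0 : 0 < chi ^+ 12 by rewrite exprn_gt0.
set pre := 1 / (2 * pi * chi ^+ 36) : R.
have pre0 : 0 <= pre by rewrite divr_ge0 ?mulr_ge0 ?pi_ge0// ltW.
have pre_le : pre <= chi ^- 36.
  rewrite /pre div1r lef_pV2 ?posrE ?mulr_gt0 ?pi_gt0//.
  by rewrite ler_peMl ?(ltW c36)//; have := pi_ge2 R; lra.
have [K K1 hK] := gapped_unbounded (airy_zeros_gt0 om_zeros f_norm)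
  (airy_zeros_lt om_zeros) (airy_zeros_gap om_zeros f_norm)
  (((d2 / cbrt c ^+ 2) ^+ 2 + 1) / (chi ^+ 12) ^+ 2).
have big k : (K <= k)%N -> (d2 / cbrt c ^+ 2) ^+ 2 + 1 < om k * (chi ^+ 12) ^+ 2.
  by move=> /hK; rewrite ltr_pdivrMr// exprn_gt0.
pose z k : R[i] := pre%:C * Cintegral (mode_kernel om f psi1 psi2 a (chi ^+ 36) t x y k).
have zE k : (1 <= k)%N -> z k =
  (pre * (J (re_part psi1) (re_part psi2) chi t y a x 0 k
   - J (im_part psi1) (im_part psi2) chi t y a x 0 k
   - J (im_part psi1) (re_part psi2) chi t y a x (- (pi / 2)) k
   - J (re_part psi1) (im_part psi2) chi t y a x (- (pi / 2)) k)) +i*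
  (pre * (J (re_part psi1) (re_part psi2) chi t y a x (- (pi / 2)) k
   - J (im_part psi1) (im_part psi2) chi t y a x (- (pi / 2)) k
   + J (im_part psi1) (re_part psi2) chi t y a x 0 k
   + J (re_part psi1) (im_part psi2) chi t y a x 0 k)).
  move=> k1; rewrite /z mode_kernel_integral//=.
  by congr (_ +i* _); rewrite mul0r ?subr0 ?addr0.
have z0 k : (K <= k)%N -> z k = 0.
  move=> Kk; have k1 := leq_trans K1 Kk.
  have J0 u1 u2 s0 : (forall v, u2 v != 0 -> 0 <= v <= d2) -> J u1 u2 chi t y a x s0 k = 0.
    by move=> hu2; exact: (term_eq0 f d u1 c0 hu2 t y a x s0 k1 k0 (big k Kk)).
  rewrite zE//; do 4 (rewrite (J0 _ (re_part psi2))// (J0 _ (im_part psi2))//).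
  by rewrite !subr0 !addr0 mulr0.
have reE n : \sum_(1 <= k < n) complex.Re (z k) = pre *
  (\sum_(1 <= k < n) J (re_part psi1) (re_part psi2) chi t y a x 0 k
   - \sum_(1 <= k < n) J (im_part psi1) (im_part psi2) chi t y a x 0 k
   - \sum_(1 <= k < n) J (im_part psi1) (re_part psi2) chi t y a x (- (pi / 2)) k
   - \sum_(1 <= k < n) J (re_part psi1) (im_part psi2) chi t y a x (- (pi / 2)) k).
  rewrite -!sumrB mulr_sumr big_nat [RHS]big_nat; apply: eq_bigr => k /andP[k1 _].
  by rewrite zE.
have imE n : \sum_(1 <= k < n) complex.Im (z k) = pre *
  (\sum_(1 <= k < n) J (re_part psi1) (re_part psi2) chi t y a x (- (pi / 2)) k
   - \sum_(1 <= k < n) J (im_part psi1) (im_part psi2) chi t y a x (- (pi / 2)) k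
   + \sum_(1 <= k < n) J (im_part psi1) (re_part psi2) chi t y a x 0 k
   + \sum_(1 <= k < n) J (re_part psi1) (im_part psi2) chi t y a x 0 k).
  rewrite -sumrB -!big_split mulr_sumr big_nat [RHS]big_nat; apply: eq_bigr => k /andP[k1 _].
  by rewrite zE.
(* The partial sums are constant from [K] on, so the limit in [Cseries] is a finite sum. *)
have limE (g : R[i] -> R) : g 0 = 0 ->
    limn (fun n => \sum_(1 <= k < n) g (z k)) = \sum_(1 <= k < K) g (z k).
  move=> g0; apply: cvg_lim => //; apply: cvg_near_cst.
  exists K => // n /= Kn; rewrite (big_cat_nat K1 Kn) /=.
  rewrite [X in _ + X]big_nat [X in _ + X]big1 ?addr0// => k /andP[Kk _].
  by rewrite z0.
(* [B1] stands for either of the two bounds on the mode sums, so the passage from real sums to the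
   modulus is done once. *)
have key B1 : 0 <= B1 ->
  (forall s0, [/\ `|\sum_(1 <= k < K) J (re_part psi1) (re_part psi2) chi t y a x s0 k| <= C1 * B1,
    `|\sum_(1 <= k < K) J (im_part psi1) (im_part psi2) chi t y a x s0 k| <= C2 * B1,
    `|\sum_(1 <= k < K) J (im_part psi1) (re_part psi2) chi t y a x s0 k| <= C3 * B1 &
    `|\sum_(1 <= k < K) J (re_part psi1) (im_part psi2) chi t y a x s0 k| <= C4 * B1]) ->
  Cmodulus (green om f psi1 psi2 a (chi ^+ 36) t x y) <= 2 * C * (chi ^- 36 * B1).
  move=> B10 hB.
  have -> : green om f psi1 psi2 a (chi ^+ 36) t x y = Cseries z by [].
  rewrite /Cseries (limE (@complex.Re R))// (limE (@complex.Im R))// reE imE.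
  set X := pre * _; set Y := pre * _.
  have abs_le (v : R) : `|v| <= C * B1 -> `|pre * v| <= C * (chi ^- 36 * B1).
    move=> hv; rewrite normrM (ger0_norm pre0) mulrCA.
    by apply: ler_pM.
  have hX : `|X| <= C * (chi ^- 36 * B1).
    apply: abs_le; have [] := hB 0; have [] := hB (- (pi / 2)).
    by rewrite /C !ler_norml; lra.
  have hY : `|Y| <= C * (chi ^- 36 * B1).
    apply: abs_le; have [] := hB 0; have [] := hB (- (pi / 2)).
    by rewrite /C !ler_norml; lra.
  have : Cmodulus (X +i* Y) <= `|X| + `|Y|.
    rewrite /Cmodulus /= -[leRHS]ger0_norm ?addr_ge0// -sqrtr_sqr ler_wsqrtr//.
    rewrite sqrrD !real_normK ?num_real//.
    by have : 0 <= `|X| * `|Y| by []; lra.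
  lra.
have c72 : chi ^- 36 * chi ^- 36 = chi ^- 72 by field; rewrite gt_eqF.
have i36 : 0 < chi ^- 36 by rewrite invr_gt0.
split.
  rewrite -c72; apply: key => [|s0]; first exact: ltW.
  have [b1 _] := h1 chi t y a x s0 K chi0 chi1 x0 xa a_le.
  have [b2 _] := h2 chi t y a x s0 K chi0 chi1 x0 xa a_le.
  have [b3 _] := h3 chi t y a x s0 K chi0 chi1 x0 xa a_le.
  have [b4 _] := h4 chi t y a x s0 K chi0 chi1 x0 xa a_le.
  by split.
move=> t0; rewrite -c72 -mulrA -[chi ^- 36 * _ * _]mulrA; apply: key => [|s0].
  rewrite mulr_ge0 ?(ltW i36)// addr_ge0 ?exprn_ge0 ?(ltW chi0)//.
  by rewrite divr_ge0 ?(ltW k0)// powR_ge0.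
have [_ /(_ t0) b1] := h1 chi t y a x s0 K chi0 chi1 x0 xa a_le.
have [_ /(_ t0) b2] := h2 chi t y a x s0 K chi0 chi1 x0 xa a_le.
have [_ /(_ t0) b3] := h3 chi t y a x s0 K chi0 chi1 x0 xa a_le.
have [_ /(_ t0) b4] := h4 chi t y a x s0 K chi0 chi1 x0 xa a_le.
by split; rewrite mulrA.
Qed.

End Kernel.

End GreenBound.

(** The complement of [Omega] is null for the restricted measure, so a pointwise bound on [Omega]
    suffices; [0 <= X] covers the degenerate branch in the definition of the norm. *)
Lemma LinftyOmega_le (R : realType) (v : R -> R -> complex R) (X : \bar R) :
  (0 <= X)%E -> (forall x y, 0 < x -> ((Cmodulus (v x y))%:E <= X)%E) ->
  (LinftyOmega v <= X)%E.
Proof.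
move=> X0 hv; rewrite /LinftyOmega unlock; case: ifP => // _.
apply/ess_sup_inf.ess_supP; exists (~` Omega); split.
- by apply: measurableC; exact: measurable_Omega.
- change ((lebesgue_measure \x lebesgue_measure)%E (~` @Omega R `&` Omega) = 0%E).
  by rewrite setICl measure0.
move=> [x y] /=; apply: contra_not => Oxy.
by rewrite ger0_norm ?sqrtr_ge0 ?hv//; case: (v x y) => *; exact: sqrtr_ge0.
Qed.

Theorem proposition3p4 (R : realType) (om f : nat -> R)
    (om_zeros : airy_zeros om) (f_normalizing : normalizing om f) :
  exists eps0 : R, 0 < eps0 /\
  forall (eps : R) (psi1 psi2 : R -> complex R),
    0 < eps <= eps0 ->
    test_function_pos psi1 -> test_function_pos psi2 ->
    mode_cutoff om eps psi1 psi2 ->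
  exists C : R,
  forall h a t : R,
    0 < h <= 1 -> 0 < a <= h `^ (1 / 2) -> -1 <= t <= 1 ->
    (LinftyOmega (fun x y : R =>
        if (x <= a)%R then green om f psi1 psi2 a h t x y else 0%R)
     <= (C * h ^- 2)%:E *
        mine 1 ((h `^ (1 / 4))%:E + (h%:E / `|t|%:E) `^ (1 / 3)))%E.
Proof.
exists 1; split=> // eps psi1 psi2 _ [re1 im1 [c1 [d1 [c1_gt0 supp1]]]]
  [re2 im2 [c2 [d2 [c2_gt0 supp2]]]] _.
have cd : c1 <= Num.max c1 d1 by rewrite le_max lexx.
have supp1' v : psi1 v != 0 -> c1 <= v <= Num.max c1 d1.
  by move=> /supp1/andP[h1 h2]; rewrite h1 le_max h2 orbT.
have supp2' v : psi2 v != 0 -> 0 <= v <= d2.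
  by move=> /supp2/andP[h1 h2]; rewrite h2 andbT (le_trans (ltW c2_gt0)).
have [C [C0 hC]] := green_sum_bound om_zeros f_normalizing c1_gt0 cd
  re1 im1 re2 im2 supp1' supp2'.
exists C => h a t /andP[h0 h1] /andP[a0 ah] _.
pose chi := h `^ 36^-1.
have chi0 : 0 < chi by exact: powR_gt0.
have chiX n : chi ^+ n = h `^ (n%:R / 36).
  by rewrite -powR_mulrn ?powR_ge0// -powRrM mulrC.
have hE : h = chi ^+ 36 by rewrite chiX divff ?powRr1// ltW.
have chi1 : chi <= 1.
  by rewrite -(@ler_pXn2r _ 36)// ?nnegrE ?(ltW chi0)// -hE expr1n.
have a18 : a <= chi ^+ 18 by rewrite chiX (_ : 18 / 36 = 1 / 2)//; field.
have e9 : h `^ (1 / 4) = chi ^+ 9 by rewrite chiX; congr (_ `^ _); field.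
have e72 : h ^- 2 = chi ^- 72 by rewrite hE -exprM.
set X : \bar R := (_ * _)%E.
have Ch0 : 0 <= C * h ^- 2 by rewrite mulr_ge0 ?(ltW C0)// invr_ge0 exprn_ge0// ltW.
(* At [t = 0] the extended quotient [h / |t|] is [+oo], so the minimum is 1 and the first bound of
   [hC] is the one to use. *)
have [XE|[t0 XE]] : X = (C * h ^- 2)%:E \/ t != 0 /\
    X = (C * h ^- 2 * Num.min 1 (chi ^+ 9 + chi ^+ 12 / cbrt `|t|))%:E.
  rewrite /X; have [->|t0] := eqVneq t 0; [left|right].
    rewrite normr0 inve0 gt0_muley ?lte_fin// poweRyr; last by rewrite mul1r invr_eq0.
    by rewrite addey// /mine ltry mule1.
  split=> //; rewrite inver normr_eq0 (negbTE t0) -EFinM poweR_EFin e9.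
  rewrite (_ : (h / `|t|) `^ (1 / 3) = chi ^+ 12 / cbrt `|t|); last first.
    rewrite mul1r -/(cbrt _) cbrtM ?invr_ge0 ?(ltW h0)// cbrtV ?normr_gt0//; congr (_ / _).
    by rewrite hE (_ : chi ^+ 36 = (chi ^+ 12) ^+ 3) ?cbrtX ?exprn_ge0 ?(ltW chi0)// -exprM.
  by rewrite -EFinD -EFin_min -EFinM.
- apply: LinftyOmega_le => [|x y x0]; rewrite XE lee_fin//.
  case: ifP => [xa|_]; last by rewrite /Cmodulus ComplexField.Normc.normc0.
  rewrite {1}hE e72.
  by have [] := hC chi a t x y chi0 chi1 (ltW x0) xa a18.
- have m0 : 0 <= Num.min 1 (chi ^+ 9 + chi ^+ 12 / cbrt `|t|).
    rewrite le_min ler01 addr_ge0 ?exprn_ge0 ?(ltW chi0)//.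
    by rewrite divr_ge0 ?exprn_ge0 ?(ltW chi0)// powR_ge0.
  have X0 : 0 <= C * h ^- 2 * Num.min 1 (chi ^+ 9 + chi ^+ 12 / cbrt `|t|).
    by rewrite mulr_ge0.
  apply: LinftyOmega_le => [|x y x0]; rewrite XE lee_fin//.
  case: ifP => [xa|_]; last by rewrite /Cmodulus ComplexField.Normc.normc0.
  rewrite {1}hE e72.
  have [g1 /(_ t0) g2] := hC chi a t x y chi0 chi1 (ltW x0) xa a18.
  by rewrite minElt; case: ifP => _; rewrite ?mulr1.
Qed.
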